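(* Let $(M,c)$ be a Riemannian conformal structure on a $2$-dimensional manifold $M$, let $g\in c$, let $\alpha\colon\mathbb{R}\to\mathcal{T}_{(1,1)}M$ be an admissible smooth $1$-parameter family with $\mathrm{trace}(\dot\alpha(0))=\mathrm{scal}^g$, let $(\widetilde M,\widetilde g)$ be the Lorentzian manifold constructed from $g$ and $\alpha$, and let $D$ be the Möbius structure for $(M,c)$ given by $D(e^{2u}g)=e^{2u}g(A_{\eta^u}(-),-)$, $u\in C^\infty(M)$. Then the Möbius structure $(M,c,D)$ is flat if and only if for every $u\in C^\infty(M)$ the immersion $\Psi^u\colon M\to(\widetilde M,\widetilde g)$, $\Psi^u(x)=(e^{u(x)},0,x)$, is such that the curvature tensor $\widetilde R$ of $(\widetilde M,\widetilde g)$ satisfies that $$\widetilde R(T\Psi^u\cdot U,T\Psi^u\cdot V)\,T\Psi^u\cdot W$$ is tangent to $\Psi^u$ (i.e. lies in the image of $\mathfrak{X}(M)$ under $T\Psi^u$) for all $U,V,W\in\mathfrak{X}(M)$.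
   Context: Manifolds are smooth, Hausdorff, second countable, without boundary. A Riemannian conformal structure $(M,c)$ is an equivalence class $c$ of Riemannian metrics on $M$, where $g\sim g'$ iff $g'=e^{2u}g$ for some $u\in C^\infty(M)$. $\mathcal{T}_{(1,1)}M$ denotes the endomorphism fields of $TM$ and $\mathcal{T}_{(0,2)}M$ the covariant 2-tensor fields. $\mathrm{scal}^g$ is the scalar curvature. Möbius structure (dimension $2$). A map $D\colon c\to\mathcal{T}_{(0,2)}M$ such that for every $g\in c$, $D(g)$ is symmetric with $\mathrm{trace}_gD(g)=\frac{\mathrm{scal}^g}{2}$, and $D(e^{2u}g)=D(g)-\frac{\|\nabla^gu\|_g^2}{2}g-\mathrm{Hess}^g(u)+du\otimes du$ for all $u\in C^\infty(M)$. Let $\widehat D(g)$ be defined by $D(g)(V,W)=g(\widehat D(g)(V),W)$. The Cotton–York tensor of $D$ for $g\in c$ is $$C(g)(U,V,W)=g\big((\nabla^g_U\widehat D(g))(V)-(\nabla^g_V\widehat D(g))(U),W\big),$$ and $(M,c,D)$ is flat when $C(g)=0$ for every $g\in c$. Admissible family. A smooth $1$-parameter family $\alpha\colon\mathbb{R}\to\mathcal{T}_{(1,1)}M$ (with derivative $\dot\alpha(\rho)$ in $\rho$) is admissible if each $\alpha(\rho)$ is self-adjoint with respect to any $g\in c$, $\alpha(0)=\mathrm{Id}$, and there is $\delta>0$ such that $\alpha(\rho)$ is nonsingular for $|\rho|<\delta$. Construction. $\widetilde M=\mathbb{R}^+\times(-\delta,\delta)\times M$ with coordinates $(t,\rho)$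 on the first two factors, and $$\widetilde g=d(\rho t)\otimes dt+dt\otimes d(\rho t)+t^2\,g(\alpha(\rho)(-),-),$$ a Lorentzian metric. The immersion $\Psi^u$ is spacelike with $(\Psi^u)^*\widetilde g=e^{2u}g$, and has the lightlike normal field $$\eta^u=e^{-u}\tfrac{\|\nabla^gu\|_g^2}{2}\,\partial_t|_{\Psi^u}-e^{-2u}\partial_\rho|_{\Psi^u}+e^{-2u}\nabla^gu|_{\Psi^u},$$ where a vector field on $M$ is identified with its natural lift to $\widetilde M$ and $X|_{\Psi^u}=X\circ\Psi^u$. The Weingarten endomorphism is defined by $(\widetilde\nabla_V\eta^u)^\top=-T\Psi^u\cdot A_{\eta^u}V$, $\widetilde\nabla$ being induced by the Levi-Civita connection of $\widetilde g$ and $\top$ denoting the tangential part. It is a fact that $D$ as in the claim is a Möbius structure. *)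

(* Defs.v *)
From HB Require Import structures.
From mathcomp Require Import all_boot all_order all_algebra.
From mathcomp Require Import all_classical all_reals all_analysis.

Set Implicit Arguments.
Unset Strict Implicit.
Unset Printing Implicit Defensive.

Import Order.TTheory GRing.Theory Num.Theory numFieldNormedType.Exports.

Local Open Scope classical_set_scope.
Local Open Scope ring_scope.

(* MathComp-Analysis has no manifolds; this file sets up, in charts, the part  *)
(* of (pseudo-)Riemannian geometry that is needed.  Vectors are row vectors,   *)
(* so that an endomorphism E acts by v |-> v *m E and a bilinear form G is     *)
(* (v, w) |-> v *m G *m w^T.                                                   *)

Section SmoothFunctions.
Context {R : realType}.

Fixpoint Ck_on n (k : nat) (A : set 'rV[R]_n) (f : 'rV[R]_n -> R) : Prop :=
  (forall y, A y -> {for y, continuous f}) /\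
  if k is k'.+1 then
    forall i : 'I_n,
      (forall y, A y -> derivable f y (delta_mx 0 i)) /\
      Ck_on k' A (fun y => 'D_(delta_mx 0 i) f y)
  else True.

(* Meant for open A. *)
Definition smooth_on n (A : set 'rV[R]_n) (f : 'rV[R]_n -> R) : Prop :=
  forall k, Ck_on k A f.

End SmoothFunctions.

(* A space with an atlas of charts to R^n; `param a` inverts `chart_map a` on   *)
(* the open set `dom a` (see smooth_manifold) and is junk off `img a`.         *)
(* Each point x comes with a preferred chart `chart_at x` around it, and the   *)
(* tangent space at x is identified with 'rV_n through that chart: a tangent   *)
(* vector at x *is* its row of components in `chart_at x`.                     *)
Record chartedSpace (R : realType) (n : nat) := ChartedSpace {
  carrier :> topologicalType ;
  chart : Type ;
  chart_at : carrier -> chart ;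
  dom : chart -> set carrier ;
  chart_map : chart -> carrier -> 'rV[R]_n ;
  param : chart -> 'rV[R]_n -> carrier }.

Definition img (R : realType) n (M : chartedSpace R n) (a : chart M) :
  set 'rV[R]_n := chart_map a @` dom a.

Record smooth_manifold (R : realType) n (M : chartedSpace R n) : Prop := {
  manifold_hausdorff : hausdorff_space M ;
  manifold_second_countable : @second_countable M ;
  manifold_cover : forall x : M, dom (chart_at x) x ;
  manifold_open_dom : forall a : chart M, open (dom a) ;
  manifold_open_img : forall a : chart M, open (img a) ;
  manifold_coordK : forall (a : chart M) x, dom a x -> param a (chart_map a x) = x ;
  manifold_coord_continuous :
    forall (a : chart M) x, dom a x -> {for x, continuous (chart_map a)} ;
  manifold_param_continuous :
    forall (a : chart M) y, img a y -> {for y, continuous (param a)} ;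
  manifold_compatible : forall (a b : chart M) (j : 'I_n),
    smooth_on (chart_map a @` (dom a `&` dom b))
              (fun y => chart_map b (param a y) 0 j) }.

Section Calculus.
Context {R : realType} {n : nat} {M : chartedSpace R n}.

Definition smooth_in (a : chart M) (f : M -> R) : Prop :=
  smooth_on (img a) (f \o param a).

Definition smooth_fun (f : M -> R) : Prop := forall a, smooth_in a f.

(* The coordinate derivative d f / d x^i in the chart a, as a function on M. *)
Definition pder (a : chart M) (i : 'I_n) (f : M -> R) (x : M) : R :=
  'D_(delta_mx 0 i) (f \o param a) (chart_map a x).

(* The covector d f at x; it pairs with v as v *m differential f x. *)
Definition differential (f : M -> R) (x : M) : 'cV[R]_n :=
  \col_i pder (chart_at x) i f x.

End Calculus.

Section Maps.
Context {R : realType} {m n : nat}.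
Context {N : chartedSpace R m} {M : chartedSpace R n}.

(* Acts on row vectors: (v *m jac) j = sum_i v^i d(F^j)/d x^i. *)
Definition jac (F : N -> M) (a : chart N) (b : chart M) (x : N) :
    'M[R]_(m, n) :=
  \matrix_(i, j) pder a i (fun y => chart_map b (F y) 0 j) x.

Definition tangent_map (F : N -> M) (x : N) : 'M[R]_(m, n) :=
  jac F (chart_at x) (chart_at (F x)) x.

End Maps.

Section Tensors.
Context {R : realType} {n : nat} {M : chartedSpace R n}.

Definition trans (a b : chart M) (x : M) : 'M[R]_n := jac id a b x.

(* Components in the chart a of tensors at x given in chart_at x. *)
Definition vec_in (a : chart M) (x : M) (v : 'rV[R]_n) : 'rV[R]_n :=
  v *m trans (chart_at x) a x.

Definition form_in (a : chart M) (x : M) (T : 'M[R]_n) : 'M[R]_n :=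
  trans a (chart_at x) x *m T *m (trans a (chart_at x) x)^T.

Definition endo_in (a : chart M) (x : M) (E : 'M[R]_n) : 'M[R]_n :=
  trans a (chart_at x) x *m E *m trans (chart_at x) a x.

Definition vector_field (X : M -> 'rV[R]_n) : Prop :=
  forall a j, smooth_in a (fun x => vec_in a x (X x) 0 j).

Definition tensor02 (T : M -> 'M[R]_n) : Prop :=
  forall a i j, smooth_in a (fun x => form_in a x (T x) i j).

(* Jointly smooth in the parameter and the point. *)
Definition tensor11_family (E : R -> M -> 'M[R]_n) : Prop :=
  forall a i j,
    smooth_on [set y : 'rV[R]_(1 + n) | img a (rsubmx y)]
      (fun y => let x := param a (rsubmx y) in
                endo_in a x (E (lsubmx y 0 0) x) i j).

Definition inner (G : 'M[R]_n) (v w : 'rV[R]_n) : R := (v *m G *m w^T) 0 0.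

Definition riemannian (g : M -> 'M[R]_n) : Prop :=
  [/\ tensor02 g, (forall x, (g x)^T = g x) &
      forall x v, v != 0 -> 0 < inner (g x) v v].

End Tensors.

Section LeviCivita.
Context {R : realType} {n : nat} {M : chartedSpace R n}.
(* A pseudo-Riemannian metric. *)
Variable G : M -> 'M[R]_n.

(* Christoffel symbol Gamma^k_ij of the Levi-Civita connection, chart a. *)
Definition christoffel (a : chart M) (i j k : 'I_n) (x : M) : R :=
  let h i j := fun y => form_in a y (G y) i j in
  2^-1 * \sum_l invmx (form_in a x (G x)) k l *
    (pder a i (h j l) x + pder a j (h i l) x - pder a l (h i j) x).

(* R(v,w)z = nabla_v nabla_w z - nabla_w nabla_v z - nabla_[v,w] z. *)
Definition riemann (x : M) (v w z : 'rV[R]_n) : 'rV[R]_n :=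
  let a := chart_at x in
  let Gam i j k := christoffel a i j k in
  \row_l \sum_i \sum_j \sum_k v 0 i * w 0 j * z 0 k *
    (pder a i (Gam j k l) x - pder a j (Gam i k l) x +
     \sum_p (Gam j k p x * Gam i p l x - Gam i k p x * Gam j p l x)).

Definition ricci (x : M) : 'M[R]_n :=
  \matrix_(j, k) \sum_i
    riemann x (delta_mx 0 i) (delta_mx 0 j) (delta_mx 0 k) 0 i.

(* Raises the second index: inner (G x) (v *m sharp T x) w = v *m T x *m w^T. *)
Definition sharp (T : M -> 'M[R]_n) (x : M) : 'M[R]_n := T x *m invmx (G x).

Definition trace_form (T : M -> 'M[R]_n) (x : M) : R := \tr (sharp T x).

Definition scal (x : M) : R := trace_form ricci x.

Definition gradient (u : M -> R) (x : M) : 'rV[R]_n :=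
  (differential u x)^T *m invmx (G x).

Definition grad_sqnorm (u : M -> R) (x : M) : R :=
  inner (G x) (gradient u x) (gradient u x).

(* The connection induced along F : N -> M: the derivative in the direction v  *)
(* at x of a vector field Y along F (Y y is tangent to M at F y).              *)
Definition cov_along m (N : chartedSpace R m) (F : N -> M)
    (Y : N -> 'rV[R]_n) (x : N) (v : 'rV[R]_m) : 'rV[R]_n :=
  let b := chart_at (F x) in
  \row_k (\sum_i v 0 i * pder (chart_at x) i (fun y => vec_in b (F y) (Y y) 0 k) x
    + \sum_i \sum_j christoffel b i j k (F x)
        * (v *m tangent_map F x) 0 i * Y x 0 j).

Definition cov (X Y : M -> 'rV[R]_n) (x : M) : 'rV[R]_n :=
  cov_along id Y x (X x).

(* Hess u (v, w) = G(nabla_v grad u, w). *)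
Definition hessian (u : M -> R) (x : M) : 'M[R]_n :=
  (\matrix_i cov_along id (gradient u) x (delta_mx 0 i)) *m G x.

(* (nabla_X E)(Y) for an endomorphism field E. *)
Definition cov_endo (X : M -> 'rV[R]_n) (E : M -> 'M[R]_n)
    (Y : M -> 'rV[R]_n) (x : M) : 'rV[R]_n :=
  cov X (fun y => Y y *m E y) x - cov X Y x *m E x.

(* For an immersion F : N -> M with nondegenerate induced metric T G T^T,      *)
(* where T := tangent_map F x: the vector of N whose image under T is the      *)
(* G-orthogonal projection of z, tangent to M at F x, onto the image of T.     *)
Definition tangential m (N : chartedSpace R m) (F : N -> M) (x : N)
    (z : 'rV[R]_n) : 'rV[R]_m :=
  let T := tangent_map F x in
  z *m G (F x) *m T^T *m invmx (T *m G (F x) *m T^T).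

(* Weingarten endomorphism: (nabla_v eta)^top = - (A v) *m tangent_map F. *)
Definition weingarten m (N : chartedSpace R m) (F : N -> M)
    (eta : N -> 'rV[R]_n) (x : N) : 'M[R]_m :=
  \matrix_i - tangential F x (cov_along F eta x (delta_mx 0 i)).

End LeviCivita.

Section Conformal.
Context {R : realType}.

Section AnyDimension.
Context {n : nat} {M : chartedSpace R n}.

Definition rescale (u : M -> R) (g : M -> 'M[R]_n) (x : M) : 'M[R]_n :=
  expR (2 * u x) *: g x.

Definition conformal_structure (c : set (M -> 'M[R]_n)) : Prop :=
  exists2 g, riemannian g &
    c = [set h | exists2 u, smooth_fun u & h = rescale u g].

(* alpha is considered as a curve of endomorphism fields. *)
Definition alpha_dot (alpha : R -> M -> 'M[R]_n) (rho : R) (x : M) : 'M[R]_n :=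
  derive1 (fun r => alpha r x) rho.

Definition nonsingular_upto (alpha : R -> M -> 'M[R]_n) (delta : R) : Prop :=
  forall rho x, `|rho| < delta -> alpha rho x \in unitmx.

Definition admissible (c : set (M -> 'M[R]_n)) (alpha : R -> M -> 'M[R]_n) :
    Prop :=
  [/\ tensor11_family alpha,
      forall h, c h -> forall rho x v w,
        inner (h x) (v *m alpha rho x) w = inner (h x) v (w *m alpha rho x),
      forall x, alpha 0 x = 1%:M &
      exists2 delta, 0 < delta & nonsingular_upto alpha delta].

End AnyDimension.

Context {M : chartedSpace R 2}.

Record mobius_structure (c : set (M -> 'M[R]_2))
    (D : (M -> 'M[R]_2) -> (M -> 'M[R]_2)) : Prop := {
  mobius_tensor : forall g, c g -> tensor02 (D g) ;
  mobius_sym : forall g, c g -> forall x, (D g x)^T = D g x ;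
  mobius_trace : forall g, c g -> forall x, trace_form g (D g) x = scal g x / 2 ;
  mobius_rescale : forall g, c g -> forall u, smooth_fun u -> forall x,
    D (rescale u g) x =
      D g x - (grad_sqnorm g u x / 2) *: g x - hessian g u x
      + differential u x *m (differential u x)^T }.

Definition cotton_york (D : (M -> 'M[R]_2) -> (M -> 'M[R]_2))
    (g : M -> 'M[R]_2) (U V W : M -> 'rV[R]_2) (x : M) : R :=
  let Dhat := sharp g (D g) in
  inner (g x) (cov_endo g U Dhat V x - cov_endo g V Dhat U x) (W x).

Definition mobius_flat (c : set (M -> 'M[R]_2))
    (D : (M -> 'M[R]_2) -> (M -> 'M[R]_2)) : Prop :=
  forall g, c g -> forall U V W,
    vector_field U -> vector_field V -> vector_field W ->
    forall x, cotton_york D g U V W x = 0.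

End Conformal.

Section Products.
Context {R : realType}.

(* A subset of the real line with its single chart; a0 only serves to make     *)
(* `param` total.  It is a 1-manifold when A is open.                          *)
Definition line (A : set R) (a0 : A) : chartedSpace R 1 :=
  @ChartedSpace R 1 (set_type A) unit (fun=> tt) (fun=> setT)
    (fun _ t => (set_val t)%:M) (fun _ y => insubd a0 (y 0 0)).

Definition product m n (N : chartedSpace R m) (M : chartedSpace R n) :
    chartedSpace R (m + n) :=
  @ChartedSpace R (m + n) (N * M)%type (chart N * chart M)%type
    (fun p => (chart_at p.1, chart_at p.2))
    (fun ab => dom ab.1 `*` dom ab.2)
    (fun ab p => row_mx (chart_map ab.1 p.1) (chart_map ab.2 p.2))
    (fun ab y => (param ab.1 (lsubmx y), param ab.2 (rsubmx y))).

Definition positive : set R := [set t | 0 < t].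
Definition symmetric_interval (delta : {posnum R}) : set R :=
  [set rho | `|rho| < delta%:num].

Lemma expR_positive (s : R) : expR s \in positive.
Proof. exact/mem_set/expR_gt0. Qed.

Lemma zero_in_interval (delta : {posnum R}) : 0 \in symmetric_interval delta.
Proof. by apply/mem_set; rewrite /symmetric_interval/= normr0. Qed.

Definition mk_positive (s : R) : positive := exist _ (expR s) (expR_positive s).

Definition mk_zero delta : symmetric_interval delta :=
  exist _ 0 (zero_in_interval delta).

End Products.

Section Ambient.
Context {R : realType} {n : nat} {M : chartedSpace R n}.
Variable delta : {posnum R}.

(* R^+ x (-delta, delta) x M; in its preferred charts a tangent vector is      *)
(* row_mx (row_mx t-component rho-component) (component tangent to M).         *)
Definition ambient : chartedSpace R (1 + 1 + n) :=
  product (product (line (mk_positive 0)) (line (mk_zero delta))) M.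

Definition t_ (p : ambient) : R := set_val p.1.1.
Definition rho_ (p : ambient) : R := set_val p.1.2.

(* d(rho t) (x) dt + dt (x) d(rho t) + t^2 g(alpha(rho) -, -) *)
Definition ambient_metric (g : M -> 'M[R]_n) (alpha : R -> M -> 'M[R]_n)
    (p : ambient) : 'M[R]_(1 + 1 + n) :=
  let dt := differential t_ p in
  let drhot := differential (fun q => rho_ q * t_ q) p in
  drhot *m dt^T + dt *m drhot^T
  + block_mx 0 0 0 (t_ p ^+ 2 *: (alpha (rho_ p) p.2 *m g p.2)).

Definition Psi (u : M -> R) (x : M) : ambient :=
  (mk_positive (u x), mk_zero delta, x).

Definition eta (g : M -> 'M[R]_n) (u : M -> R) (x : M) : 'rV[R]_(1 + 1 + n) :=
  row_mx (row_mx (expR (- u x) * (grad_sqnorm g u x / 2))%:M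
                 (- expR (- (2 * u x)))%:M)
         (expR (- (2 * u x)) *: gradient g u x).

(* e^{2u} g(A_{eta^u} -, -) *)
Definition mobius_of (g : M -> 'M[R]_n) (alpha : R -> M -> 'M[R]_n)
    (u : M -> R) (x : M) : 'M[R]_n :=
  weingarten (ambient_metric g alpha) (Psi u) (eta g u) x *m rescale u g x.

End Ambient.

(* Main.v *)
(* At rho = 0 the Christoffel symbols of the ambient metric are explicit in terms
   of t, g and the derivative of alpha at 0.  Writing B for the latter, lowered
   with g, the Weingarten endomorphism of Psi^0 gives D(g) = B / 2.  The
   curvature vanishes in the direction d/dt, and so depends on Psi^u only
   through t = e^u; in dimension 2, where the curvature of g is determined by
   scal^g = 2 trace D(g), the part of R(TU, TV)TW tangent to M is zero, and what
   remains is
     R(TU, TV)TW = - e^u C(g)(U, V, W) d/dt.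
   Since d/dt is not tangent to Psi^u, tangency for one u, or for all u, is the
   vanishing of C(g).  Finally the Moebius law and trace D(g) = scal^g / 2 make
   C conformally invariant in dimension 2: C(e^(2u) g) = C(g).  No bump
   functions are needed because these are identities for fixed fields U, V, W. *)
Require Import Defs.
From HB Require Import structures.
From mathcomp Require Import all_boot all_order all_algebra.
From mathcomp Require Import all_classical all_reals all_analysis.
From mathcomp Require Import ring lra.
Set Implicit Arguments.
Unset Strict Implicit.
Unset Printing Implicit Defensive.
Import Order.TTheory GRing.Theory Num.Theory numFieldNormedType.Exports.
Local Open Scope classical_set_scope.
Local Open Scope ring_scope.

(** * Calculus on R^n *)

(** The obstacle is that a tensor is stored at each point in the frame of that point's preferred
    chart, a choice that may jump from point to point: nothing can be differentiated before it is
    carried into one fixed chart. Hence the chain rule between charts and the tensoriality of the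
    Hessian. Smoothness is phrased by iterated partial derivatives, so the symmetry of second
    derivatives and the differentiability of C^1 functions are derived from the mean value theorem.

    The hypersurface [rho] = 0 suffices because TU, TV, TW have no [rho] component: their curvature
    differentiates Christoffel symbols only along that hypersurface, so only the first
    [rho]-derivative of the metric enters. There the parts of the curvature along M, d/dt and d/drho
    are a Gauss equation, the Codazzi equation of B and that of g; the last is empty because g is
    parallel. Smoothness and symmetry of B are inherited from D(g) = B / 2.

    Pointwise claims become polynomial identities between values and derivatives; lowering indices
    keeps the inverse metric out of them. *)

Section RowCalculus.
Context {R : realType} {n : nat}.
Implicit Types (f g : 'rV[R]_n -> R) (y v : 'rV[R]_n) (A : set 'rV[R]_n).

(** Both quotients are the same function of [r], so derivability and derivatives transfer along a
    line by mere rewriting. This puts directional derivatives within reach of the one-variable mean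
    value theorem. *)
Lemma line_growth_rate f y v (s : R) :
  (fun r : R => r^-1 *: (((fun r => f (y + r *: v)) \o shift s) (r *: 1)
            - f (y + s *: v))) =
  (fun r => r^-1 *: ((f \o shift (y + s *: v)) (r *: v) - f (y + s *: v))).
Proof.
apply/funext => r /=; congr (_ *: (f _ - _)).
by rewrite scalerDl [r *: 1]mulr1 addrCA.
Qed.

Lemma line_derivable f y v (s : R) :
  derivable (fun r : R => f (y + r *: v)) s 1 = derivable f (y + s *: v) v.
Proof. by rewrite /derivable line_growth_rate. Qed.

Lemma line_derive f y v (s : R) :
  'D_1 (fun r : R => f (y + r *: v)) s = 'D_v f (y + s *: v).
Proof. by rewrite /derive line_growth_rate. Qed.

Lemma line_is_derive f y v (s : R) :
  derivable f (y + s *: v) v ->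
  is_derive s 1 (fun r : R => f (y + r *: v)) ('D_v f (y + s *: v)).
Proof. by split; rewrite ?line_derivable ?line_derive. Qed.

Lemma derive_translate f (c y v : 'rV[R]_n) :
  'D_v (fun z => f (z + c)) y = 'D_v f (y + c).
Proof.
rewrite /derive; congr (lim (_ @ 0^')); apply/funext => s /=.
by rewrite addrA.
Qed.

Lemma derivable_translate f (c y v : 'rV[R]_n) :
  derivable f (y + c) v -> derivable (fun z => f (z + c)) y v.
Proof.
rewrite /derivable; set p := (fun s : R => _); set q := (fun s : R => _).
suff -> : q = p by [].
by apply/funext => s; rewrite /p /q /= addrA.
Qed.

(* Unification otherwise unfolds derivatives to limits along filters and diverges. *)
Opaque derive derivable.

(** The increment [r] may have either sign or vanish, which is why the bounds are in absolute value;
    the two signs use the intervals [[0, r]] and [[r, 0]]. *)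
Lemma mvt_line f y v (r : R) :
  (forall s, `|s| <= `|r| -> derivable f (y + s *: v) v) ->
  exists2 s, `|s| <= `|r| &
    f (y + r *: v) - f y = r * 'D_v f (y + s *: v).
Proof.
move=> df; pose phi s := f (y + s *: v); pose dphi s := 'D_v f (y + s *: v).
have cont (a b : R) : (forall s, s \in `[a, b] -> `|s| <= `|r|) ->
    {within `[a, b], continuous phi}.
  move=> ab; apply: continuous_in_subspaceT => s /set_mem /= sab.
  apply: differentiable_continuous; apply/derivable1_diffP.
  have sr : `|s| <= `|r| by exact: ab.
  by case: (line_is_derive (df s sr)).
have [r0|r0|->] := ltgtP r 0; last first.
- by exists 0; rewrite ?normr0// !scale0r addr0 mul0r subrr.
- have sub s : s \in `[0, r] -> `|s| <= `|r|.
    by rewrite in_itv/= => /andP[s0 sr]; rewrite !ger0_norm// ltW.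
  have [s|s sr] := @MVT R phi dphi 0 r r0 _ (cont _ _ sub).
    by move=> /subset_itv_oo_cc/sub/df/line_is_derive.
  rewrite /phi/= scale0r addr0 subr0 mulrC => ->; exists s => //.
  exact/sub/subset_itv_oo_cc.
- have sub s : s \in `[r, 0] -> `|s| <= `|r|.
    by rewrite in_itv/= => /andP[s0 sr]; rewrite !ler0_norm ?lerN2// ltW.
  have [s|s sr] := @MVT R phi dphi r 0 r0 _ (cont _ _ sub).
    by move=> /subset_itv_oo_cc/sub/df/line_is_derive.
  rewrite /phi/= scale0r addr0 sub0r => E; exists s; first exact/sub/subset_itv_oo_cc.
  by rewrite -[LHS]opprB E mulrN opprK mulrC.
Qed.

(** The second difference is the increment along [v] of the single function [g], the increment of
    [f] along [w]. The mean value theorem is applied to [g] in direction [v], then to the derivative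
    ['D_v f] in direction [w]. *)
Lemma mixed_difference f y v w (r : R) :
  (forall s s', `|s| <= `|r| -> `|s'| <= `|r| ->
     derivable f (y + s *: v + s' *: w) v /\
     derivable ('D_v f) (y + s *: v + s' *: w) w) ->
  exists s s', [/\ `|s| <= `|r|, `|s'| <= `|r| &
    f (y + r *: v + r *: w) - f (y + r *: v) - (f (y + r *: w) - f y)
      = r * r * 'D_w ('D_v f) (y + s *: v + s' *: w)].
Proof.
move=> df; pose g z := f (z + r *: w) - f z.
have f0 s : `|s| <= `|r| -> derivable f (y + s *: v) v.
  move=> sr; have [|+ _] := df s 0 sr; first by rewrite normr0.
  by rewrite scale0r addr0.
have f1 s : `|s| <= `|r| -> derivable (fun z => f (z + r *: w)) (y + s *: v) v.
  move=> sr; apply: derivable_translate.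
  exact: (df s r sr (lexx _)).1.
have dg s : `|s| <= `|r| -> derivable g (y + s *: v) v.
  by move=> sr; apply: derivableB; [exact: f1|exact: f0].
have [s sr Es] := mvt_line dg.
have [s' sr' Es'] := @mvt_line ('D_v f) (y + s *: v) w r
  (fun s' sr' => (df s s' sr sr').2).
exists s, s'; split=> //.
rewrite -mulrA -Es' -derive_translate -deriveB; [|exact: f1|exact: f0].
by rewrite -Es.
Qed.

(** Schwarz's theorem: the second difference is symmetric in [v] and [w], so both mixed derivatives
    take a common value at two points close to [y], and continuity brings these values back to
    [y]. *)
Lemma derive_comm f y v w :
  (\forall z \near y, derivable f z v) -> (\forall z \near y, derivable f z w) ->
  (\forall z \near y, derivable ('D_v f) z w) ->
  (\forall z \near y, derivable ('D_w f) z v) ->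
  {for y, continuous ('D_w ('D_v f))} -> {for y, continuous ('D_v ('D_w f))} ->
  'D_w ('D_v f) y = 'D_v ('D_w f) y.
Proof.
move=> fv fw fvw fwv cvw cwv; apply/eqP; rewrite -subr_eq0 -normr_le0.
apply/ler_addgt0Pl => e e0; rewrite addr0.
have e2 : 0 < e / 2 by rewrite divr_gt0.
move/cvgrPdist_le: cvw => /(_ _ e2) Nvw.
move/cvgrPdist_le: cwv => /(_ _ e2) Nwv.
have N : \forall z \near y, [/\ derivable f z v, derivable f z w,
    derivable ('D_v f) z w, derivable ('D_w f) z v &
    `|'D_w ('D_v f) y - 'D_w ('D_v f) z| <= e / 2 /\
    `|'D_v ('D_w f) y - 'D_v ('D_w f) z| <= e / 2].
  apply: filter_app Nwv; apply: filter_app Nvw; apply: filter_app fwv.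
  apply: filter_app fvw; apply: filter_app fw; apply: filterS fv.
  move=> z f1 f2 f3 f4 f5 f6; exact: And5 f1 f2 f3 f4 (conj f5 f6).
have [d /= d0 dP] := (nbhs_ballP _ _).1 N.
have nvw : 0 < `|v| + `|w| + 1 by rewrite ltr_wpDl ?addr_ge0.
(* Every point of the parallelogram is then within d / 2 of [y]; the summand 1 keeps the denominator
   positive when [v] and [w] both vanish. *)
pose r := d / (2 * (`|v| + `|w| + 1)).
have r0 : 0 < r by rewrite divr_gt0// mulr_gt0.
have inball s s' : `|s| <= `|r| -> `|s'| <= `|r| ->
    ball y d (y + s *: v + s' *: w).
  move=> sr sr'; rewrite -ball_normE /ball_/= -addrA opprD addrA subrr sub0r normrN.
  apply: le_lt_trans (ler_normD _ _) _; rewrite !normrZ.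
  apply: (@le_lt_trans _ _ (r * (`|v| + `|w| + 1))).
    rewrite (gtr0_norm r0) in sr sr'.
    have h1 := ler_wpM2r (normr_ge0 v) sr; have h2 := ler_wpM2r (normr_ge0 w) sr'.
    lra.
  by rewrite /r invfM mulrA mulfVK ?gt_eqF// ltr_pdivrMr// mulr_natr mulr2n ltrDr.
have [|s [s' [sr sr' E]]] := @mixed_difference f y v w r.
  move=> s s' sr sr'; have [h1 _ h2 _ _] := dP _ (inball s s' sr sr').
  exact: conj h1 h2.
have inball' s1 s1' : `|s1| <= `|r| -> `|s1'| <= `|r| ->
    ball y d (y + s1 *: w + s1' *: v).
  by move=> ? ?; rewrite addrAC; exact: inball.
have [|p [p' [pr pr' E']]] := @mixed_difference f y w v r.
  move=> s1 s1' sr1 sr1'; have [_ h1 _ h2 _] := dP _ (inball' s1 s1' sr1 sr1').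
  exact: conj h1 h2.
(* Both sides, multiplied by [r * r], equal the same second difference. *)
have EE : 'D_w ('D_v f) (y + s *: v + s' *: w) =
          'D_v ('D_w f) (y + p *: w + p' *: v).
  apply: (@mulfI _ (r * r)); first by rewrite mulf_neq0 ?gt_eqF.
  apply: (etrans (esym E)); apply: (etrans _ E'); rewrite (addrAC y).
  by move: (f _) (f _) (f _) (f _) => x1 x2 x3 x4; ring.
have [_ _ _ _ [le1 _]] := dP _ (inball _ _ sr sr').
have [_ _ _ _ [_ le2]] := dP _ (inball' _ _ pr pr').
rewrite -(subrKA ('D_w ('D_v f) (y + s *: v + s' *: w))) [e]splitr.
apply: le_trans (ler_normD _ _) _; apply: lerD; first exact: le1.
by rewrite EE distrC.
Qed.

(** With the partial derivatives of a function for [c], this is the candidate for its Fréchet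
    differential. *)
Definition pairing (c : 'I_n -> R) (v : 'rV[R]_n) : R := \sum_i v 0 i * c i.

Lemma pairing_is_linear c : linear (pairing c).
Proof.
move=> k u v; rewrite /pairing scaler_sumr -big_split/=.
by apply: eq_bigr => i _; rewrite !mxE mulrDl -mulrA.
Qed.

HB.instance Definition _ c :=
  GRing.isLinear.Build R 'rV[R]_n R _ (pairing c) (pairing_is_linear c).

Lemma pairing_continuous c : continuous (pairing c).
Proof.
rewrite /pairing; apply: continuous_big => [|i _ v]; first exact: add_continuous.
exact: (cvgMr_tmp (b := c i) (@coord_continuous _ _ _ 0 i v)).
Qed.

Lemma pairing_delta c i : pairing c (delta_mx 0 i) = c i.
Proof.
rewrite /pairing (bigD1 i)//= !mxE !eqxx mul1r big1 ?addr0// => j ji.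
by rewrite !mxE (negbTE ji) andbF mul0r.
Qed.

Lemma row_normE (v : 'rV[R]_n) (r : R) :
  0 <= r -> (`|v| <= r) <-> (forall i, `|v 0 i| <= r).
Proof.
move=> r0; rewrite /Num.Def.normr/= mx_normrE; split=> [vr i|vr].
  by apply: le_trans vr; apply: (le_bigmax _ _ (ord0, i)).
by rewrite (bigmax_le _ r0)//= => -[k i] _ /=; rewrite ord1; exact: vr.
Qed.

Definition take_row (k : nat) (v : 'rV[R]_n) : 'rV[R]_n :=
  \row_i (if (i < k)%N then v 0 i else 0).

(** Coordinates are switched on one at a time: [take_row k v] keeps the first [k] of them, and
    passing to [k.+1] moves along a single axis, where the mean value theorem compares the increment
    with the partial derivative at [y]. *)
Lemma continuous_partials_increment f y k :
  (forall i, \forall z \near y, derivable f z (delta_mx 0 i)) ->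
  (forall i, {for y, continuous ('D_(delta_mx 0 i) f)}) ->
  forall e, 0 < e -> \forall v \near (0 : 'rV[R]_n),
    `|f (y + take_row k v) - f y
      - pairing (fun i => 'D_(delta_mx 0 i) f y) (take_row k v)| <= e * `|v|.
Proof.
move=> df cf; elim: k => [|k IH] e e0.
  near=> v; have -> : take_row 0 v = 0 by apply/rowP => i; rewrite !mxE.
  by rewrite linear0 addr0 subrr subr0 normr0 mulr_ge0// ltW.
(* One half of the tolerance goes to the first [k] coordinates by induction, the other half to the
   oscillation of the next partial derivative. *)
have e2 : 0 < e / 2 by rewrite divr_gt0.
have [kn|nk] := ltnP k n; last first.
  apply: filterS (IH _ e0) => v.
  suff -> : take_row k.+1 v = take_row k v by [].
  apply/rowP => i; rewrite !mxE.
  by rewrite !(leq_trans (ltn_ord i))// ltnW.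
pose i := Ordinal kn.
have N2 : \forall z \near y, derivable f z (delta_mx 0 i) /\
    `|'D_(delta_mx 0 i) f y - 'D_(delta_mx 0 i) f z| <= e / 2.
  have := cf i; move/cvgrPdist_le => /(_ _ e2) N.
  by apply: filterI; [exact: df|exact: N].
have [d /= d0 dP] := (nbhs_ballP _ _).1 N2.
have N3 : \forall v \near (0 : 'rV[R]_n), `|v| < d.
  by apply/nbhs_ballP; exists d => //= v; rewrite -ball_normE /= sub0r normrN.
apply: filter_app N3; apply: filterS (IH _ e2) => v IHv vd.
have takeS : take_row k.+1 v = take_row k v + v 0 i *: delta_mx 0 i.
  apply/rowP => j; rewrite !mxE eqxx/= ltnS leq_eqVlt.
  have [->|ji] := eqVneq j i; first by rewrite /= eqxx ltnn mulr1 add0r.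
  have -> : (nat_of_ord j == k) = false by apply/negbTE.
  by rewrite mulr0 addr0.
have vi : `|v 0 i| <= `|v| by apply: (row_normE _ _).1.
have inball s : `|s| <= `|v 0 i| ->
    ball y d (y + take_row k v + s *: delta_mx 0 i).
  move=> sv; rewrite -ball_normE /ball_/= -addrA opprD addNKr normrN.
  apply: le_lt_trans vd; apply/row_normE => // j; rewrite !mxE eqxx/=.
  have [->|ji] := eqVneq j i.
    by rewrite /= ltnn add0r mulr1 (le_trans sv).
  rewrite mulr0 addr0; case: ifP => _; last by rewrite normr0.
  exact: (row_normE _ _).1.
have [s sv Es] := @mvt_line f (y + take_row k v) (delta_mx 0 i) (v 0 i)
  (fun s sv => (dP _ (inball s sv)).1).
have le2 := (dP _ (inball s sv)).2.
move: Es le2; rewrite takeS addrA linearD linearZ /= pairing_delta.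
set P := pairing _ _; move: IHv; rewrite -/P.
move: (f _) (f _) (f _) (derive f _ _) (derive f _ _) => f1 f2 f3 D1 D2 IHv Es le2.
have -> : f1 - f2 - (P + v 0 i *: D1) = (f3 - f2 - P) - v 0 i * (D1 - D2).
  have -> : f1 = f3 + v 0 i * D2 by rewrite -Es addrC subrK.
  have alg (a b p x d1 d2 : R) :
    a + x * d2 - b - (p + x * d1) = a - b - p - x * (d1 - d2) by ring.
  exact: alg.
apply: (le_trans (ler_normB _ _)); rewrite [e]splitr mulrDl; apply: lerD => //.
by rewrite normrM mulrC ler_pM.
Unshelve. all: by end_near. Qed.

(** C^1 in the sense of partial derivatives implies Fréchet differentiable. The chain rule between
    charts rests on this, since a change of charts mixes all coordinate directions. *)
Lemma continuous_partials_differentiable f y :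
  (forall i, \forall z \near y, derivable f z (delta_mx 0 i)) ->
  (forall i, {for y, continuous ('D_(delta_mx 0 i) f)}) ->
  differentiable f y.
Proof.
move=> df cf; pose c i := 'D_(delta_mx 0 i) f y.
have E : (f : _ -> R^o) \o shift y = cst (f y : R^o) + (pairing c : _ -> R^o) +o_ (0 : 'rV[R]_n) (@idfun 'rV[R]_n).
  apply/eqaddoP => e e0; apply: filterS (continuous_partials_increment n df cf e0).
  move=> v; have -> : take_row n v = v by apply/rowP => i; rewrite !mxE ltn_ord.
  have -> : ((f : _ -> R^o) \o shift y - (cst (f y : R^o) + (pairing c : _ -> R^o))) v
      = f (v + y) - (f y + pairing c v) by [].
  by rewrite opprD addrA (addrC v).
apply/diff_locallyP; rewrite (diff_unique (@pairing_continuous c) E).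
by split=> //; exact: pairing_continuous.
Qed.

End RowCalculus.

(** * Closure properties of C^k functions on open sets *)

Section SmoothOn.
Context {R : realType} {n : nat}.
Implicit Types (f g : 'rV[R]_n -> R) (y v : 'rV[R]_n) (A : set 'rV[R]_n).

Lemma Ck_onW k A f : Ck_on k.+1 A f -> Ck_on k A f.
Proof.
elim: k f => [|k IH] f [cf df]; first by split.
by split=> // i; split; [exact: (df i).1|exact/IH/(df i).2].
Qed.

Lemma open_near_eq A f g y : open A -> {in A, f =1 g} -> A y ->
  {near y, f =1 g}.
Proof.
move=> oA fg Ay; apply: filterS (open_nbhs_nbhs (conj oA Ay)) => z Az.
exact/fg/mem_set.
Qed.

Lemma near_eq_continuous f g y : {near y, f =1 g} ->
  {for y, continuous f} -> {for y, continuous g}.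
Proof.
move=> fg cf; rewrite /prop_for /continuous_at -(nbhs_singleton fg).
move=> P /cf cfP.
by apply: (@filterS2 _ (nbhs y) (nbhs_filter y) _ _ _ _ fg cfP) => z /= <-.
Qed.

Lemma Ck_on_ext k A f g : open A -> {in A, f =1 g} -> Ck_on k A f -> Ck_on k A g.
Proof.
move=> oA; elim: k f g => [|k IH] f g fg [cf df].
  by split=> // y Ay; exact: near_eq_continuous (open_near_eq oA fg Ay) (cf y Ay).
split=> [y Ay|i].
  exact: near_eq_continuous (open_near_eq oA fg Ay) (cf y Ay).
split=> [y Ay|].
  exact: near_eq_derivable (open_near_eq oA fg Ay) ((df i).1 y Ay).
apply: IH (df i).2 => y /set_mem Ay.
exact: near_eq_derive (open_near_eq oA fg Ay).
Qed.

Lemma Ck_on_cst k A (c : R) : Ck_on k A (cst c).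
Proof.
elim: k c => [|k IH] c; first by split=> // y _; exact: cst_continuous.
split=> [y _|i]; first exact: cst_continuous.
split=> [y _|]; first exact: derivable_cst.
suff -> : (fun y => 'D_(delta_mx 0 i) (cst c) y) = cst 0 by exact: IH.
by apply/funext => y; rewrite derive_cst.
Qed.

Lemma Ck_onD k A f g : open A -> Ck_on k A f -> Ck_on k A g ->
  Ck_on k A (fun y => f y + g y).
Proof.
move=> oA; elim: k f g => [|k IH] f g [cf df] [cg dg].
  by split=> // y Ay; exact: continuousD (cf y Ay) (cg y Ay).
split=> [y Ay|i]; first exact: continuousD (cf y Ay) (cg y Ay).
split=> [y Ay|]; first exact: derivableD ((df i).1 y Ay) ((dg i).1 y Ay).
apply: Ck_on_ext (IH _ _ (df i).2 (dg i).2) => // y /set_mem Ay.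
by rewrite [RHS]deriveD//; [exact: (df i).1|exact: (dg i).1].
Qed.

Lemma Ck_onM k A f g : open A -> Ck_on k A f -> Ck_on k A g ->
  Ck_on k A (fun y => f y * g y).
Proof.
move=> oA; elim: k f g => [|k IH] f g Cf Cg.
  by split=> // y Ay; exact: continuousM (Cf.1 y Ay) (Cg.1 y Ay).
have [cf df] := Cf; have [cg dg] := Cg.
split=> [y Ay|i]; first exact: continuousM (cf y Ay) (cg y Ay).
split=> [y Ay|]; first exact: derivableM ((df i).1 y Ay) ((dg i).1 y Ay).
apply: Ck_on_ext (Ck_onD oA (IH _ _ (Ck_onW Cf) (dg i).2)
                            (IH _ _ (Ck_onW Cg) (df i).2)) => // y /set_mem Ay.
by rewrite [RHS]deriveM//; [exact: (df i).1|exact: (dg i).1].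
Qed.

Lemma Ck_onV k A f : open A -> (forall y, A y -> f y != 0) -> Ck_on k A f ->
  Ck_on k A (fun y => (f y)^-1).
Proof.
move=> oA f0; elim: k f f0 => [|k IH] f f0 Cf.
  by split=> // y Ay; apply: (@continuousV _ _ f y (f0 y Ay)); exact: Cf.1.
have [cf df] := Cf.
split=> [y Ay|i]; first by apply: (@continuousV _ _ f y (f0 y Ay)); exact: cf.
split=> [y Ay|]; first exact: derivableV (f0 y Ay) ((df i).1 y Ay).
have CV := IH f f0 (Ck_onW Cf).
apply: Ck_on_ext (Ck_onM oA (Ck_onM oA (Ck_on_cst k A (-1)) (Ck_onM oA CV CV)) (df i).2)
  => // y /set_mem Ay.
rewrite [RHS]deriveV//; [|exact: f0|exact: (df i).1].
by rewrite mulN1r -invfM -expr2.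
Qed.

(** A single directional derivative of [f] gives no differentiability in several variables, so the
    chain rule is applied to the restriction of [f] to the line through [y]. *)
Lemma expR_comp_is_derive f y v : derivable f y v ->
  is_derive y v (fun z => expR (f z)) (expR (f y) * 'D_v f y).
Proof.
move=> df; have y0 : y + (0 : R) *: v = y by rewrite scale0r addr0.
pose phi (r : R) := f (y + r *: v).
have dphi : derivable phi 0 1 by rewrite /phi line_derivable y0.
have dE : derivable expR (phi 0) 1 by exact: derivable_expR.
split.
  rewrite -{1}y0 -(line_derivable (fun z => expR (f z))).
  apply/derivable1_diffP; apply: (@differentiable_comp _ _ _ _ phi expR).
    exact: (derivable1_diffP _ _).1 dphi.
  exact: (derivable1_diffP _ _).1 dE.
have Ephi : 'D_1 phi 0 = 'D_v f y by rewrite line_derive y0.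
have phi0 : phi 0 = f y by rewrite /phi y0.
rewrite -{1}y0 -(line_derive (fun z => expR (f z))) -derive1E.
apply: etrans (derive1_comp dphi dE) _.
rewrite derive1E [in X in _ * X]derive1E Ephi.
by congr (_ * _); rewrite -phi0; exact: (congr1 (fun h => h (phi 0)) (@derive_expR R)).
Qed.

Lemma Ck_on_expR k A f : open A -> Ck_on k A f -> Ck_on k A (fun y => expR (f y)).
Proof.
move=> oA; elim: k => [|k IH] Cf.
  split=> // y Ay; apply: (@continuous_comp _ _ _ f expR); first exact: Cf.1.
  exact: continuous_expR.
have [cf df] := Cf.
split=> [y Ay|i].
  apply: (@continuous_comp _ _ _ f expR); first exact: cf.
  exact: continuous_expR.
split=> [y Ay|]; first by case: (expR_comp_is_derive ((df i).1 y Ay)).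
apply: Ck_on_ext (Ck_onM oA (IH (Ck_onW Cf)) (df i).2) => // y /set_mem Ay.
by case: (expR_comp_is_derive ((df i).1 y Ay)).
Qed.

End SmoothOn.

(** * Calculus in a chart *)

Section ChartCalculus.
Context {R : realType} {n : nat} {M : chartedSpace R n}.
Hypothesis hM : smooth_manifold M.
Implicit Types (a b : chart M) (O : set M) (f g : M -> R) (x : M) (i j : 'I_n).

(** The set [O] is a parameter because transition matrices are smooth only on an overlap [dom a] ∩
    [dom b], while tensor components are smooth on all of [dom a]. *)
Definition smooth_inside a O f := smooth_on (chart_map a @` O) (f \o param a).

Definition subdomain a O := open O /\ O `<=` dom a.

Definition is_pder a i f x (d : R) :=
  is_derive (chart_map a x) (delta_mx 0 i) (f \o param a) d.

Lemma subdomain_dom a : subdomain a (dom a).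
Proof. by split=> //; exact: manifold_open_dom. Qed.

Lemma subdomainI a b : subdomain a (dom a `&` dom b).
Proof. by split=> [|x []//]; apply: openI; exact: manifold_open_dom. Qed.

(** The image is the part of the open set [img a] that the continuous map [param a] sends into
    [O]. *)
Lemma chart_image_open a O : subdomain a O -> open (chart_map a @` O).
Proof.
move=> [oO Oa]; rewrite openE => _ [x Ox <-].
have ax := Oa _ Ox.
have imgx : img a (chart_map a x) by exists x.
have N1 := open_nbhs_nbhs (conj (manifold_open_img hM (a:=a)) imgx).
have := manifold_param_continuous hM imgx.
rewrite /prop_for /continuous_at manifold_coordK// => cp.
have N2 := cp _ (open_nbhs_nbhs (conj oO Ox)).
apply: (@filterS2 _ _ (nbhs_filter (chart_map a x)) _ _ _ _ N1 N2).
move=> _ [z az <-] /=; rewrite manifold_coordK// => Oz.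
by exists z.
Qed.

Lemma smooth_insideP a O f g : subdomain a O -> {in O, f =1 g} ->
  smooth_inside a O f -> smooth_inside a O g.
Proof.
move=> sO fg sf k; apply: Ck_on_ext (sf k); first exact: chart_image_open.
move=> _ /set_mem[x Ox <-] /=.
by rewrite manifold_coordK ?fg//; [exact: mem_set|exact: sO.2].
Qed.

Lemma smooth_inside_cst a O (c : R) : smooth_inside a O (fun=> c).
Proof. by move=> k; exact: Ck_on_cst. Qed.

Lemma smooth_insideD a O f g : subdomain a O -> smooth_inside a O f ->
  smooth_inside a O g -> smooth_inside a O (fun x => f x + g x).
Proof.
by move=> sO sf sg k; apply: Ck_onD (sf k) (sg k); exact: chart_image_open.
Qed.

Lemma smooth_insideM a O f g : subdomain a O -> smooth_inside a O f ->
  smooth_inside a O g -> smooth_inside a O (fun x => f x * g x).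
Proof.
by move=> sO sf sg k; apply: Ck_onM (sf k) (sg k); exact: chart_image_open.
Qed.

Lemma smooth_insideN a O f : subdomain a O -> smooth_inside a O f ->
  smooth_inside a O (fun x => - f x).
Proof.
move=> sO sf; apply: (@smooth_insideP a O (fun x => -1 * f x)) => //.
  by move=> x _; rewrite mulN1r.
by apply: smooth_insideM => //; exact: smooth_inside_cst.
Qed.

Lemma smooth_insideB a O f g : subdomain a O -> smooth_inside a O f ->
  smooth_inside a O g -> smooth_inside a O (fun x => f x - g x).
Proof.
by move=> sO sf sg; apply: smooth_insideD => //; exact: smooth_insideN.
Qed.

Lemma smooth_insideV a O f : subdomain a O -> (forall x, O x -> f x != 0) ->
  smooth_inside a O f -> smooth_inside a O (fun x => (f x)^-1).
Proof.
move=> sO f0 sf k; apply: Ck_onV (sf k); first exact: chart_image_open.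
by move=> _ [x Ox <-] /=; rewrite manifold_coordK ?f0//; exact: sO.2.
Qed.

Lemma smooth_inside_expR a O f : subdomain a O -> smooth_inside a O f ->
  smooth_inside a O (fun x => expR (f x)).
Proof.
by move=> sO sf k; apply: Ck_on_expR (sf k); exact: chart_image_open.
Qed.

Lemma smooth_inside_sum (I : Type) (r : seq I) (P : pred I) (F : I -> M -> R) a O :
  subdomain a O -> (forall k, smooth_inside a O (F k)) ->
  smooth_inside a O (fun x => \sum_(k <- r | P k) F k x).
Proof.
move=> sO sF; elim: r => [|k r IH].
  apply: smooth_insideP (@smooth_inside_cst a O 0) => // x _.
  by rewrite big_nil.
apply: (@smooth_insideP a O
  (fun x => (if P k then F k x else 0) + \sum_(k <- r | P k) F k x)) => //.
  by move=> x _; rewrite big_cons; case: ifP => //; rewrite add0r.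
apply: smooth_insideD => //; case: (P k) => //; exact: smooth_inside_cst.
Qed.

Lemma smooth_inside_pder a O i f : subdomain a O -> smooth_inside a O f ->
  smooth_inside a O (pder a i f).
Proof.
move=> sO sf k; apply: Ck_on_ext ((sf k.+1).2 i).2; first exact: chart_image_open.
move=> _ /set_mem[x Ox <-] /=; rewrite /pder manifold_coordK//; exact: sO.2.
Qed.

Lemma is_pderE a i f x d : is_pder a i f x d -> pder a i f x = d.
Proof. by case. Qed.

Lemma smooth_inside_is_pder a O i f x : smooth_inside a O f -> O x ->
  is_pder a i f x (pder a i f x).
Proof.
by move=> sf Ox; split=> //; apply: ((sf 1).2 i).1; exists x.
Qed.

Lemma chart_near a O x (P : M -> Prop) : subdomain a O -> O x ->
  (forall y, O y -> P y) -> \forall y \near chart_map a x, P (param a y).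
Proof.
move=> sO Ox fg.
have imgx : (chart_map a @` O) (chart_map a x) by exists x.
apply: filterS (open_nbhs_nbhs (conj (chart_image_open sO) imgx)).
by move=> _ [z Oz <-] /=; rewrite (manifold_coordK hM (sO.2 _ Oz)); exact: fg.
Qed.

Lemma pder_ext a O i f g x : subdomain a O -> O x ->
  (forall y, O y -> f y = g y) -> pder a i f x = pder a i g x.
Proof. by move=> sO Ox fg; apply: near_eq_derive; exact: chart_near fg. Qed.

Lemma is_pder_eq a i f x d d' : is_pder a i f x d -> d = d' -> is_pder a i f x d'.
Proof. by move=> ? <-. Qed.

Lemma is_pder_cst a i (c : R) x : is_pder a i (fun=> c) x 0.
Proof. exact: is_derive_cst. Qed.

Lemma is_pderD a i f g x d e : is_pder a i f x d -> is_pder a i g x e ->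
  is_pder a i (fun y => f y + g y) x (d + e).
Proof. exact: is_deriveD. Qed.

Lemma is_pderN a i f x d : is_pder a i f x d ->
  is_pder a i (fun y => - f y) x (- d).
Proof. exact: is_deriveN. Qed.

Lemma is_pderB a i f g x d e : is_pder a i f x d -> is_pder a i g x e ->
  is_pder a i (fun y => f y - g y) x (d - e).
Proof. exact: is_deriveB. Qed.

Lemma is_pderM a i f g x d e : dom a x -> is_pder a i f x d -> is_pder a i g x e ->
  is_pder a i (fun y => f y * g y) x (d * g x + f x * e).
Proof.
move=> ax df dg; apply: is_derive_eq; first exact: (is_deriveM df dg).
by rewrite /= manifold_coordK// addrC (mulrC d).
Qed.

Lemma is_pder_expR a i f x d : dom a x -> is_pder a i f x d ->
  is_pder a i (fun y => expR (f y)) x (expR (f x) * d).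
Proof.
move=> ax [df <-]; have := expR_comp_is_derive df.
by rewrite /= manifold_coordK.
Qed.

Lemma is_pder_sum m (F : 'I_m -> M -> R) (d : 'I_m -> R) a i x :
  (forall k, is_pder a i (F k) x (d k)) ->
  is_pder a i (fun y => \sum_k F k y) x (\sum_k d k).
Proof.
move=> dF; have := @is_derive_sum _ _ _ _ (fun k => F k \o param a) _ _ _ dF.
rewrite /is_pder; congr is_derive; apply/funext => y.
by rewrite fct_sumE.
Qed.

(** Schwarz's theorem in a chart. Iterating [pder] returns to the manifold between the two
    derivatives, so it agrees with the iterated derivative on R^n only near the image of [x]; that
    is the content of [E]. *)
Lemma pder_comm a O i j f x : subdomain a O -> smooth_inside a O f -> O x ->
  pder a i (pder a j f) x = pder a j (pder a i f) x.
Proof.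
move=> sO sf Ox; set y := chart_map a x; set h := f \o param a.
have oO := chart_image_open sO.
have Oy : (chart_map a @` O) y by exists x.
have E k l : pder a k (pder a l f) x =
    'D_(delta_mx 0 k) ('D_(delta_mx 0 l) h) y.
  apply: near_eq_derive.
  apply: filterS (open_nbhs_nbhs (conj oO Oy)) => _ [z Oz <-] /=.
  by rewrite /pder manifold_coordK//; exact: sO.2.
have dh k : \forall z \near y, derivable h z (delta_mx 0 k).
  apply: filterS (open_nbhs_nbhs (conj oO Oy)) => z Oz.
  exact: ((sf 1).2 k).1.
have ddh k l : \forall z \near y, derivable ('D_(delta_mx 0 k) h) z (delta_mx 0 l).
  apply: filterS (open_nbhs_nbhs (conj oO Oy)) => z Oz.
  exact: (((sf 2).2 k).2.2 l).1.
have cdh k l : {for y, continuous ('D_(delta_mx 0 l) ('D_(delta_mx 0 k) h))}.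
  exact: (((sf 2).2 k).2.2 l).2.1 _ Oy.
rewrite !E; exact: derive_comm.
Qed.

Lemma smooth_inside_trans a b i j :
  smooth_inside a (dom a `&` dom b) (fun x => trans a b x i j).
Proof.
apply: (@smooth_insideP a _ (pder a i (fun y => chart_map b y 0 j))).
- exact: subdomainI.
- by move=> x _; rewrite !mxE.
- by apply: smooth_inside_pder; [exact: subdomainI|exact: manifold_compatible].
Qed.

(** Chain rule for a change of charts. The coordinate line of [b] becomes a curve [c] in the chart
    [a]; [f] read in [a] is Fréchet differentiable, and the velocity of [c] is a row of the
    transition matrix. *)
Lemma pder_chain a b O i f x : subdomain a O -> smooth_inside a O f -> O x ->
  dom b x ->
  is_pder b i f x (\sum_j trans b a x i j * pder a j f x).
Proof.
move=> sO sf Ox bx; have ax : dom a x := sO.2 _ Ox.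
have oO := chart_image_open sO.
have Oy : (chart_map a @` O) (chart_map a x) by exists x.
have df : differentiable (f \o param a) (chart_map a x).
  apply: continuous_partials_differentiable => k.
    apply: filterS (open_nbhs_nbhs (conj oO Oy)) => z Oz.
    exact: ((sf 1).2 k).1.
  exact: ((sf 1).2 k).2.1 _ Oy.
pose phi := chart_map a \o param b.
have phix : phi (chart_map b x) = chart_map a x by rewrite /phi/= manifold_coordK.
have dphi k : derivable (fun y => phi y 0 k) (chart_map b x) (delta_mx 0 i).
  have sphi := manifold_compatible hM b a k.
  by apply: ((sphi 1).2 i).1; exists x.
pose c (r : R) := phi (chart_map b x + r *: delta_mx 0 i).
have c0 : c 0 = chart_map a x by rewrite /c scale0r addr0.
have dc : derivable c 0 1.
  apply/derivable_mxP => i0 k; rewrite ord1.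
  by rewrite (line_derivable (fun y => phi y 0 k)) scale0r addr0.
have dc' : 'D_1 c 0 = \row_k trans b a x i k.
  rewrite derive_mx//; apply/matrixP => i0 k; rewrite !mxE ord1.
  by rewrite (line_derive (fun y => phi y 0 k)) scale0r addr0.
have y0 : chart_map b x + (0 : R) *: delta_mx 0 i = chart_map b x.
  by rewrite scale0r addr0.
have E : is_derive (0 : R) 1 ((f \o param a) \o c)
    (\sum_j trans b a x i j * pder a j f x).
  have dcd : differentiable c 0 := (derivable1_diffP _ _).1 dc.
  have dfc : differentiable (f \o param a) (c 0) by rewrite c0.
  have dcomp := differentiable_comp dcd dfc.
  split; first exact: (derivable1_diffP _ _).2.
  have dc1 : 'd c 0 1 = \row_k trans b a x i k by rewrite -dc' deriveE.
  rewrite deriveE// diff_comp//= dc1 c0.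
  rewrite [X in 'd _ _ X]row_sum_delta linear_sum/=.
  apply: eq_bigr => k _; rewrite linearZ/= -deriveE// mxE.
  by [].
(* Passing through the chart [a] and back is the identity only on the overlap, which the coordinate
   line stays in for small [r]. *)
have nE : {near 0, (f \o param a) \o c =1
    (fun r => (f \o param b) (chart_map b x + r *: delta_mx 0 i))}.
  have : {for (0 : R), continuous (fun r : R => chart_map b x + r *: delta_mx 0 i)}.
    by apply: continuousD; [exact: cst_continuous|exact: scalel_continuous].
  rewrite /prop_for/continuous_at y0 => cl.
  have := chart_near (subdomainI b a) (conj bx ax)
    (fun z (Oz : (dom b `&` dom a) z) => manifold_coordK hM Oz.2).
  move=> /cl Ncl; apply: (@filterS _ (nbhs (0 : R)) (nbhs_filter _) _ _ _ Ncl) => r.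
  by move=> /= Er; rewrite /c /phi/= Er.
have := near_eq_is_derive nE E.
move=> [h1 h2]; split; last by rewrite -h2 line_derive y0.
by move: h1; rewrite line_derivable y0.
Qed.

End ChartCalculus.

(** * Tensors in charts *)

Section TensorsInCharts.
Context {R : realType} {n : nat} {M : chartedSpace R n}.
Hypothesis hM : smooth_manifold M.
Implicit Types (a b c : chart M) (x : M) (T E G : 'M[R]_n).

Lemma coord_is_derive (y v : 'rV[R]_n) j : is_derive y v (fun z => z 0 j) (v 0 j).
Proof.
have di : derivable (@id 'rV[R]_n) y v by exact: derivable_id.
split; first exact: ((derivable_mxP _ _ _).1 di 0 j).
by have := derive_mx di; rewrite derive_id => /rowP/(_ j); rewrite mxE => <-.
Qed.

Lemma trans_id a x : dom a x -> trans a a x = 1%:M.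
Proof.
move=> ax; apply/matrixP => i j; rewrite !mxE.
have -> : (i == j)%:R = (delta_mx 0 i : 'rV[R]_n) 0 j by rewrite !mxE eqxx eq_sym.
have [_ <-] := coord_is_derive (chart_map a x) (delta_mx 0 i) j.
apply: near_eq_derive.
have imgx : img a (chart_map a x) by exists x.
apply: filterS (open_nbhs_nbhs (conj (manifold_open_img hM (a:=a)) imgx)).
by move=> _ [z az <-] /=; rewrite manifold_coordK.
Qed.

Lemma smooth_inside_chart_map a c k :
  smooth_inside a (dom a `&` dom c) (fun y => chart_map c y 0 k).
Proof. exact: manifold_compatible. Qed.

(** Cocycle rule for Jacobians: the chain rule applied to the coordinate functions of [c]. Their
    invertibility and the transformation of all tensors follow from it. *)
Lemma trans_comp a b c x : dom a x -> dom b x -> dom c x ->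
  trans b c x = trans b a x *m trans a c x.
Proof.
move=> ax bx cx; apply/matrixP => i k; rewrite [LHS]mxE mxE.
have := pder_chain hM i (subdomainI hM a c)
  (smooth_inside_chart_map a c k) (conj ax cx) bx.
by move/is_pderE ->; apply: eq_bigr => j _; congr (_ * _); rewrite mxE.
Qed.

Lemma transK a b x : dom a x -> dom b x -> trans a b x *m trans b a x = 1%:M.
Proof. by move=> ax bx; rewrite -trans_comp// trans_id. Qed.

Lemma trans_unit a b x : dom a x -> dom b x -> trans a b x \in unitmx.
Proof. by move=> ax bx; have := mulmx1_unit (transK ax bx) => -[]. Qed.

Lemma form_in_trans a b x T : dom a x -> dom b x ->
  form_in b x T = trans b a x *m form_in a x T *m (trans b a x)^T.
Proof.
move=> ax bx; have cx := manifold_cover hM x.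
by rewrite /form_in (trans_comp ax bx cx) trmx_mul !mulmxA.
Qed.

Lemma vec_in_trans a b x v : dom a x -> dom b x ->
  vec_in b x v = vec_in a x v *m trans a b x.
Proof.
move=> ax bx; have cx := manifold_cover hM x.
by rewrite /vec_in (trans_comp ax cx bx) mulmxA.
Qed.

Lemma form_in_at x T : form_in (chart_at x) x T = T.
Proof.
by rewrite /form_in trans_id ?trmx1 ?mul1mx ?mulmx1//; exact: manifold_cover.
Qed.

Lemma vec_in_at x v : vec_in (chart_at x) x v = v.
Proof. by rewrite /vec_in trans_id ?mulmx1//; exact: manifold_cover. Qed.

Lemma endo_in_at x E : endo_in (chart_at x) x E = E.
Proof.
by rewrite /endo_in trans_id ?mul1mx ?mulmx1//; exact: manifold_cover.
Qed.

Lemma form_in_mul a x E T : dom a x ->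
  form_in a x (E *m T) = endo_in a x E *m form_in a x T.
Proof.
move=> ax; rewrite /form_in /endo_in !mulmxA -[in RHS](mulmxA _ (trans _ a x)).
by rewrite transK ?mulmx1//; exact: manifold_cover.
Qed.

Lemma vec_in_mul a x v E : dom a x ->
  vec_in a x (v *m E) = vec_in a x v *m endo_in a x E.
Proof.
move=> ax; rewrite /vec_in /endo_in !mulmxA -[in RHS](mulmxA v).
by rewrite transK ?mulmx1//; exact: manifold_cover.
Qed.

Lemma form_in_unit a x G : dom a x -> (form_in a x G \in unitmx) = (G \in unitmx).
Proof.
move=> ax; rewrite /form_in !unitmx_mul unitmx_tr.
by rewrite trans_unit ?andbT//; exact: manifold_cover.
Qed.

Lemma form_in_tr a x T : (form_in a x T)^T = form_in a x T^T.
Proof. by rewrite /form_in !trmx_mul trmxK mulmxA. Qed.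

Lemma form_inD a x T T' : form_in a x (T + T') = form_in a x T + form_in a x T'.
Proof. by rewrite /form_in mulmxDr mulmxDl. Qed.

Lemma form_inN a x T : form_in a x (- T) = - form_in a x T.
Proof. by rewrite /form_in mulmxN mulNmx. Qed.

Lemma form_inZ a x k T : form_in a x (k *: T) = k *: form_in a x T.
Proof. by rewrite /form_in -scalemxAr -scalemxAl. Qed.

Lemma endo_in_sharp a x T G : dom a x -> G \in unitmx ->
  endo_in a x (T *m invmx G) = form_in a x T *m invmx (form_in a x G).
Proof.
move=> ax uG; apply: (canRL (mulmxK _)); first by rewrite form_in_unit.
by rewrite -form_in_mul// mulmxKV.
Qed.

Lemma inner_in a x G v w : dom a x ->
  inner G v w = inner (form_in a x G) (vec_in a x v) (vec_in a x w).
Proof.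
move=> ax; have cx := manifold_cover hM x.
rewrite /inner /form_in /vec_in trmx_mul.
rewrite !mulmxA -(mulmxA v (trans _ _ _) (trans _ _ _)) transK// mulmx1.
by rewrite -(mulmxA _ (trans a _ x)^T) -trmx_mul transK// trmx1 mulmx1.
Qed.

Definition dcol a (u : M -> R) x : 'cV[R]_n := \col_i pder a i u x.

Lemma differential_in a u x : smooth_fun u -> dom a x ->
  differential u x = trans (chart_at x) a x *m dcol a u x.
Proof.
move=> su ax; apply/colP => i; rewrite !mxE.
have := pder_chain hM i (subdomain_dom hM a) (su a) ax (manifold_cover hM x).
by move/is_pderE ->; apply: eq_bigr => j _; congr (_ * _); rewrite mxE.
Qed.

(** The gradient is defined at each point through its preferred chart; this shows that the same
    formula holds in every chart, which makes it differentiable. *)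
Lemma gradient_in (g : M -> 'M[R]_n) a u x : smooth_fun u -> dom a x ->
  g x \in unitmx ->
  vec_in a x (gradient g u x) = (dcol a u x)^T *m invmx (form_in a x (g x)).
Proof.
move=> su ax ug; have cx := manifold_cover hM x.
apply: (canRL (mulmxK _)); first by rewrite form_in_unit.
have JK := transK cx ax.
rewrite /gradient (differential_in su ax) /vec_in /form_in trmx_mul.
move: (trans _ a x) (trans a _ x) JK => J J' JK.
rewrite !mulmxA -(mulmxA _ J J') JK mulmx1 mulmxKV//.
by rewrite -(mulmxA _ J^T) -trmx_mul (mulmx1C JK) trmx1 mulmx1.
Qed.

Lemma smooth_inside_prod (I : Type) (r : seq I) (P : pred I) (F : I -> M -> R) a O :
  subdomain a O -> (forall k, smooth_inside a O (F k)) ->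
  smooth_inside a O (fun x => \prod_(k <- r | P k) F k x).
Proof.
move=> sO sF; elim: r => [|k r IH].
  apply: (smooth_insideP hM sO _ (smooth_inside_cst a O 1)) => x _.
  by rewrite big_nil.
apply: (@smooth_insideP _ _ _ hM a O
  (fun x => (if P k then F k x else 1) * \prod_(k <- r | P k) F k x)) => //.
  by move=> x _; rewrite big_cons; case: ifP => //; rewrite mul1r.
apply: smooth_insideM => //; case: (P k) => //; exact: smooth_inside_cst.
Qed.

Lemma smooth_inside_det m (F : M -> 'M[R]_m) a O : subdomain a O ->
  (forall i j, smooth_inside a O (fun x => F x i j)) ->
  smooth_inside a O (fun x => \det (F x)).
Proof.
move=> sO sF; apply: smooth_inside_sum => // s.
apply: smooth_insideM => //; first exact: smooth_inside_cst.
exact: smooth_inside_prod.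
Qed.

(** Cramer's rule: an entry of the inverse is a cofactor over the determinant, both polynomials in
    the entries. *)
Lemma smooth_inside_invmx m (F : M -> 'M[R]_m) a O i j : subdomain a O ->
  (forall x, O x -> F x \in unitmx) ->
  (forall i j, smooth_inside a O (fun x => F x i j)) ->
  smooth_inside a O (fun x => invmx (F x) i j).
Proof.
move=> sO uF sF.
apply: (@smooth_insideP _ _ _ hM a O
  (fun x => (\det (F x))^-1 * cofactor (F x) j i)) => //.
  by move=> x /set_mem Ox; rewrite /invmx uF// !mxE.
apply: smooth_insideM => //.
  apply: smooth_insideV => // [x Ox|]; last exact: smooth_inside_det.
  by have := uF x Ox; rewrite unitmxE unitfE.
apply: smooth_insideM => //; first exact: smooth_inside_cst.
apply: smooth_inside_det => // k l.
by apply: (smooth_insideP hM sO _ (sF (lift j k) (lift i l))) => x _; rewrite !mxE.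
Qed.

(** A nonzero vector in the kernel of [g x] would have square norm 0. *)
Lemma riemannian_unit g x : riemannian g -> g x \in unitmx.
Proof.
case=> _ _ pos; rewrite -row_free_unit -kermx_eq0; apply/negPn/negP.
move=> /rowV0Pn[v /sub_kermxP vg v0].
by have := pos x v v0; rewrite /inner vg mul0mx mxE ltxx.
Qed.

End TensorsInCharts.

(** * The Levi-Civita connection in charts *)

Section LeviCivitaInCharts.
Context {R : realType} {n : nat} {M : chartedSpace R n}.
Hypothesis hM : smooth_manifold M.
Implicit Types (a b : chart M) (x : M).

Definition form_comp a (T : M -> 'M[R]_n) i j x : R := form_in a x (T x) i j.

Variable g : M -> 'M[R]_n.
Hypothesis hg : riemannian g.

Let sg a i j : smooth_inside a (dom a) (form_comp a g i j).
Proof. by case: hg => + _ _; apply. Qed.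

Let ug a x : dom a x -> form_in a x (g x) \in unitmx.
Proof. by move=> ax; rewrite form_in_unit// (riemannian_unit x hg). Qed.

Lemma form_comp_sym a i j x : form_comp a g i j x = form_comp a g j i x.
Proof.
rewrite /form_comp -[in LHS](trmxK (form_in a x (g x))) mxE form_in_tr.
by have [_ -> _] := hg.
Qed.

Lemma inverse_comp_smooth a i j :
  smooth_inside a (dom a) (fun y => invmx (form_in a y (g y)) i j).
Proof.
apply: smooth_inside_invmx => [//||y|k l]; [exact: subdomain_dom|exact: ug|].
exact: sg.
Qed.

Lemma christoffel_smooth a i j k :
  smooth_inside a (dom a) (christoffel g a i j k).
Proof.
have sD := subdomain_dom hM a.
apply: smooth_insideM => //; first exact: smooth_inside_cst.
apply: smooth_inside_sum => // l.
apply: smooth_insideM => //; first exact: inverse_comp_smooth.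
by apply: smooth_insideB => //; first apply: smooth_insideD => //;
  apply: smooth_inside_pder => //; exact: sg.
Qed.

(** Christoffel symbols of the first kind. Lowering the upper index cancels the inverse metric, so
    later identities hold without division by the determinant. *)
Lemma christoffel_lower a i j l x : dom a x ->
  \sum_k christoffel g a i j k x * form_comp a g k l x =
  2^-1 * (pder a i (form_comp a g j l) x + pder a j (form_comp a g i l) x
          - pder a l (form_comp a g i j) x).
Proof.
move=> ax; rewrite /christoffel.
under eq_bigr do rewrite -mulrA; rewrite -mulr_sumr; congr (_ * _).
under eq_bigr do rewrite mulr_suml; rewrite exchange_big/=.
under eq_bigr => m _.
  under eq_bigr => k _.
    rewrite mulrAC [X in X * _]mulrC form_comp_sym; over.
  rewrite -mulr_suml; over.
have E m : \sum_i0 form_comp a g l i0 x * invmx (form_in a x (g x)) i0 m = (l == m)%:R.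
  have /matrixP/(_ l m) := mulmxV (ug ax); rewrite !mxE => <-.
  by apply: eq_bigr => k _.
under eq_bigr => m _ do rewrite E.
rewrite (bigD1 l)//= eqxx mul1r big1 ?addr0// => m ml.
by rewrite eq_sym (negbTE ml) mul0r.
Qed.

(** Nondegeneracy of [g]: components may be compared after lowering an index. *)
Lemma form_comp_inj a (A B : 'I_n -> R) x : dom a x ->
  (forall l, \sum_k A k * form_comp a g k l x = \sum_k B k * form_comp a g k l x) ->
  A =1 B.
Proof.
move=> ax AB k.
have : \row_k A k *m form_in a x (g x) = \row_k B k *m form_in a x (g x).
  apply/rowP => l; rewrite !mxE.
  under eq_bigr do rewrite mxE; under [RHS]eq_bigr do rewrite mxE.
  exact: AB.
by move/(can_inj (mulmxK (ug ax)))/rowP/(_ k); rewrite !mxE.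
Qed.

Lemma christoffel_sym a i j k x : dom a x ->
  christoffel g a i j k x = christoffel g a j i k x.
Proof.
move=> ax; congr (_ * _); apply: eq_bigr => l _; congr (_ * _).
rewrite [pder a i _ x + _]addrC; congr (_ - _).
apply: (pder_ext hM l (subdomain_dom hM a) ax) => y _; exact: form_comp_sym.
Qed.

(** [g] is parallel. Adding two symbols of the first kind makes all derivatives but one cancel. *)
Lemma metric_compatible a i j l x : dom a x ->
  pder a i (form_comp a g j l) x =
  \sum_k christoffel g a i j k x * form_comp a g k l x +
  \sum_k christoffel g a i l k x * form_comp a g k j x.
Proof.
move=> ax; rewrite !christoffel_lower//.
have E k p q : pder a k (form_comp a g p q) x = pder a k (form_comp a g q p) x.
  by apply: (pder_ext hM k (subdomain_dom hM a) ax) => y _; exact: form_comp_sym.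
rewrite (E i l j).
by field.
Qed.

End LeviCivitaInCharts.

(** * Surfaces *)

Lemma sum_ord2 (V : nmodType) (F : 'I_2 -> V) : \sum_i F i = F 0 + F 1.
Proof.
rewrite !big_ord_recl big_ord0 addr0; congr (_ + F _); exact: val_inj.
Qed.

Lemma forall_ord2 (P : 'I_2 -> Prop) : P 0 -> P 1 -> forall i, P i.
Proof.
move=> P0 P1 [[|[|//]] i2].
- by rewrite (_ : Ordinal i2 = 0)//; exact: val_inj.
- by rewrite (_ : Ordinal i2 = 1)//; exact: val_inj.
Qed.

Section Curvature.
Context {R : realType} {n : nat} {M : chartedSpace R n}.
Variable G : M -> 'M[R]_n.

(* The components R^l_ijk of the curvature tensor. *)
Definition curvature_comp (a : chart M) i j k l (x : M) : R :=
  pder a i (christoffel G a j k l) x - pder a j (christoffel G a i k l) x +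
  \sum_p (christoffel G a j k p x * christoffel G a i p l x
          - christoffel G a i k p x * christoffel G a j p l x).

Lemma riemannE x v w z l : riemann G x v w z 0 l =
  \sum_i \sum_j \sum_k v 0 i * w 0 j * z 0 k * curvature_comp (chart_at x) i j k l x.
Proof. by rewrite mxE. Qed.

Lemma ricciE x j k :
  ricci G x j k = \sum_i curvature_comp (chart_at x) i j k i x.
Proof.
rewrite mxE; apply: eq_bigr => i _; rewrite riemannE.
rewrite (bigD1 i)//= [X in _ + X]big1 ?addr0 => [|p pi]; last first.
  rewrite big1// => q _; rewrite big1// => r _.
  by rewrite !mxE (negbTE pi) andbF !mul0r.
rewrite (bigD1 j)//= [X in _ + X]big1 ?addr0 => [|p pj]; last first.
  by rewrite big1// => q _; rewrite !mxE (negbTE pj) andbF mulr0 !mul0r.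
rewrite (bigD1 k)//= [X in _ + X]big1 ?addr0 => [|p pk]; last first.
  by rewrite !mxE (negbTE pk) !andbF mulr0 !mul0r.
by rewrite !mxE !eqxx !mul1r.
Qed.

Lemma curvature_comp_anti a i j k l x :
  curvature_comp a i j k l x = - curvature_comp a j i k l x.
Proof.
rewrite /curvature_comp opprD opprB; congr (_ + _).
by rewrite -sumrN; apply: eq_bigr => p _; rewrite opprB.
Qed.

End Curvature.

(* In the "algebra" lemmas, [G], [Ga], [X], [du] stand for the values at a point
   of the metric, the Christoffel symbols, the gradient and the differential of
   [u], and [dG], [ddG], [dGa] for iterated partial derivatives, whose first
   indices are the directions of differentiation. *)
Lemma curvature_lower_anti_algebra (R : comRingType) (G : 'I_2 -> 'I_2 -> R)
    (Ga dG : 'I_2 -> 'I_2 -> 'I_2 -> R) (dGa ddG : 'I_2 -> 'I_2 -> 'I_2 -> 'I_2 -> R) :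
  G 1 0 = G 0 1 ->
  (forall i j l, dG i j l = Ga i j 0 * G 0 l + Ga i j 1 * G 1 l
    + (Ga i l 0 * G 0 j + Ga i l 1 * G 1 j)) ->
  (forall i j k l, ddG i j k l =
    (dGa i j k 0 * G 0 l + Ga j k 0 * dG i 0 l
    + (dGa i j k 1 * G 1 l + Ga j k 1 * dG i 1 l))
    + (dGa i j l 0 * G 0 k + Ga j l 0 * dG i 0 k
    + (dGa i j l 1 * G 1 k + Ga j l 1 * dG i 1 k))) ->
  forall i j k m, ddG i j k m = ddG j i k m ->
  \sum_l (dGa i j k l - dGa j i k l
          + \sum_p (Ga j k p * Ga i p l - Ga i k p * Ga j p l)) * G l m =
  - \sum_l (dGa i j m l - dGa j i m l
          + \sum_p (Ga j m p * Ga i p l - Ga i m p * Ga j p l)) * G l k.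
Proof.
(* Once first derivatives of the metric are eliminated, the claim is the commutation of its second
   derivatives rearranged: terms quadratic in Christoffel symbols come from the eliminated first
   derivatives. *)
move=> G10 HdG HddG i j k m /eqP; rewrite !HddG !HdG -subr_eq0 => /eqP E.
apply/eqP; rewrite -subr_eq0 opprK; apply/eqP; rewrite -[RHS]E !sum_ord2 G10.
ring.
Qed.

(** Here [c0], [c1] and [d0], [d1] are the components R^l_01k for k = 0 and k = 1, and [p] is the
    Ricci endomorphism. Antisymmetry leaves one lowered component [r]; each unknown, multiplied by
    the determinant [d], is a multiple of [r], and half the trace of [p] is r / d, the Gauss
    curvature. *)
Lemma surface_curvature_algebra (R : realFieldType)
    (g00 g01 g11 c0 c1 d0 d1 p00 p01 p10 p11 : R) :
  g00 * g11 - g01 * g01 != 0 ->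
  c0 * g00 + c1 * g01 = 0 -> d0 * g01 + d1 * g11 = 0 ->
  c0 * g01 + c1 * g11 = - (d0 * g00 + d1 * g01) ->
  p00 * g00 + p01 * g01 = - c1 -> p00 * g01 + p01 * g11 = - d1 ->
  p10 * g00 + p11 * g01 = c0 -> p10 * g01 + p11 * g11 = d0 ->
  [/\ c0 = (p00 + p11) / 2 * g01, c1 = - ((p00 + p11) / 2 * g00),
     d0 = (p00 + p11) / 2 * g11 & d1 = - ((p00 + p11) / 2 * g01)].
Proof.
move=> dn0 L00 L11 L01 P00 P01 P10 P11.
pose r := d0 * g00 + d1 * g01; pose d := g00 * g11 - g01 * g01.
have {}L01 : c0 * g01 + c1 * g11 + r = 0 by rewrite L01 addNr.
have Hc0 : d * c0 = r * g01.
  transitivity (r * g01 + g11 * (c0 * g00 + c1 * g01)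
                - g01 * (c0 * g01 + c1 * g11 + r)); first by rewrite /d; ring.
  by rewrite L00 L01; ring.
have Hc1 : d * c1 = - (r * g00).
  transitivity (- (r * g00) - g01 * (c0 * g00 + c1 * g01)
                + g00 * (c0 * g01 + c1 * g11 + r)); first by rewrite /d; ring.
  by rewrite L00 L01; ring.
have Hd0 : d * d0 = r * g11.
  transitivity (r * g11 - g01 * (d0 * g01 + d1 * g11)); first by rewrite /d /r; ring.
  by rewrite L11; ring.
have Hd1 : d * d1 = - (r * g01).
  transitivity (- (r * g01) + g00 * (d0 * g01 + d1 * g11)); first by rewrite /d /r; ring.
  by rewrite L11; ring.
have HP00 : d * p00 = r.
  apply: (mulfI dn0); rewrite -/d.
  transitivity (d * (g11 * (p00 * g00 + p01 * g01) - g01 * (p00 * g01 + p01 * g11))).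
    by rewrite /d; ring.
  rewrite P00 P01; transitivity (g01 * (d * d1) - g11 * (d * c1)); first by ring.
  by rewrite Hd1 Hc1 /d; ring.
have HP11 : d * p11 = r.
  apply: (mulfI dn0); rewrite -/d.
  transitivity (d * (g00 * (p10 * g01 + p11 * g11) - g01 * (p10 * g00 + p11 * g01))).
    by rewrite /d; ring.
  rewrite P10 P11; transitivity (g00 * (d * d0) - g01 * (d * c0)); first by ring.
  by rewrite Hd0 Hc0 /d; ring.
have HK : d * ((p00 + p11) / 2) = r by rewrite mulrA mulrDr HP00 HP11; field.
split; apply: (mulfI dn0); rewrite -/d ?mulrN mulrA HK //.
Qed.

Section Surface.
Context {R : realType} {M : chartedSpace R 2}.
Hypothesis hM : smooth_manifold M.
Implicit Types (a b : chart M) (x : M).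

Section Metric.
Variable g : M -> 'M[R]_2.
Hypothesis hg : riemannian g.

Local Notation gam := (christoffel g).
Local Notation gc a := (form_comp a g).

Let sg a i j : smooth_inside a (dom a) (gc a i j).
Proof. by case: hg => + _ _; apply. Qed.

Let sgam a i j k : smooth_inside a (dom a) (gam a i j k).
Proof. exact: christoffel_smooth. Qed.

Lemma pder_metric a i j l x : dom a x ->
  pder a i (gc a j l) x = gam a i j 0 x * gc a 0 l x + gam a i j 1 x * gc a 1 l x
    + (gam a i l 0 x * gc a 0 j x + gam a i l 1 x * gc a 1 j x).
Proof. by move=> ax; rewrite (metric_compatible hM)// !sum_ord2. Qed.

Lemma pder_pder_metric a i j k l x : dom a x ->
  pder a i (pder a j (gc a k l)) x =
    (pder a i (gam a j k 0) x * gc a 0 l x + gam a j k 0 x * pder a i (gc a 0 l) x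
    + (pder a i (gam a j k 1) x * gc a 1 l x + gam a j k 1 x * pder a i (gc a 1 l) x))
    + (pder a i (gam a j l 0) x * gc a 0 k x + gam a j l 0 x * pder a i (gc a 0 k) x
    + (pder a i (gam a j l 1) x * gc a 1 k x + gam a j l 1 x * pder a i (gc a 1 k) x)).
Proof.
move=> ax; have dg p q : is_pder a i (gc a p q) x (pder a i (gc a p q) x).
  exact: smooth_inside_is_pder.
have dgam p q r : is_pder a i (gam a p q r) x (pder a i (gam a p q r) x).
  exact: smooth_inside_is_pder.
rewrite (pder_ext hM i (subdomain_dom hM a) ax (fun y ay => pder_metric j k l ay)).
by apply: is_pderE; do !apply: is_pderD; apply: is_pderM.
Qed.

Lemma curvature_lower_anti a i j k m x : dom a x ->
  \sum_l curvature_comp g a i j k l x * gc a l m x =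
  - \sum_l curvature_comp g a i j m l x * gc a l k x.
Proof.
move=> ax; exact: (@curvature_lower_anti_algebra R (fun i j => gc a i j x)
  (fun i j k => gam a i j k x) (fun i j k => pder a i (gc a j k) x)
  (fun i j k l => pder a i (gam a j k l) x)
  (fun i j k l => pder a i (pder a j (gc a k l)) x)
  (form_comp_sym hg a 1 0 x) (fun i j l => pder_metric i j l ax)
  (fun i j k l => pder_pder_metric i j k l ax) i j k m
  (pder_comm hM i j (subdomain_dom hM a) (sg a k m) ax)).
Qed.

(** Antisymmetry in both pairs of indices leaves a surface one curvature component, hence R(v,w)z =
    K (g(w,z) v - g(v,z) w) with K half of the scalar curvature. *)
Lemma scal_curvature x k l :
  curvature_comp g (chart_at x) 0 1 k l x =
  scal g x / 2 * (g x 1 k * (l == 0)%:R - g x 0 k * (l == 1)%:R).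
Proof.
have ax := manifold_cover hM x; set a := chart_at x in ax *.
have E i j : gc a i j x = g x i j by rewrite /form_comp form_in_at.
have gs : g x 1 0 = g x 0 1 by rewrite -!E form_comp_sym.
have L k' m := curvature_lower_anti 0 1 k' m ax.
have := L 0 0; have := L 1 1; have := L 0 1.
rewrite !sum_ord2 !E gs.
set c0 := curvature_comp g a 0 1 0 0 x; set c1 := curvature_comp g a 0 1 0 1 x.
set d0 := curvature_comp g a 0 1 1 0 x; set d1 := curvature_comp g a 0 1 1 1 x.
move=> L01 L11 L00.
have ug := riemannian_unit x hg.
pose d := g x 0 0 * g x 1 1 - g x 0 1 * g x 0 1.
have d0' : d != 0.
  move: ug; rewrite unitmxE unitfE (expand_det_row _ 0) sum_ord2.
  rewrite /cofactor !det_mx11 !mxE /= expr0 expr1 mul1r mulN1r mulrN.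
  have -> : lift 0 0 = 1 :> 'I_2 by exact: val_inj.
  have -> : lift 1 0 = 0 :> 'I_2 by exact: val_inj.
  by rewrite gs.
pose r := d0 * g x 0 0 + d1 * g x 0 1.
have z2 (y : R) : y = - y -> y = 0 by move=> /eqP; rewrite -addr_eq0 -mulr2n mulrn_eq0 => /eqP.
have c00 k' l' p : curvature_comp g a p p k' l' x = 0.
  exact/z2/curvature_comp_anti.
pose P := ricci g x *m invmx (g x).
have PE : P *m g x = ricci g x by rewrite mulmxKV.
have PE' j m : P j 0 * g x 0 m + P j 1 * g x 1 m = ricci g x j m.
  by rewrite -PE [in RHS]mxE sum_ord2.
have := PE' 1 1; have := PE' 1 0; have := PE' 0 1; have := PE' 0 0.
rewrite !ricciE !sum_ord2 -/a !c00 !add0r !addr0 gs.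
rewrite !(curvature_comp_anti _ _ 1 0) -/c0 -/c1 -/d0 -/d1 => P00 P01 P10 P11.
have sE : scal g x = P 0 0 + P 1 1 by rewrite /scal /trace_form /mxtrace sum_ord2.
have [Ec0 Ec1 Ed0 Ed1] := surface_curvature_algebra d0' (z2 _ L00) (z2 _ L11) L01
  P00 P01 P10 P11.
rewrite sE; move: l; apply: forall_ord2; move: k; apply: forall_ord2;
  rewrite -?/c0 -?/c1 -?/d0 -?/d1 ?gs/= ?mulr1 ?mulr0 ?subr0 ?sub0r ?mulrN //.
Qed.

End Metric.
End Surface.

(** * The Cotton-York tensor in charts *)

Section Cotton.
Context {R : realType} {n : nat} {M : chartedSpace R n}.

(** The antisymmetrized covariant derivative of [T] in its first two indices; the terms with
    Christoffel symbols in [i], [j] cancel by symmetry and are left out. *)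
Definition cotton_comp (G T : M -> 'M[R]_n) (a : chart M) i j k (x : M) : R :=
  pder a i (form_comp a T j k) x - pder a j (form_comp a T i k) x
  - \sum_l christoffel G a i k l x * form_comp a T j l x
  + \sum_l christoffel G a j k l x * form_comp a T i l x.

Hypothesis hM : smooth_manifold M.

Lemma tangent_map_id x : tangent_map (@id M) x = 1%:M.
Proof. by rewrite -[LHS]/(trans _ _ x) trans_id//; exact: manifold_cover. Qed.

Lemma covE (G : M -> 'M[R]_n) X Y x k : cov G X Y x 0 k =
  \sum_i X x 0 i * pder (chart_at x) i (fun y => vec_in (chart_at x) y (Y y) 0 k) x
  + \sum_i \sum_j christoffel G (chart_at x) i j k x * X x 0 i * Y x 0 j.
Proof. by rewrite mxE tangent_map_id mulmx1. Qed.

End Cotton.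

(** [E] stands for the endomorphism obtained from the form [T] by raising an index. Derivatives of
    [U] and [V] cancel, and lowering the index commutes with differentiation because the metric is
    parallel. *)
Lemma cotton_york_algebra (R : comRingType) (G E : 'I_2 -> 'I_2 -> R)
    (Ga dG dE dT : 'I_2 -> 'I_2 -> 'I_2 -> R) (U V W : 'I_2 -> R)
    (dU dV dVE dUE : 'I_2 -> 'I_2 -> R) :
  G 1 0 = G 0 1 ->
  (forall i j k, Ga i j k = Ga j i k) ->
  (forall i j l, dG i j l = Ga i j 0 * G 0 l + Ga i j 1 * G 1 l
    + (Ga i l 0 * G 0 j + Ga i l 1 * G 1 j)) ->
  (forall i j k, dT i j k = dE i j 0 * G 0 k + E j 0 * dG i 0 k
    + (dE i j 1 * G 1 k + E j 1 * dG i 1 k)) ->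
  (forall i k, dVE i k = dV i 0 * E 0 k + V 0 * dE i 0 k
    + (dV i 1 * E 1 k + V 1 * dE i 1 k)) ->
  (forall i k, dUE i k = dU i 0 * E 0 k + U 0 * dE i 0 k
    + (dU i 1 * E 1 k + U 1 * dE i 1 k)) ->
  let mu (v : 'I_2 -> R) k := v 0 * E 0 k + v 1 * E 1 k in
  let T i j := E i 0 * G 0 j + E i 1 * G 1 j in
  let nab (X Y : 'I_2 -> R) dY k := \sum_i X i * dY i k
     + \sum_i \sum_j Ga i j k * X i * Y j in
  \sum_k \sum_m (nab U (mu V) dVE k - mu (nab U V dV) k
           - (nab V (mu U) dUE k - mu (nab V U dU) k)) * G k m * W m
  = \sum_i \sum_j \sum_k U i * V j * W k *
    (dT i j k - dT j i k - \sum_l Ga i k l * T j l + \sum_l Ga j k l * T i l).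
Proof.
move=> G10 HGa HdG HdT HdVE HdUE mu T nab.
rewrite /nab /mu /T !sum_ord2 !HdT !HdVE !HdUE !HdG !(HGa 1 0) G10.
ring.
Qed.

Section SurfaceCotton.
Context {R : realType} {M : chartedSpace R 2}.
Hypothesis hM : smooth_manifold M.
Implicit Types (a b : chart M) (x : M).
Variable g : M -> 'M[R]_2.
Hypothesis hg : riemannian g.
Local Notation gam := (christoffel g).
Local Notation gc a := (form_comp a g).

(** Tensoriality: only the values of the three fields at [x] matter. This is what allows comparison
    with the curvature, which is defined pointwise. *)
Lemma cotton_yorkE (D : (M -> 'M[R]_2) -> (M -> 'M[R]_2)) U V W x :
  tensor02 (D g) -> vector_field U -> vector_field V ->
  cotton_york D g U V W x = \sum_i \sum_j \sum_k U x 0 i * V x 0 j * W x 0 k *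
    cotton_comp g (D g) (chart_at x) i j k x.
Proof.
move=> sD sU sV; have ax := manifold_cover hM x; set a := chart_at x in ax *.
have sda := subdomain_dom hM a.
have [sg _ _] := hg.
pose E i j y := (form_in a y (D g y) *m invmx (form_in a y (g y))) i j.
have sE i j : smooth_inside a (dom a) (E i j).
  apply: (@smooth_insideP _ _ _ hM a (dom a)
     (fun y => \sum_k form_comp a (D g) i k y * invmx (form_in a y (g y)) k j)) => //.
    by move=> y _; rewrite /E mxE.
  apply: smooth_inside_sum => // k; apply: smooth_insideM => //; first exact: sD.
  exact: inverse_comp_smooth.
have dE i j k : is_pder a i (E j k) x (pder a i (E j k) x).
  exact: smooth_inside_is_pder.
have dg i j k : is_pder a i (gc a j k) x (pder a i (gc a j k) x).
  by apply: smooth_inside_is_pder ax; exact: sg.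
have dX X : vector_field X -> forall i k, is_pder a i (fun y => vec_in a y (X y) 0 k) x
    (pder a i (fun y => vec_in a y (X y) 0 k) x).
  by move=> sX i k; apply: smooth_inside_is_pder ax; exact: sX.
have EG i j y : dom a y -> form_comp a (D g) i j y =
    E i 0 y * gc a 0 j y + E i 1 y * gc a 1 j y.
  move=> ay; rewrite -[RHS](sum_ord2 (fun k => E i k y * gc a k j y)).
  have ug : form_in a y (g y) \in unitmx by rewrite form_in_unit// riemannian_unit.
  have /matrixP/(_ i j) DE := mulmxKV ug (form_in a y (D g y)).
  by apply: (etrans (esym DE)); rewrite mxE.
have dT i j k : pder a i (form_comp a (D g) j k) x =
    pder a i (E j 0) x * gc a 0 k x + E j 0 x * pder a i (gc a 0 k) x
    + (pder a i (E j 1) x * gc a 1 k x + E j 1 x * pder a i (gc a 1 k) x).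
  rewrite (pder_ext hM i sda ax (fun y ay => EG j k y ay)).
  by apply: is_pderE; apply: is_pderD; apply: is_pderM.
have XE (X : M -> 'rV[R]_2) k y : dom a y -> vec_in a y (X y *m sharp g (D g) y) 0 k =
    vec_in a y (X y) 0 0 * E 0 k y + vec_in a y (X y) 0 1 * E 1 k y.
  move=> ay; rewrite vec_in_mul// endo_in_sharp// ?riemannian_unit//.
  by rewrite mxE sum_ord2.
have dXE X : vector_field X -> forall i k,
    pder a i (fun y => vec_in a y (X y *m sharp g (D g) y) 0 k) x =
    pder a i (fun y => vec_in a y (X y) 0 0) x * E 0 k x + X x 0 0 * pder a i (E 0 k) x
    + (pder a i (fun y => vec_in a y (X y) 0 1) x * E 1 k x
       + X x 0 1 * pder a i (E 1 k) x).
  move=> sX i k; rewrite (pder_ext hM i sda ax (fun y ay => XE X k y ay)).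
  rewrite -[X x](vec_in_at hM x) -/a.
  by apply: is_pderE; apply: is_pderD; apply: is_pderM => //; exact: dX.
have XEx (X : M -> 'rV[R]_2) k : (X x *m sharp g (D g) x) 0 k = X x 0 0 * E 0 k x + X x 0 1 * E 1 k x.
  by have := XE X k x ax; rewrite !(vec_in_at hM x).
have := @cotton_york_algebra R (fun i j => gc a i j x) (fun i j => E i j x)
  (fun i j k => gam a i j k x) (fun i j k => pder a i (gc a j k) x)
  (fun i j k => pder a i (E j k) x) (fun i j k => pder a i (form_comp a (D g) j k) x)
  (U x 0) (V x 0) (W x 0)
  (fun i k => pder a i (fun y => vec_in a y (U y) 0 k) x)
  (fun i k => pder a i (fun y => vec_in a y (V y) 0 k) x)
  (fun i k => pder a i (fun y => vec_in a y (V y *m sharp g (D g) y) 0 k) x)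
  (fun i k => pder a i (fun y => vec_in a y (U y *m sharp g (D g) y) 0 k) x)
  (form_comp_sym hg a 1 0 x) (fun i j k => christoffel_sym hM hg i j k ax)
  (fun i j l => pder_metric hM hg i j l ax) dT (dXE V sV) (dXE U sU).
move=> /= H.
transitivity (\sum_i \sum_j \sum_k U x 0 i * V x 0 j * W x 0 k *
  (pder a i (form_comp a (D g) j k) x - pder a j (form_comp a (D g) i k) x -
   \sum_l gam a i k l x * (E j 0 x * gc a 0 l x + E j 1 x * gc a 1 l x) +
   \sum_l gam a j k l x * (E i 0 x * gc a 0 l x + E i 1 x * gc a 1 l x))); last first.
  apply: eq_bigr => i _; apply: eq_bigr => j _; apply: eq_bigr => k _.
  congr (_ * (_ - _ + _)); apply: eq_bigr => l _; by rewrite EG.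
rewrite -H /cotton_york /inner mxE exchange_big/=; apply: eq_bigr => m _.
rewrite mxE big_distrl/=; apply: eq_bigr => k _; rewrite [(W x)^T _ _]mxE.
congr (_ * _ * _); last by rewrite /form_comp form_in_at.
have covEx X Y k' : (cov g X Y x *m sharp g (D g) x) 0 k' =
  cov g X Y x 0 0 * E 0 k' x + cov g X Y x 0 1 * E 1 k' x.
  exact: (XEx (fun=> cov g X Y x)).
have rowB (v w : 'rV[R]_2) k' : (v - w) 0 k' = v 0 k' - w 0 k' by rewrite !mxE.
have sumE (X Y : M -> 'rV[R]_2) k' :
    \sum_i \sum_j gam a i j k' x * X x 0 i * (Y x *m sharp g (D g) x) 0 j =
    \sum_i \sum_j gam a i j k' x * X x 0 i * (Y x 0 0 * E 0 j x + Y x 0 1 * E 1 j x).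
  by apply: eq_bigr => i _; apply: eq_bigr => j _; rewrite XEx.
by rewrite /cov_endo !rowB !covEx !(covE hM) -/a !sumE.
Qed.

End SurfaceCotton.

(** * The Hessian in charts *)

(** Since the metric is parallel, the lowered derivative of the gradient is the covariant derivative
    of du. *)
Lemma hessian_algebra (R : comRingType) (G : 'I_2 -> 'I_2 -> R)
    (Ga dG : 'I_2 -> 'I_2 -> 'I_2 -> R) (X du : 'I_2 -> R) (dX ddu : 'I_2 -> 'I_2 -> R) :
  G 1 0 = G 0 1 ->
  (forall i j l, dG i j l = Ga i j 0 * G 0 l + Ga i j 1 * G 1 l
    + (Ga i l 0 * G 0 j + Ga i l 1 * G 1 j)) ->
  (forall j, du j = X 0 * G 0 j + X 1 * G 1 j) ->
  (forall i j, ddu i j = dX i 0 * G 0 j + X 0 * dG i 0 j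
     + (dX i 1 * G 1 j + X 1 * dG i 1 j)) ->
  forall i j,
  \sum_k (dX i k + \sum_l Ga i l k * X l) * G k j = ddu i j - \sum_l Ga i j l * du l.
Proof.
by move=> G10 HdG Hdu Hddu i j; rewrite Hddu !sum_ord2 !Hdu !HdG G10; ring.
Qed.

(* [J] is the Jacobian of the change of charts; the lemma is doubled, and the
   Christoffel symbols are expressed through [dG], to avoid divisions. *)
Lemma hessian_transform_algebra (R : comRingType) (J Ga uaa : 'I_2 -> 'I_2 -> R)
    (dJ dGa : 'I_2 -> 'I_2 -> 'I_2 -> R) (Xb Xa ua : 'I_2 -> R)
    (ubb : 'I_2 -> 'I_2 -> R) (dGb : 'I_2 -> 'I_2 -> 'I_2 -> R) :
  Ga 1 0 = Ga 0 1 -> (forall r, dGa r 1 0 = dGa r 0 1) ->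
  (forall p, dJ 1 0 p = dJ 0 1 p) ->
  (forall p, Xa p = \sum_k Xb k * J k p) ->
  (forall p, ua p = \sum_q Xa q * Ga q p) ->
  (forall i j, ubb i j = \sum_q (dJ i j q * ua q + J j q * \sum_p J i p * uaa p q)) ->
  (forall k i j, dGb k i j =
    \sum_p \sum_q ((dJ k i p * J j q + J i p * dJ k j q) * Ga p q
      + J i p * J j q * \sum_r J k r * dGa r p q)) ->
  forall i j,
  2 * ubb i j - \sum_k Xb k * (dGb i j k + dGb j i k - dGb k i j) =
  \sum_p \sum_q J i p * J j q *
    (2 * uaa p q - \sum_r Xa r * (dGa p q r + dGa q p r - dGa r p q)).
Proof.
move=> G10 dG10 dJ10 HXa Hua Hubb HdGb.
by apply: forall_ord2; apply: forall_ord2;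
  rewrite !sum_ord2 !Hubb !HdGb !sum_ord2 !Hua !sum_ord2 !HXa !sum_ord2 ?G10 ?dG10 ?dJ10;
  ring.
Qed.

Section Hessian.
Context {R : realType} {M : chartedSpace R 2}.
Hypothesis hM : smooth_manifold M.
Implicit Types (a b : chart M) (x : M) (u : M -> R).
Variable g : M -> 'M[R]_2.
Hypothesis hg : riemannian g.
Local Notation gam := (christoffel g).
Local Notation gc a := (form_comp a g).

Let sg a i j : smooth_inside a (dom a) (gc a i j).
Proof. by case: hg => + _ _; apply. Qed.

Let ug a x : dom a x -> form_in a x (g x) \in unitmx.
Proof. by move=> ax; rewrite form_in_unit// (riemannian_unit x hg). Qed.

Definition hess_comp a i j u x :=
  pder a i (pder a j u) x - \sum_l gam a i j l x * pder a l u x.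

Definition grad_comp a k u x := vec_in a x (gradient g u x) 0 k.

Lemma grad_comp_smooth a k u : smooth_fun u ->
  smooth_inside a (dom a) (grad_comp a k u).
Proof.
move=> su; have sda := subdomain_dom hM a.
apply: (@smooth_insideP _ _ _ hM a (dom a)
  (fun y => \sum_j pder a j u y * invmx (form_in a y (g y)) j k)) => //.
  move=> y /set_mem ay; rewrite /grad_comp gradient_in// ?riemannian_unit//.
  by rewrite mxE; apply: eq_bigr => j _; rewrite !mxE.
apply: smooth_inside_sum => // j; apply: smooth_insideM => //.
  by apply: smooth_inside_pder => //; exact: su.
exact: inverse_comp_smooth.
Qed.

Lemma grad_lower a u y j : smooth_fun u -> dom a y ->
  pder a j u y = grad_comp a 0 u y * gc a 0 j y + grad_comp a 1 u y * gc a 1 j y.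
Proof.
move=> su ay; rewrite -[RHS](sum_ord2 (fun k => grad_comp a k u y * gc a k j y)).
have E : vec_in a y (gradient g u y) *m form_in a y (g y) = (dcol a u y)^T.
  by rewrite gradient_in// ?riemannian_unit// mulmxKV// ug.
have /rowP/(_ j) := E; rewrite mxE => ->; by rewrite !mxE.
Qed.

Lemma grad_sqnorm_comp a u y : smooth_fun u -> dom a y ->
  grad_sqnorm g u y = grad_comp a 0 u y * pder a 0 u y + grad_comp a 1 u y * pder a 1 u y.
Proof.
move=> su ay; rewrite /grad_sqnorm (inner_in hM _ _ _ ay) /inner.
rewrite mxE sum_ord2 ![((vec_in _ _ _)^T) _ _]mxE.
rewrite ![(_ *m form_in _ _ _) _ _]mxE !sum_ord2.
by rewrite -!(grad_lower _ su ay) mulrC [X in _ + X]mulrC.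
Qed.

Lemma pder_grad_lower a u x i j : smooth_fun u -> dom a x ->
  pder a i (pder a j u) x =
    pder a i (grad_comp a 0 u) x * gc a 0 j x
    + grad_comp a 0 u x * pder a i (gc a 0 j) x
    + (pder a i (grad_comp a 1 u) x * gc a 1 j x
    + grad_comp a 1 u x * pder a i (gc a 1 j) x).
Proof.
move=> su ax; have sda := subdomain_dom hM a.
have dX k : is_pder a i (grad_comp a k u) x (pder a i (grad_comp a k u) x).
  by apply: smooth_inside_is_pder ax; exact: grad_comp_smooth.
have dg k l : is_pder a i (gc a k l) x (pder a i (gc a k l) x).
  exact: smooth_inside_is_pder.
rewrite (pder_ext hM i sda ax (fun y ay => grad_lower j su ay)).
by apply: is_pderE; apply: is_pderD; apply: is_pderM.
Qed.

Lemma hessianE u x i j : smooth_fun u ->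
  hessian g u x i j = hess_comp (chart_at x) i j u x.
Proof.
move=> su; have ax := manifold_cover hM x; set a := chart_at x in ax *.
have H := @hessian_algebra R (fun i j => gc a i j x) (fun i j k => gam a i j k x)
  (fun i j k => pder a i (gc a j k) x) (fun k => grad_comp a k u x)
  (fun j => pder a j u x) (fun i k => pder a i (grad_comp a k u) x)
  (fun i j => pder a i (pder a j u) x) (form_comp_sym hg a 1 0 x)
  (fun i j l => pder_metric hM hg i j l ax)
  (fun j => grad_lower j su ax) (fun i j => pder_grad_lower i j su ax) i j.
rewrite -[RHS]H /hessian mxE; apply: eq_bigr => k _; congr (_ * _); last first.
  by rewrite /form_comp form_in_at.
(* A row of the Hessian is seen as a covariant derivative along the field with constant entries, so
   that [covE] applies. *)
rewrite mxE; rewrite -[cov_along _ _ _ _ _]/(cov g (fun=> delta_mx 0 i) (gradient g u) x).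
rewrite (covE hM) -/a /grad_comp vec_in_at//; congr (_ + _).
  rewrite sum_ord2; move: (i); apply: forall_ord2; rewrite !mxE/=.
    by rewrite mul1r mul0r addr0.
  by rewrite mul1r mul0r add0r.
rewrite sum_ord2; move: (i); apply: forall_ord2; rewrite !mxE/=.
  rewrite [X in _ + X]big1 ?addr0; last by move=> l _; rewrite mulr0 mul0r.
  by apply: eq_bigr => l _; rewrite mulr1.
rewrite [X in X + _]big1 ?add0r; last by move=> l _; rewrite mulr0 mul0r.
by apply: eq_bigr => l _; rewrite mulr1.
Qed.

(** Pairing the Christoffel symbols with du equals pairing those of the first kind with the
    gradient, which absorbs the inverse metric. This is the form in which changes of charts are
    polynomial. *)
Lemma hess_comp_lower a u x i j : smooth_fun u -> dom a x ->
  2 * hess_comp a i j u x = 2 * pder a i (pder a j u) x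
   - \sum_k grad_comp a k u x *
     (pder a i (gc a j k) x + pder a j (gc a i k) x - pder a k (gc a i j) x).
Proof.
move=> su ax; rewrite /hess_comp mulrBr; congr (_ - _).
have L k := christoffel_lower hM hg i j k ax.
have {L}L k : pder a i (gc a j k) x + pder a j (gc a i k) x - pder a k (gc a i j) x
  = 2 * (gam a i j 0 x * gc a 0 k x + gam a i j 1 x * gc a 1 k x).
  by have := L k; rewrite sum_ord2 => ->; rewrite mulrA mulfV ?mul1r// pnatr_eq0.
rewrite !sum_ord2 !L !(grad_lower _ su ax) (form_comp_sym hg a 1 0); ring.
Qed.

Lemma hess_comp_trans a b u x i j : smooth_fun u -> dom a x -> dom b x ->
  hess_comp b i j u x = \sum_p \sum_q trans b a x i p * trans b a x j q *
    hess_comp a p q u x.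
Proof.
move=> su ax bx.
have sda := subdomain_dom hM a; have sdba := subdomainI hM b a.
have bax : (dom b `&` dom a) x by [].
have sJ p q : smooth_inside b (dom b `&` dom a) (fun y => trans b a y p q).
  exact: smooth_inside_trans.
have dJ i' p q : is_pder b i' (fun y => trans b a y p q) x
    (pder b i' (fun y => trans b a y p q) x).
  exact: smooth_inside_is_pder.
have ub j' y : (dom b `&` dom a) y ->
    pder b j' u y = \sum_q trans b a y j' q * pder a q u y.
  by move=> [yb ya]; exact: is_pderE (pder_chain hM j' sda (su a) ya yb).
have gb i' j' y : (dom b `&` dom a) y -> gc b i' j' y =
    \sum_p \sum_q trans b a y i' p * trans b a y j' q * gc a p q y.
  move=> [yb ya]; rewrite /form_comp (form_in_trans hM _ ya yb) mxE exchange_big/=.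
  apply: eq_bigr => q _; rewrite mxE big_distrl/=; apply: eq_bigr => p _.
  by rewrite [(trans b a y)^T _ _]mxE mulrAC.
have dua i' q : is_pder b i' (pder a q u) x
    (\sum_p trans b a x i' p * pder a p (pder a q u) x).
  apply: (pder_chain hM i' sda _ ax bx).
  by apply: smooth_inside_pder => //; exact: su.
have dga k p q : is_pder b k (gc a p q) x
    (\sum_r trans b a x k r * pder a r (gc a p q) x).
  exact: (pder_chain hM k sda _ ax bx).
have ubb i' j' : pder b i' (pder b j' u) x = \sum_q
    (pder b i' (fun y => trans b a y j' q) x * pder a q u x
     + trans b a x j' q * \sum_p trans b a x i' p * pder a p (pder a q u) x).
  rewrite (pder_ext hM i' sdba bax (ub j')).
  by apply: is_pderE; apply: is_pder_sum => q; exact: is_pderM.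
have dgb k i' j' : pder b k (gc b i' j') x = \sum_p \sum_q
    ((pder b k (fun y => trans b a y i' p) x * trans b a x j' q
      + trans b a x i' p * pder b k (fun y => trans b a y j' q) x) * gc a p q x
    + trans b a x i' p * trans b a x j' q
      * \sum_r trans b a x k r * pder a r (gc a p q) x).
  rewrite (pder_ext hM k sdba bax (gb i' j')).
  apply: is_pderE; apply: is_pder_sum => p; apply: is_pder_sum => q.
  by apply: is_pderM => //; exact: is_pderM.
have Xa p : grad_comp a p u x = \sum_k grad_comp b k u x * trans b a x k p.
  by rewrite /grad_comp (vec_in_trans hM _ bx ax) mxE.
(* Second derivatives of the transition map commute; this enters the cancellation of its
   non-tensorial terms. *)
have dJ10 p : pder b 1 (fun y => trans b a y 0 p) x = pder b 0 (fun y => trans b a y 1 p) x.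
  have E i' y : (dom b `&` dom a) y ->
      trans b a y i' p = pder b i' (fun z => chart_map a z 0 p) y.
    by move=> _; rewrite mxE.
  rewrite (pder_ext hM 1 sdba bax (E 0)) (pder_ext hM 0 sdba bax (E 1)).
  exact: (pder_comm hM 1 0 sdba (smooth_inside_chart_map hM b a p)).
have dg10 r : pder a r (gc a 1 0) x = pder a r (gc a 0 1) x.
  by apply: (pder_ext hM r sda ax) => y _; exact: form_comp_sym.
have H := @hessian_transform_algebra R (fun i j => trans b a x i j)
  (fun i j => gc a i j x) (fun i j => pder a i (pder a j u) x)
  (fun i j k => pder b i (fun y => trans b a y j k) x)
  (fun i j k => pder a i (gc a j k) x) (fun k => grad_comp b k u x)
  (fun k => grad_comp a k u x) (fun k => pder a k u x)
  (fun i j => pder b i (pder b j u) x) (fun i j k => pder b i (gc b j k) x)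
  (form_comp_sym hg a 1 0 x) dg10 dJ10 Xa
  (fun p => etrans (grad_lower p su ax)
     (esym (sum_ord2 (fun q => grad_comp a q u x * gc a q p x)))) ubb dgb i j.
have two : 2 != 0 :> R by rewrite pnatr_eq0.
apply: (mulfI two); rewrite (hess_comp_lower _ _ su bx) [LHS]H mulr_sumr.
apply: eq_bigr => p _; rewrite mulr_sumr; apply: eq_bigr => q _.
by rewrite -(hess_comp_lower _ _ su ax) mulrCA.
Qed.

(* The hypotheses give [D (rescale u g)] at each [y] through [chart_at y] only,
   and its derivative at [x] needs it in one chart around [x]: hence the
   tensoriality of the Hessian. *)
Lemma hessian_form_comp a u x i j : smooth_fun u -> dom a x ->
  form_comp a (hessian g u) i j x = hess_comp a i j u x.
Proof.
move=> su ax; have cx := manifold_cover hM x.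
rewrite (hess_comp_trans i j su cx ax) /form_comp /form_in mxE exchange_big/=.
apply: eq_bigr => q _; rewrite mxE big_distrl/=; apply: eq_bigr => p _.
by rewrite [((trans _ _ _)^T) _ _]mxE hessianE// mulrAC.
Qed.

End Hessian.

(** * Conformal invariance of the Cotton-York tensor *)

(* After the substitutions both sides differ by a multiple of
   [K * det G - (...)], which vanishes since [K] is the trace of [T]: this is
   where dimension 2 and the trace condition on Moebius structures enter. *)
Lemma cotton_conformal_algebra (R : realFieldType) (G T ddu : 'I_2 -> 'I_2 -> R)
    (Ga dG dT dddu Gah dTh : 'I_2 -> 'I_2 -> 'I_2 -> R)
    (dGa : 'I_2 -> 'I_2 -> 'I_2 -> 'I_2 -> R)
    (X du dN : 'I_2 -> R) (Th : 'I_2 -> 'I_2 -> R) (K : R) :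
  G 1 0 = G 0 1 -> T 1 0 = T 0 1 -> ddu 1 0 = ddu 0 1 ->
  (forall k, dddu 1 0 k = dddu 0 1 k) ->
  (forall k, Ga 1 0 k = Ga 0 1 k) ->
  (forall i j l, dG i j l = Ga i j 0 * G 0 l + Ga i j 1 * G 1 l
    + (Ga i l 0 * G 0 j + Ga i l 1 * G 1 j)) ->
  (forall j, du j = X 0 * G 0 j + X 1 * G 1 j) ->
  (forall i, dN i = \sum_l X l * (ddu i l - \sum_p Ga i l p * du p)) ->
  (forall k l, dGa 0 1 k l - dGa 1 0 k l
     + \sum_p (Ga 1 k p * Ga 0 p l - Ga 0 k p * Ga 1 p l)
     = K * (G 1 k * (l == 0)%:R - G 0 k * (l == 1)%:R)) ->
  K * (G 0 0 * G 1 1 - G 0 1 * G 0 1) =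
    G 1 1 * T 0 0 - 2 * G 0 1 * T 0 1 + G 0 0 * T 1 1 ->
  (forall i j k, Gah i j k = Ga i j k + (i == k)%:R * du j + (j == k)%:R * du i
     - G i j * X k) ->
  let N := (X 0 * du 0 + X 1 * du 1) / 2 in
  (forall j k, Th j k = T j k - N * G j k - (ddu j k - \sum_l Ga j k l * du l)
     + du j * du k) ->
  (forall i j k, dTh i j k = dT i j k - (dN i * G j k + N * dG i j k)
     - (dddu i j k - \sum_l (dGa i j k l * du l + Ga j k l * ddu i l))
     + (ddu i j * du k + du j * ddu i k)) ->
  forall k,
  dTh 0 1 k - dTh 1 0 k - \sum_l Gah 0 k l * Th 1 l + \sum_l Gah 1 k l * Th 0 l
  = dT 0 1 k - dT 1 0 k - \sum_l Ga 0 k l * T 1 l + \sum_l Ga 1 k l * T 0 l.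
Proof.
move=> G10 T10 ddu10 dddu10 Ga10 HdG Hdu HdN Hcurv HK HGah N HTh HdTh.
have {}Hcurv k l : dGa 0 1 k l = dGa 1 0 k l
     - \sum_p (Ga 1 k p * Ga 0 p l - Ga 0 k p * Ga 1 p l)
     + K * (G 1 k * (l == 0)%:R - G 0 k * (l == 1)%:R).
  by rewrite -Hcurv; ring.
have {}HK : K * (G 0 0 * G 1 1 - G 0 1 * G 0 1) -
    (G 1 1 * T 0 0 - 2 * G 0 1 * T 0 1 + G 0 0 * T 1 1) = 0 by rewrite HK subrr.
apply: forall_ord2.
  apply/eqP; rewrite -subr_eq0; apply/eqP.
  (* The multiplier of the trace relation is, up to sign, a component of the gradient of [u]; it
     comes from the curvature produced by commuting third covariant derivatives of [u]. *)
  transitivity (- X 1 * (K * (G 0 0 * G 1 1 - G 0 1 * G 0 1) -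
    (G 1 1 * T 0 0 - 2 * G 0 1 * T 0 1 + G 0 0 * T 1 1))); last by rewrite HK mulr0.
  rewrite !sum_ord2 !HTh !HdTh !HGah !HdN !sum_ord2 !HdG !Hcurv /N !Hdu !sum_ord2
    ?ddu10 ?dddu10 ?Ga10 ?G10 ?T10 /=.
  by field.
apply/eqP; rewrite -subr_eq0; apply/eqP.
transitivity (X 0 * (K * (G 0 0 * G 1 1 - G 0 1 * G 0 1) -
    (G 1 1 * T 0 0 - 2 * G 0 1 * T 0 1 + G 0 0 * T 1 1))); last by rewrite HK mulr0.
rewrite !sum_ord2 !HTh !HdTh !HGah !HdN !sum_ord2 !HdG !Hcurv /N !Hdu !sum_ord2
    ?ddu10 ?dddu10 ?Ga10 ?G10 ?T10 /=.
by field.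
Qed.

Section Conformal.
Context {R : realType} {M : chartedSpace R 2}.
Hypothesis hM : smooth_manifold M.
Implicit Types (a b : chart M) (x : M).
Variables (g : M -> 'M[R]_2) (u : M -> R).
Hypotheses (hg : riemannian g) (su : smooth_fun u).
Local Notation gam := (christoffel g).
Local Notation gc a := (form_comp a g).
Local Notation h := (rescale u g).

Let sg a i j : smooth_inside a (dom a) (gc a i j).
Proof. by case: hg => + _ _; apply. Qed.

Lemma rescale_comp a i j y : form_comp a h i j y = expR (2 * u y) * gc a i j y.
Proof. by rewrite /form_comp form_inZ mxE. Qed.

Let s2u a : smooth_inside a (dom a) (fun y => 2 * u y).
Proof.
apply: smooth_insideM => //; [exact: subdomain_dom|exact: smooth_inside_cst|].
exact: su.
Qed.

Lemma riemannian_rescale : riemannian h.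
Proof.
split.
- move=> a i j; have sda := subdomain_dom hM a.
  apply: (@smooth_insideP _ _ _ hM a (dom a)
    (fun y => expR (2 * u y) * gc a i j y)) => //.
    by move=> y _; rewrite -rescale_comp.
  by apply: smooth_insideM => //; exact: smooth_inside_expR.
- by move=> x; have [_ gT _] := hg; rewrite /rescale linearZ/= gT.
- move=> x v v0; have [_ _ gpos] := hg.
  rewrite /inner /rescale -scalemxAr -scalemxAl mxE mulr_gt0 ?expR_gt0//.
  exact: gpos.
Qed.

(** Both sides are lowered with [g] and multiplied by e^(2u), which turns the left side into the
    symbols of the first kind of the rescaled metric. *)
Lemma christoffel_rescale a i j k x : dom a x ->
  christoffel h a i j k x = gam a i j k x + (i == k)%:R * pder a j u x
    + (j == k)%:R * pder a i u x - gc a i j x * grad_comp g a k u x.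
Proof.
move=> ax; have sda := subdomain_dom hM a.
have du i' : is_pder a i' u x (pder a i' u x) by apply: smooth_inside_is_pder ax; exact: su.
have dg i' p q : is_pder a i' (gc a p q) x (pder a i' (gc a p q) x).
  exact: smooth_inside_is_pder.
have dh i' p q : pder a i' (form_comp a h p q) x =
    expR (2 * u x) * (2 * pder a i' u x * gc a p q x + pder a i' (gc a p q) x).
  rewrite (pder_ext hM i' sda ax (fun y _ => rescale_comp a p q y)).
  apply: is_pderE; apply: is_pder_eq.
    exact (is_pderM hM ax (is_pder_expR hM ax
      (is_pderM hM ax (is_pder_cst a i' 2 x) (du i'))) (dg i' p q)).
  rewrite /=; ring.
move: k; apply: (form_comp_inj hM hg ax) => l.
have e0 : expR (2 * u x) != 0 by rewrite gt_eqF// expR_gt0.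
apply: (mulfI e0); rewrite mulr_sumr.
under eq_bigr do rewrite mulrCA -rescale_comp.
rewrite (christoffel_lower hM riemannian_rescale)// !dh.
have := christoffel_lower hM hg i j l ax; rewrite !sum_ord2 => L.
have -> : pder a i (gc a j l) x = 2 * (gam a i j 0 x * gc a 0 l x + gam a i j 1 x * gc a 1 l x)
   - pder a j (gc a i l) x + pder a l (gc a i j) x.
  by rewrite L; field.
rewrite !(grad_lower hM hg _ su ax).
move: i j {L}; apply: forall_ord2; apply: forall_ord2; rewrite /= ?(form_comp_sym hg a 1 0);
  by field.
Qed.

Section Mobius.
Variables (c : set (M -> 'M[R]_2)) (D : (M -> 'M[R]_2) -> (M -> 'M[R]_2)).
Hypotheses (hD : mobius_structure c D) (cg : c g).
Local Notation N a y :=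
  ((grad_comp g a 0 u y * pder a 0 u y + grad_comp g a 1 u y * pder a 1 u y) / 2).

(** The Moebius law transported to one chart and valid on its whole domain, so that it can be
    differentiated. *)
Lemma mobius_comp_rescale a j k y : dom a y ->
  form_comp a (D h) j k y = form_comp a (D g) j k y - N a y * gc a j k y
    - (pder a j (pder a k u) y - \sum_l gam a j k l y * pder a l u y)
    + pder a j u y * pder a k u y.
Proof.
move=> ay; rewrite -[in RHS](grad_sqnorm_comp hM hg su ay).
rewrite -[X in _ - X + _](hessian_form_comp hM hg j k su ay).
have -> : pder a j u y * pder a k u y =
    form_in a y (differential u y *m (differential u y)^T) j k.
  have ud : trans a (chart_at y) y *m differential u y = dcol a u y.
    rewrite (differential_in hM su ay) mulmxA transK ?mul1mx//.
    exact: manifold_cover.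
  have -> : form_in a y (differential u y *m (differential u y)^T) =
      dcol a u y *m (dcol a u y)^T.
    by rewrite /form_in mulmxA -mulmxA -trmx_mul ud.
  rewrite mxE big_ord1.
  by rewrite !mxE.
rewrite /form_comp (mobius_rescale hD cg su) !(form_inD, form_inN, form_inZ).
by rewrite !mxE.
Qed.

(** d(|grad u|^2 / 2) = Hess u (grad u, -), because the metric is parallel. *)
Lemma pder_half_grad_sqnorm a i x : dom a x -> is_pder a i (fun y => N a y) x
  (\sum_l grad_comp g a l u x * (pder a i (pder a l u) x
     - \sum_p gam a i l p x * pder a p u x)).
Proof.
move=> ax.
have dX k : is_pder a i (grad_comp g a k u) x (pder a i (grad_comp g a k u) x).
  by apply: smooth_inside_is_pder ax; exact: grad_comp_smooth.
have ddu k : is_pder a i (pder a k u) x (pder a i (pder a k u) x).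
  apply: smooth_inside_is_pder ax; apply: smooth_inside_pder => //.
    exact: subdomain_dom.
  exact: su.
apply: is_pder_eq.
  exact (is_pderM hM ax (is_pderD (is_pderM hM ax (dX 0) (ddu 0))
    (is_pderM hM ax (dX 1) (ddu 1))) (is_pder_cst a i 2^-1 x)).
rewrite !sum_ord2 !(pder_grad_lower hM hg i _ su ax) !(grad_lower hM hg _ su ax).
rewrite !(pder_metric hM hg i _ _ ax) (form_comp_sym hg a 1 0) /=.
by field.
Qed.

Lemma pder_mobius_comp_rescale a i j k x : dom a x ->
  pder a i (form_comp a (D h) j k) x = pder a i (form_comp a (D g) j k) x
    - (\sum_l grad_comp g a l u x * (pder a i (pder a l u) x
        - \sum_p gam a i l p x * pder a p u x) * gc a j k x
       + N a x * pder a i (gc a j k) x)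
    - (pder a i (pder a j (pder a k u)) x
       - \sum_l (pder a i (gam a j k l) x * pder a l u x
                 + gam a j k l x * pder a i (pder a l u) x))
    + (pder a i (pder a j u) x * pder a k u x
       + pder a j u x * pder a i (pder a k u) x).
Proof.
move=> ax; have sda := subdomain_dom hM a.
have sdu l : smooth_inside a (dom a) (pder a l u).
  by apply: smooth_inside_pder => //; exact: su.
have sddu l l' : smooth_inside a (dom a) (pder a l (pder a l' u)).
  exact: smooth_inside_pder.
have sD := mobius_tensor hD cg.
rewrite (pder_ext hM i sda ax (fun y ay => mobius_comp_rescale j k ay)).
have di f : smooth_inside a (dom a) f -> is_pder a i f x (pder a i f x).
  by move=> sf; exact: smooth_inside_is_pder ax.
have dN := pder_half_grad_sqnorm i ax.
have dD : is_pder a i (form_comp a (D g) j k) x (pder a i (form_comp a (D g) j k) x).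
  by apply: di; exact: sD.
have dgam l : is_pder a i (gam a j k l) x (pder a i (gam a j k l) x).
  by apply: di; exact: christoffel_smooth.
apply: is_pderE.
rewrite -mulr_suml.
exact (is_pderD (is_pderB (is_pderB dD (is_pderM hM ax dN (di _ (sg a j k))))
  (is_pderB (di _ (sddu j k)) (is_pder_sum (fun l => is_pderM hM ax (dgam l) (di _ (sdu l))))))
  (is_pderM hM ax (di _ (sdu j)) (di _ (sdu k)))).
Qed.

(** The inverse of a 2 x 2 matrix is its adjugate over its determinant; clearing the determinant
    gives the trace condition in the polynomial form used by [cotton_conformal_algebra]. *)
Lemma trace_form_comp a T x : dom a x -> form_in a x (T x) 1 0 = form_in a x (T x) 0 1 ->
  trace_form g T x * (gc a 0 0 x * gc a 1 1 x - gc a 0 1 x * gc a 0 1 x) =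
  gc a 1 1 x * form_comp a T 0 0 x - 2 * gc a 0 1 x * form_comp a T 0 1 x
    + gc a 0 0 x * form_comp a T 1 1 x.
Proof.
move=> ax T10.
pose E := endo_in a x (sharp g T x).
have trE : trace_form g T x = E 0 0 + E 1 1.
  rewrite -(sum_ord2 (fun i => E i i)) -/(\tr E) /E /endo_in mxtrace_mulC mulmxA.
  by rewrite transK ?mul1mx//; exact: manifold_cover.
have TE i j : form_comp a T i j x = E i 0 * gc a 0 j x + E i 1 * gc a 1 j x.
  rewrite -[RHS](sum_ord2 (fun k => E i k * gc a k j x)) /form_comp.
  have -> : T x = sharp g T x *m g x by rewrite /sharp mulmxKV// riemannian_unit.
  by rewrite form_in_mul// mxE.
move: T10; rewrite -![form_in a x (T x) _ _]/(form_comp a T _ _ x) => T10.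
rewrite trE (_ : 2 * _ * _ = gc a 0 1 x * (form_comp a T 0 1 x + form_comp a T 1 0 x)); last first.
  by rewrite T10; ring.
by rewrite !TE (form_comp_sym hg a 1 0); ring.
Qed.

Lemma cotton_comp_anti (G T : M -> 'M[R]_2) a i j k x :
  cotton_comp G T a i j k x = - cotton_comp G T a j i k x.
Proof. by rewrite /cotton_comp; ring. Qed.

(** By antisymmetry only the pair (0, 1) has content, and there the algebraic lemma applies with K =
    scal / 2. *)
Lemma cotton_comp_rescale x i j k :
  cotton_comp h (D h) (chart_at x) i j k x = cotton_comp g (D g) (chart_at x) i j k x.
Proof.
have ax := manifold_cover hM x; set a := chart_at x in ax *.
have sda := subdomain_dom hM a.
have sdu l : smooth_inside a (dom a) (pder a l u).
  by apply: smooth_inside_pder => //; exact: su.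
have D10 : form_in a x (D g x) 1 0 = form_in a x (D g x) 0 1.
  by rewrite -[in LHS](trmxK (form_in a x (D g x))) mxE form_in_tr (mobius_sym hD cg).
have ddu10 := pder_comm hM 1 0 sda (su a) ax.
have dddu10 k' := pder_comm hM 1 0 sda (sdu k') ax.
have curv k' l : pder a 0 (gam a 1 k' l) x - pder a 1 (gam a 0 k' l) x
   + \sum_p (gam a 1 k' p x * gam a 0 p l x - gam a 0 k' p x * gam a 1 p l x) =
   scal g x / 2 * (gc a 1 k' x * (l == 0)%:R - gc a 0 k' x * (l == 1)%:R).
  have := scal_curvature hM hg x k' l; rewrite /curvature_comp -/a => ->.
  by rewrite /form_comp !form_in_at.
have HK := trace_form_comp ax D10; rewrite (mobius_trace hD cg) in HK.
have H := @cotton_conformal_algebra R (fun i j => gc a i j x)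
  (fun i j => form_comp a (D g) i j x) (fun i j => pder a i (pder a j u) x)
  (fun i j k => gam a i j k x) (fun i j k => pder a i (gc a j k) x)
  (fun i j k => pder a i (form_comp a (D g) j k) x)
  (fun i j k => pder a i (pder a j (pder a k u)) x)
  (fun i j k => christoffel h a i j k x)
  (fun i j k => pder a i (form_comp a (D h) j k) x)
  (fun i j k l => pder a i (gam a j k l) x)
  (fun k => grad_comp g a k u x) (fun k => pder a k u x)
  (fun i => \sum_l grad_comp g a l u x * (pder a i (pder a l u) x
        - \sum_p gam a i l p x * pder a p u x))
  (fun i j => form_comp a (D h) i j x) (scal g x / 2)
  (form_comp_sym hg a 1 0 x) D10 ddu10 dddu10
  (fun k => christoffel_sym hM hg 1 0 k ax) (fun i j l => pder_metric hM hg i j l ax)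
  (fun j => grad_lower hM hg j su ax) (fun i => erefl) curv HK
  (fun i j k => christoffel_rescale i j k ax)
  (fun j k => mobius_comp_rescale j k ax).
have {}H k' : cotton_comp h (D h) a 0 1 k' x = cotton_comp g (D g) a 0 1 k' x.
  apply: H => i' j' k''; rewrite (pder_mobius_comp_rescale i' j' k'' ax).
  by rewrite mulr_suml.
have Z G T p : cotton_comp G T a p p k x = 0.
  apply/eqP; have /eqP := cotton_comp_anti G T a p p k x.
  by rewrite -addr_eq0 -mulr2n mulrn_eq0.
move: i j; apply: forall_ord2; apply: forall_ord2.
- exact: etrans (Z _ _ _) (esym (Z _ _ _)).
- exact: H.
- apply: (etrans (cotton_comp_anti _ _ _ _ _ _ _)).
  apply: (etrans (congr1 -%R (H k))); exact: esym (cotton_comp_anti _ _ _ _ _ _ _).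
- exact: etrans (Z _ _ _) (esym (Z _ _ _)).
Qed.

Lemma cotton_york_rescale U V W x : c h -> vector_field U -> vector_field V ->
  cotton_york D h U V W x = cotton_york D g U V W x.
Proof.
move=> ch sU sV.
rewrite (cotton_yorkE hM hg)//; last exact: (mobius_tensor hD).
rewrite (cotton_yorkE hM riemannian_rescale)//; last exact: (mobius_tensor hD).
apply: eq_bigr => i _; apply: eq_bigr => j _; apply: eq_bigr => k _.
by rewrite cotton_comp_rescale.
Qed.

End Mobius.
End Conformal.

(** * The ambient manifold *)

Section AmbientCharts.
Context {R : realType} {n : nat} {M : chartedSpace R n}.
Hypothesis hM : smooth_manifold M.
Variable delta : {posnum R}.
Implicit Types (a b : chart M) (x : M) (t rho : R).
Local Notation amb := (@ambient R n M delta).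

(** Outside 0 < [t] or |[rho]| < [delta] the coordinates fall back to the defaults [t] = 1 and [rho]
    = 0; such values are excluded by the bounds in the lemmas below. *)
Definition ambient_point t rho x : amb :=
  (insubd (mk_positive 0) t, insubd (mk_zero delta) rho, x).

Definition ambient_chart a : chart amb := ((tt, tt), a).

Definition idx_t : 'I_(1 + 1 + n) := lshift n (lshift 1 0).
Definition idx_rho : 'I_(1 + 1 + n) := lshift n (rshift 1 0).
Definition idx_M (k : 'I_n) : 'I_(1 + 1 + n) := rshift (1 + 1) k.

Lemma sum_ambient (F : 'I_(1 + 1 + n) -> R) :
  \sum_i F i = F idx_t + F idx_rho + \sum_k F (idx_M k).
Proof. by rewrite !big_split_ord/= !big_ord1. Qed.

Lemma forall_ambient (P : 'I_(1 + 1 + n) -> Prop) :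
  P idx_t -> P idx_rho -> (forall k, P (idx_M k)) -> forall i, P i.
Proof.
move=> Pt Pr PM i; case: (split_ordP i) => [j ->|k ->]; last exact: PM.
by case: (split_ordP j) => [k ->|k ->]; rewrite ord1.
Qed.

Lemma t_point t rho x : 0 < t -> t_ (ambient_point t rho x) = t.
Proof.
by move=> t0; rewrite /t_/= /set_val/= insubdK//; apply/mem_set.
Qed.

Lemma rho_point t rho x : `|rho| < delta%:num -> rho_ (ambient_point t rho x) = rho.
Proof.
by move=> t0; rewrite /rho_/= /set_val/= insubdK//; apply/mem_set.
Qed.

Lemma ambient_pointE (p : amb) : p = ambient_point (t_ p) (rho_ p) p.2.
Proof.
by case: p => [[t rho] x]; rewrite /ambient_point /t_ /rho_/= !valKd.
Qed.

Lemma Psi_point (u : M -> R) x : Psi delta u x = ambient_point (expR (u x)) 0 x.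
Proof.
by rewrite [LHS]ambient_pointE.
Qed.

Lemma chart_map_point a t rho x : 0 < t -> `|rho| < delta%:num ->
  chart_map (ambient_chart a) (ambient_point t rho x) =
  row_mx (row_mx t%:M rho%:M) (chart_map a x).
Proof.
move=> t0 r0; have := t_point rho x t0; have := rho_point t x r0.
by rewrite /t_ /rho_ /= => -> ->.
Qed.

Lemma param_row a t rho y :
  param (ambient_chart a) (row_mx (row_mx t%:M rho%:M) y) =
  ambient_point t rho (param a y).
Proof.
by rewrite /= !(row_mxKl, row_mxKr) !mxE.
Qed.

Lemma row_t (v : 'rV[R]_1) (w : 'rV[R]_1) (y : 'rV[R]_n) : row_mx (row_mx v w) y 0 idx_t = v 0 0.
Proof. by rewrite !row_mxEl. Qed.

Lemma row_rho (v : 'rV[R]_1) (w : 'rV[R]_1) (y : 'rV[R]_n) :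
  row_mx (row_mx v w) y 0 idx_rho = w 0 0.
Proof. by rewrite row_mxEl row_mxEr. Qed.

Lemma row_M (v : 'rV[R]_(1 + 1)) (y : 'rV[R]_n) k : row_mx v y 0 (idx_M k) = y 0 k.
Proof. by rewrite row_mxEr. Qed.

Lemma t_eq_rho : (idx_t == idx_rho) = false. Proof. by []. Qed.

Lemma t_eq_M k : (idx_t == idx_M k) = false. Proof. exact: eq_lrshift. Qed.

Lemma rho_eq_M k : (idx_rho == idx_M k) = false. Proof. exact: eq_lrshift. Qed.

Lemma M_eq_M k l : (idx_M k == idx_M l) = (k == l). Proof. exact: eq_rshift. Qed.

Definition ambient_indexE := (t_eq_rho, t_eq_M, rho_eq_M, M_eq_M,
  eq_sym idx_rho idx_t, fun k => eq_sym (idx_M k) idx_t, fun k => eq_sym (idx_M k) idx_rho).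

Lemma line_t t rho (y : 'rV[R]_n) r :
  row_mx (row_mx t%:M rho%:M) y + r *: delta_mx 0 idx_t =
  row_mx (row_mx (t + r)%:M rho%:M) y.
Proof.
apply/rowP; apply: forall_ambient => [||k];
  rewrite [LHS]mxE [X in _ + X]mxE [delta_mx _ _ _ _]mxE ?(row_t, row_rho, row_M)
    ?ambient_indexE ?eqxx ?mxE /= ?mulr1 ?mulr0 ?addr0 ?mulr1n //.
Qed.

Lemma line_rho t rho (y : 'rV[R]_n) r :
  row_mx (row_mx t%:M rho%:M) y + r *: delta_mx 0 idx_rho =
  row_mx (row_mx t%:M (rho + r)%:M) y.
Proof.
apply/rowP; apply: forall_ambient => [||k];
  rewrite [LHS]mxE [X in _ + X]mxE [delta_mx _ _ _ _]mxE ?(row_t, row_rho, row_M)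
    ?ambient_indexE ?eqxx ?mxE /= ?mulr1 ?mulr0 ?addr0 ?mulr1n //.
Qed.

Lemma line_M t rho (y : 'rV[R]_n) k r :
  row_mx (row_mx t%:M rho%:M) y + r *: delta_mx 0 (idx_M k) =
  row_mx (row_mx t%:M rho%:M) (y + r *: delta_mx 0 k).
Proof.
apply/rowP; apply: forall_ambient => [||l];
  rewrite [LHS]mxE [X in _ + X]mxE [delta_mx _ _ _ _]mxE ?(row_t, row_rho, row_M)
    ?ambient_indexE ?eqxx ?mxE /= ?eqxx ?mulr1 ?mulr0 ?addr0 ?mulr1n //.
Qed.

Lemma derive_translate_line (F : R -> R) t : 'D_1 (fun r => F (t + r)) 0 = 'D_1 F t.
Proof.
Transparent derive.
rewrite /derive; congr (lim (_ @ 0^')); apply/funext => r /=.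
by rewrite addr0 [t + _]addrC addr0.
Opaque derive.
Qed.

Lemma pder_along (b : chart amb) i (f : amb -> R) p :
  pder b i f p = 'D_1 (fun r : R => f (param b (chart_map b p + r *: delta_mx 0 i))) 0.
Proof.
by rewrite (line_derive (f \o param b)) scale0r addr0.
Qed.

Lemma pder_t a (f : amb -> R) t rho x : 0 < t -> `|rho| < delta%:num -> dom a x ->
  pder (ambient_chart a) idx_t f (ambient_point t rho x) =
  'D_1 (fun s => f (ambient_point s rho x)) t.
Proof.
move=> t0 r0 ax; rewrite pder_along chart_map_point// -[RHS]derive_translate_line.
apply: (congr1 (fun F : R -> R => derive F 0 1)); apply/funext => r.
by rewrite line_t param_row manifold_coordK.
Qed.

Lemma pder_rho a (f : amb -> R) t rho x : 0 < t -> `|rho| < delta%:num -> dom a x ->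
  pder (ambient_chart a) idx_rho f (ambient_point t rho x) =
  'D_1 (fun s => f (ambient_point t s x)) rho.
Proof.
move=> t0 r0 ax; rewrite pder_along chart_map_point// -[RHS]derive_translate_line.
apply: (congr1 (fun F : R -> R => derive F 0 1)); apply/funext => r.
by rewrite line_rho param_row manifold_coordK.
Qed.

Lemma pder_M a k (f : amb -> R) t rho x : 0 < t -> `|rho| < delta%:num -> dom a x ->
  pder (ambient_chart a) (idx_M k) f (ambient_point t rho x) =
  pder a k (fun y => f (ambient_point t rho y)) x.
Proof.
move=> t0 r0 ax; rewrite pder_along chart_map_point//.
have y0 : chart_map a x + (0 : R) *: delta_mx 0 k = chart_map a x.
  by rewrite scale0r addr0.
rewrite /pder -[in RHS]y0.
rewrite -(line_derive ((fun y => f (ambient_point t rho y)) \o param a)).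
apply: (congr1 (fun F : R -> R => derive F 0 1)); apply/funext => r.
by rewrite line_M param_row.
Qed.

(** A derivative sees only parameters close to [t], which are positive: the formula for [f] may fail
    at the default values of [ambient_point]. *)
Lemma pder_t_near a (f : amb -> R) (phi : R -> R) d t rho x :
  0 < t -> `|rho| < delta%:num -> dom a x ->
  (forall s, 0 < s -> f (ambient_point s rho x) = phi s) -> is_derive t 1 phi d ->
  pder (ambient_chart a) idx_t f (ambient_point t rho x) = d.
Proof.
move=> t0 r0 ax fphi [_ <-]; rewrite pder_t//; apply: near_eq_derive.
by apply: filterS (lt_nbhsr t0) => s; exact: fphi.
Qed.

Lemma pder_rho_near a (f : amb -> R) (phi : R -> R) d t rho x :
  0 < t -> `|rho| < delta%:num -> dom a x ->
  (forall s, `|s| < delta%:num -> f (ambient_point t s x) = phi s) ->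
  is_derive rho 1 phi d ->
  pder (ambient_chart a) idx_rho f (ambient_point t rho x) = d.
Proof.
move=> t0 r0 ax fphi [_ <-]; rewrite pder_rho//; apply: near_eq_derive.
have o : open [set s : R | `|s| < delta%:num].
  have -> : [set s : R | `|s| < delta%:num] = ball (0 : R) delta%:num.
    by apply/seteqP; split => s; rewrite -ball_normE /= sub0r normrN.
  exact: ball_open.
by apply: filterS (open_nbhs_nbhs (conj o r0)) => s; exact: fphi.
Qed.

Lemma pder_M_near a k (f : amb -> R) (phi : M -> R) t rho x :
  0 < t -> `|rho| < delta%:num -> dom a x ->
  (forall y, dom a y -> f (ambient_point t rho y) = phi y) ->
  pder (ambient_chart a) (idx_M k) f (ambient_point t rho x) = pder a k phi x.
Proof.
move=> t0 r0 ax fphi; rewrite pder_M//.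
exact: (pder_ext hM k (subdomain_dom hM a) ax).
Qed.

End AmbientCharts.

Lemma is_derive_fext (R : numFieldType) (V W : normedModType R) (f h : V -> W) t v d :
  f =1 h -> is_derive t v h d -> is_derive t v f d.
Proof. by move=> /funext ->. Qed.

Lemma is_derive_scale (R : realFieldType) (c t : R) : is_derive t 1 (fun s => c * s) c.
Proof.
have := is_deriveM (is_derive_cst c t 1) (is_derive_id t (1 : R)).
move=> /is_derive_eq; apply.
by rewrite /GRing.scale/= mulr0 addr0 mulr1.
Qed.

Lemma is_derive_scale_sqr (R : realFieldType) (c t : R) :
  is_derive t 1 (fun s => s ^+ 2 * c) (2 * t * c).
Proof.
have := is_deriveM (is_deriveM (is_derive_id t (1 : R)) (is_derive_id t 1)) (is_derive_cst c t 1).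
move=> /is_derive_eq; apply.
by rewrite /GRing.scale/= mulr0 add0r !mulr1 mulrC mulr_natl mulr2n.
Qed.

Lemma scalar_mx0 (R : nzRingType) n : (0 : R)%:M = 0 :> 'M[R]_n.
Proof. by apply/matrixP => i j; rewrite !mxE mul0rn. Qed.

Lemma scalemx_comp (R : pzRingType) m n (c : R) (A : 'M[R]_(m, n)) i j :
  (c *: A) i j = c * A i j.
Proof. by rewrite mxE. Qed.

Lemma mulmx_is_derive (R : realFieldType) n (P Q : 'M[R]_n) (f : R -> 'M[R]_n) t i j :
  derivable f t 1 ->
  is_derive t 1 (fun s => (P *m f s *m Q) i j) ((P *m 'D_1 f t *m Q) i j).
Proof.
move=> df.
have E X : (P *m X *m Q) i j = \sum_l (\sum_k P i k * X k l) * Q l j.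
  by rewrite mxE; apply: eq_bigr => l _; rewrite mxE.
rewrite E (_ : (fun s => _) = \sum_l (fun s => (\sum_k P i k * f s k l) * Q l j)); last first.
  by apply/funext => s; rewrite E fct_sumE.
apply: is_derive_sum => l.
have dS : is_derive t 1 (fun s => \sum_k P i k * f s k l) (\sum_k P i k * 'D_1 f t k l).
  rewrite (_ : (fun s => _) = \sum_k (fun s => P i k * f s k l)); last first.
    by apply/funext => s; rewrite fct_sumE.
  apply: is_derive_sum => k.
  have dfkl : is_derive t 1 (fun s => f s k l) ('D_1 f t k l).
    split; first exact: ((derivable_mxP _ _ _).1 df k l).
    by rewrite derive_mx// mxE.
  exact: (is_deriveZ (P i k) dfkl).
have := is_deriveZ (Q l j) dS.
rewrite (_ : Q l j \*: _ = (fun s => (\sum_k P i k * f s k l) * Q l j)); last first.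
  by apply/funext => s /=; rewrite mulrC.
by rewrite [_ *: _]mulrC.
Qed.

Section AmbientBlock.
Context {R : nzRingType} {n : nat}.

Definition ambient_block (p q r s : R) (T : 'M[R]_n) : 'M[R]_(1 + 1 + n) :=
  block_mx (block_mx p%:M q%:M r%:M s%:M) 0 0 T.

Variables (p q r s : R) (T : 'M[R]_n).
Local Notation X := (ambient_block p q r s T).

Lemma ambient_blockE :
  (X idx_t idx_t = p) * (X idx_t idx_rho = q) * (X idx_rho idx_t = r) * (X idx_rho idx_rho = s)
  * (forall k, X idx_t (idx_M k) = 0) * (forall k, X idx_rho (idx_M k) = 0)
  * (forall k, X (idx_M k) idx_t = 0) * (forall k, X (idx_M k) idx_rho = 0)
  * (forall k l, X (idx_M k) (idx_M l) = T k l).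
Proof.
by do !split => *;
  rewrite /X ?(block_mxEul, block_mxEur, block_mxEdl, block_mxEdr) ?mxE ?mulr1n.
Qed.

(* Entries get a head symbol of their own, so that rewriting them does not try
   to unify them with entries of other matrices. *)
Definition ambient_entry i j := X i j.

Lemma ambient_entryE :
  (ambient_entry idx_t idx_t = p) * (ambient_entry idx_t idx_rho = q) * (ambient_entry idx_rho idx_t = r)
  * (ambient_entry idx_rho idx_rho = s)
  * (forall k, ambient_entry idx_t (idx_M k) = 0) * (forall k, ambient_entry idx_rho (idx_M k) = 0)
  * (forall k, ambient_entry (idx_M k) idx_t = 0) * (forall k, ambient_entry (idx_M k) idx_rho = 0)
  * (forall k l, ambient_entry (idx_M k) (idx_M l) = T k l).
Proof. exact: ambient_blockE. Qed.

End AmbientBlock.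

(** * The ambient metric and its Christoffel symbols at [rho] = 0 *)

Section AmbientMetric.
Context {R : realType} {n : nat} {M : chartedSpace R n}.
Hypothesis hM : smooth_manifold M.
Variable delta : {posnum R}.
Implicit Types (a b : chart M) (x : M) (t rho : R).
Local Notation amb := (@ambient R n M delta).
Local Notation pt := (@ambient_point R n M delta).
Local Notation ach := (@ambient_chart R n M delta).
Variables (g : M -> 'M[R]_n) (alpha : R -> M -> 'M[R]_n).
Local Notation G := (@ambient_metric R n M delta g alpha).

Lemma trans_ambient a b t rho x : 0 < t -> `|rho| < delta%:num -> dom a x ->
  trans (ach a) (ach b) (pt t rho x) = block_mx 1%:M 0 0 (trans a b x).
Proof.
move=> t0 r0 ax; apply/matrixP => i j; rewrite [LHS]mxE.
have Et s : 0 < s -> chart_map (ach b) (pt s rho x) 0 j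
    = row_mx (row_mx s%:M rho%:M) (chart_map b x) 0 j.
  by move=> s0; rewrite chart_map_point.
have Er s : `|s| < delta%:num -> chart_map (ach b) (pt t s x) 0 j
    = row_mx (row_mx t%:M s%:M) (chart_map b x) 0 j.
  by move=> s0; rewrite chart_map_point.
have EM y : dom a y -> chart_map (ach b) (pt t rho y) 0 j
    = row_mx (row_mx t%:M rho%:M) (chart_map b y) 0 j.
  by move=> s0; rewrite chart_map_point.
have s11 (s : R) : (s%:M : 'M[R]_1) 0 0 = s by rewrite mxE mulr1n.
move: i; apply: forall_ambient => [||k].
- apply: (pder_t_near (f := fun y => chart_map (ach b) y 0 j) hM t0 r0 ax Et); move: j {Et Er EM}.
  apply: forall_ambient => [||l]; rewrite ?(block_mxEul, block_mxEur) ?mxE ?(ambient_indexE).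
  + exact: is_derive_fext (fun s => etrans (row_t _ _ _) (s11 s)) (is_derive_id _ _).
  + exact: is_derive_fext (fun s => row_rho _ _ _) (is_derive_cst _ _ _).
  + exact: is_derive_fext (fun s => row_M _ _ _) (is_derive_cst _ _ _).
- apply: (pder_rho_near (f := fun y => chart_map (ach b) y 0 j) hM t0 r0 ax Er); move: j {Et Er EM}.
  apply: forall_ambient => [||l]; rewrite ?(block_mxEul, block_mxEur) ?mxE ?(ambient_indexE).
  + exact: is_derive_fext (fun s => row_t _ _ _) (is_derive_cst _ _ _).
  + exact: is_derive_fext (fun s => etrans (row_rho _ _ _) (s11 s)) (is_derive_id _ _).
  + exact: is_derive_fext (fun s => row_M _ _ _) (is_derive_cst _ _ _).
- rewrite (pder_M_near (f := fun y => chart_map (ach b) y 0 j) hM k t0 r0 ax EM); move: j {Et Er EM}.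
  apply: forall_ambient => [||l]; rewrite ?(block_mxEdl, block_mxEdr) ?mxE.
  + apply: is_pderE; exact: is_derive_fext (fun s => row_t _ _ _) (is_pder_cst _ _ _ _).
  + apply: is_pderE; exact: is_derive_fext (fun s => row_rho _ _ _) (is_pder_cst _ _ _ _).
  + by congr pder; apply/funext => y; rewrite row_M.
Qed.

(** Expanding d(rho t) = t drho + rho dt turns the first two terms of the metric into 2 rho dt^2 + t
    (dt drho + drho dt). *)
Lemma ambient_metric_point t rho x : 0 < t -> `|rho| < delta%:num ->
  G (pt t rho x) =
  ambient_block (2 * rho) t t 0 (t ^+ 2 *: (alpha rho x *m g x)).
Proof.
rewrite /ambient_block scalar_mx0.
move=> t0 r0; have ax := manifold_cover hM x; set a := chart_at x in ax.
rewrite /ambient_metric t_point// rho_point//.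
have dt : differential (@t_ _ _ _ delta) (pt t rho x) = col_mx (col_mx 1%:M 0) 0.
  apply/matrixP => i j; rewrite ord1 [LHS]mxE; move: i; apply: forall_ambient => [||k].
  - rewrite !col_mxEu mxE; apply: (pder_t_near (phi := id) hM t0 r0 ax _ (is_derive_id _ _)) => s s0.
    by rewrite t_point.
  - rewrite col_mxEu col_mxEd mxE; apply: (pder_rho_near (phi := cst t) hM t0 r0 ax _ (is_derive_cst _ _ _)).
    by move=> s s0; rewrite t_point.
  - rewrite col_mxEd mxE (pder_M_near (phi := cst t) hM k t0 r0 ax).
      exact: is_pderE (is_pder_cst _ _ _ _).
    by move=> y ay; rewrite t_point.
have dr : differential (fun q => @rho_ _ _ _ delta q * @t_ _ _ _ delta q) (pt t rho x)
    = col_mx (col_mx rho%:M t%:M) 0.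
  apply/matrixP => i j; rewrite ord1 [LHS]mxE; move: i; apply: forall_ambient => [||k].
  - rewrite !col_mxEu mxE mulr1n.
    apply: (pder_t_near hM t0 r0 ax _ (is_derive_scale _ _)) => s s0.
    by rewrite t_point// rho_point.
  - rewrite col_mxEu col_mxEd mxE mulr1n.
    apply: (pder_rho_near hM t0 r0 ax _ (is_derive_scale _ _)) => s s0.
    by rewrite t_point// rho_point// mulrC.
  - rewrite col_mxEd mxE (pder_M_near (phi := cst (rho * t)) hM k t0 r0 ax).
      exact: is_pderE (is_pder_cst _ _ _ _).
    by move=> y ay; rewrite t_point// rho_point.
rewrite dt dr !tr_col_mx !mul_col_row !trmx0 !mul0mx !mulmx0 trmx1 !mulmx1 !tr_scalar_mx.
by rewrite !mul1mx !add_block_mx !(addr0, add0r) mulr_natl mulr2n raddfD.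
Qed.

Lemma ambient_metric_chart a t rho x : 0 < t -> `|rho| < delta%:num -> dom a x ->
  form_in (ach a) (pt t rho x) (G (pt t rho x)) =
  ambient_block (2 * rho) t t 0
    (t ^+ 2 *: form_in a x (alpha rho x *m g x)).
Proof.
move=> t0 r0 ax; rewrite ambient_metric_point// /form_in /ambient_block scalar_mx0.
rewrite -[chart_at (pt t rho x)]/(ach (chart_at x)) trans_ambient//.
rewrite tr_block_mx !mulmx_block !(mulmx0, mul0mx, addr0, add0r) !trmx0.
by rewrite !(mulmx0, mul0mx, addr0, add0r) trmx1 mul1mx mulmx1 -scalemxAr -scalemxAl.
Qed.

Hypotheses (hg : riemannian g) (alpha0 : forall x, alpha 0 x = 1%:M).
Hypothesis smooth_alpha : tensor11_family alpha.

Let zero_lt_delta : `|0 : R| < delta%:num.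
Proof. by rewrite normr0. Qed.

(** At [rho] = 0 the dt^2 term disappears and the upper block is antidiagonal, so the inverse is
    explicit. *)
Lemma ambient_metric_inverse a t x : 0 < t -> dom a x ->
  invmx (form_in (ach a) (pt t 0 x) (G (pt t 0 x))) =
  ambient_block 0 t^-1 t^-1 0 (t ^- 2 *: invmx (form_in a x (g x))).
Proof.
move=> t0 ax; have tn0 : t != 0 by rewrite gt_eqF.
rewrite ambient_metric_chart// alpha0 mul1mx mulr0 /ambient_block !scalar_mx0.
set X := block_mx _ _ _ _; set Y := block_mx _ _ _ _.
have XY : X *m Y = 1%:M.
  rewrite /X /Y !mulmx_block !(mulmx0, mul0mx, addr0, add0r).
  rewrite -!scalar_mxM mulfV// -scalemxAl -scalemxAr ?scalar_mx0.
  rewrite ?scalar_mx0 scalerA divff ?expf_neq0// scale1r mulmxV ?form_in_unit ?riemannian_unit//.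
  by rewrite -!scalar_mx_block.
have [uX _] := mulmx1_unit XY.
by rewrite -[RHS](mulKmx uX) XY mulmx1.
Qed.

(** Joint smoothness of the family is used along its first coordinate axis, with the point of the
    chart frozen. *)
Lemma alpha_derivable x : derivable (fun s => alpha s x) 0 1.
Proof.
have ax := manifold_cover hM x; set a := chart_at x in ax.
apply/derivable_mxP => i j.
have sF := smooth_alpha a i j.
set F := (fun y => _) in sF.
pose y0 : 'rV[R]_(1 + n) := row_mx 0%:M (chart_map a x).
have Sy0 : img a (rsubmx y0) by rewrite row_mxKr; exists x.
have := ((sF 1).2 (lshift n 0)).1 y0 Sy0.
have y00 : y0 + (0 : R) *: delta_mx 0 (lshift n 0) = y0 by rewrite scale0r addr0.
rewrite -[in X in X -> _]y00 -line_derivable.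
rewrite (_ : (fun r : R => _) = (fun s => alpha s x i j))//.
apply/funext => s; rewrite /F.
have -> : y0 + s *: delta_mx 0 (lshift n 0) = row_mx s%:M (chart_map a x).
  apply/rowP => k; rewrite [LHS]mxE [X in _ + X]mxE [delta_mx _ _ _ _]mxE eqxx/=.
  case: (split_ordP k) => l ->; rewrite ?(row_mxEl, row_mxEr).
    by rewrite ord1 eqxx !mxE !mulr1n add0r mulr1.
  by rewrite eq_sym eq_lrshift mulr0 addr0.
by rewrite row_mxKl row_mxKr manifold_coordK// [s%:M _ _]mxE mulr1n endo_in_at.
Qed.

Definition alpha_form x : 'M[R]_n := alpha_dot alpha 0 x *m g x.

Lemma alpha_form_is_derive a x i j : dom a x ->
  is_derive (0 : R) 1 (fun s : R => form_in a x (alpha s x *m g x) i j)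
    (form_comp a alpha_form i j x).
Proof.
move=> ax; have := mulmx_is_derive (trans a (chart_at x) x)
  (g x *m (trans a (chart_at x) x)^T) i j (alpha_derivable (x := x)).
rewrite -derive1E -/(alpha_dot alpha 0 x) /form_comp /form_in /alpha_form !mulmxA.
by apply: is_derive_fext => s; rewrite !mulmxA.
Qed.

Opaque idx_t idx_rho idx_M ambient_block form_in.

Lemma pder_t_metric a t x i j : 0 < t -> dom a x ->
  pder (ach a) idx_t (form_comp (ach a) G i j) (pt t 0 x) =
  ambient_entry 0 1 1 0 ((2 * t) *: form_in a x (g x)) i j.
Proof.
rewrite /ambient_entry.
move=> t0 ax.
pose phi s := ambient_block 0 s s 0 (s ^+ 2 *: form_in a x (g x)) i j.
have phiE s : 0 < s -> form_comp (ach a) G i j (pt s 0 x) = phi s.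
  by move=> s0; rewrite /form_comp ambient_metric_chart// alpha0 mul1mx mulr0.
apply: (pder_t_near hM t0 zero_lt_delta ax phiE).
rewrite /phi; move: i j {phi phiE}.
have z (f : R -> R) : f =1 cst 0 -> is_derive t 1 f 0.
  by move=> /funext ->; exact: is_derive_cst.
apply: forall_ambient => [||k]; apply: forall_ambient => [||l]; rewrite ambient_blockE;
  try by apply: z => s; rewrite ambient_blockE.
- by apply: is_derive_fext (is_derive_id _ _) => s; rewrite ambient_blockE.
- by apply: is_derive_fext (is_derive_id _ _) => s; rewrite ambient_blockE.
- rewrite mxE; apply: is_derive_fext (is_derive_scale_sqr _ _) => s.
  by rewrite ambient_blockE mxE.
Qed.

(** The entry 2 is the [rho]-derivative of the dt^2 coefficient, which itself vanishes at [rho] =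
    0. *)
Lemma pder_rho_metric a t x i j : 0 < t -> dom a x ->
  pder (ach a) idx_rho (form_comp (ach a) G i j) (pt t 0 x) =
  ambient_entry 2 0 0 0 (t ^+ 2 *: form_in a x (alpha_form x)) i j.
Proof.
rewrite /ambient_entry.
move=> t0 ax.
pose phi s := ambient_block (2 * s) t t 0
  (t ^+ 2 *: form_in a x (alpha s x *m g x)) i j.
have phiE s : `|s| < delta%:num -> form_comp (ach a) G i j (pt t s x) = phi s.
  by move=> s0; rewrite /form_comp ambient_metric_chart.
apply: (pder_rho_near hM t0 zero_lt_delta ax phiE).
rewrite /phi; move: i j {phi phiE}.
have z (f : R -> R) d : f =1 cst d -> is_derive (0 : R) 1 f 0.
  by move=> /funext ->; exact: is_derive_cst.
apply: forall_ambient => [||k]; apply: forall_ambient => [||l]; rewrite ambient_blockE;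
  try by apply: z => s; rewrite ambient_blockE.
- by apply: is_derive_fext (is_derive_scale _ _) => s; rewrite ambient_blockE.
- rewrite mxE; have := is_deriveZ (t ^+ 2) (alpha_form_is_derive k l ax).
  by apply: is_derive_fext => s; rewrite ambient_blockE mxE.
Qed.

Definition metric_pder a k x : 'M[R]_n := \matrix_(p, q) pder a k (form_comp a g p q) x.

Lemma pder_M_metric a t x k i j : 0 < t -> dom a x ->
  pder (ach a) (idx_M k) (form_comp (ach a) G i j) (pt t 0 x) =
  ambient_entry 0 0 0 0 (t ^+ 2 *: metric_pder a k x) i j.
Proof.
rewrite /ambient_entry.
move=> t0 ax.
pose phi y := ambient_block 0 t t 0 (t ^+ 2 *: form_in a y (g y)) i j.
have phiE y : dom a y -> form_comp (ach a) G i j (pt t 0 y) = phi y.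
  by move=> ay; rewrite /form_comp ambient_metric_chart// alpha0 mul1mx mulr0.
rewrite (pder_M_near hM k t0 zero_lt_delta ax phiE).
apply: is_pderE; rewrite /phi; move: i j {phi phiE}.
have z (f : M -> R) d : f =1 cst d -> is_pder a k f x 0.
  by move=> f0; rewrite (funext f0); exact: is_pder_cst.
apply: forall_ambient => [||p]; apply: forall_ambient => [||q]; rewrite ambient_blockE;
  try by apply: z => s; rewrite ambient_blockE.
rewrite !mxE; have [sg _ _] := hg.
have dg : is_pder a k (form_comp a g p q) x (pder a k (form_comp a g p q) x).
  by apply: smooth_inside_is_pder ax; exact: sg.
rewrite (_ : (fun y => _) = (fun y => t ^+ 2 * form_comp a g p q y)); last first.
  by apply/funext => y; rewrite ambient_blockE mxE.
apply: is_pder_eq; first exact (is_pderM hM ax (is_pder_cst a k (t ^+ 2) x) dg).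
by rewrite mul0r add0r.
Qed.

Definition ambient_row (p q : R) (v : 'I_n -> R) (i : 'I_(1 + 1 + n)) : R :=
  row_mx (row_mx p%:M q%:M) (\row_k v k) 0 i.

Lemma ambient_rowE p q v : (ambient_row p q v idx_t = p) * (ambient_row p q v idx_rho = q)
  * (forall k, ambient_row p q v (idx_M k) = v k).
Proof. by rewrite /ambient_row; split=> [|k]; [split|]; rewrite ?(row_t, row_rho, row_M) mxE ?mulr1n. Qed.

Local Notation chr a t x i j k := (christoffel G (ach a) i j k (pt t 0 x)).

(* Twice the Christoffel symbol of the first kind. *)
Definition ambient_first_kind a t x i j l :=
   pder (ach a) i (form_comp (ach a) G j l) (pt t 0 x)
    + pder (ach a) j (form_comp (ach a) G i l) (pt t 0 x)
    - pder (ach a) l (form_comp (ach a) G i j) (pt t 0 x).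

(** Raising an index with the antidiagonal inverse exchanges the two null directions: the d/dt part
    comes from the first-kind symbol with last index [rho], and conversely. *)
Let chrE a t x i j k : 0 < t -> dom a x -> chr a t x i j k =
  ambient_row (2^-1 * (t^-1 * ambient_first_kind a t x i j idx_rho))
    (2^-1 * (t^-1 * ambient_first_kind a t x i j idx_t))
    (fun m => 2^-1 * (t ^- 2 * \sum_p invmx (form_in a x (g x)) m p
       * ambient_first_kind a t x i j (idx_M p))) k.
Proof.
move=> t0 ax.
transitivity (2^-1 * \sum_l ambient_block 0 t^-1 t^-1 0
    (t ^- 2 *: invmx (form_in a x (g x))) k l * ambient_first_kind a t x i j l).
  by rewrite -ambient_metric_inverse.
move: (ambient_first_kind a t x i j) => L; rewrite sum_ambient.
move: k; apply: forall_ambient => [||m]; rewrite !ambient_rowE !ambient_blockE.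
- rewrite mul0r add0r big1 ?addr0// => p _; by rewrite ambient_blockE mul0r.
- rewrite mul0r addr0 big1 ?addr0// => p _; by rewrite ambient_blockE mul0r.
- rewrite !mul0r !add0r; congr (_ * _); rewrite mulr_sumr; apply: eq_bigr => p _.
  by rewrite ambient_blockE mxE mulrA.
Qed.

Let row_eq p q v p' q' v' k : p = p' -> q = q' -> v =1 v' ->
  ambient_row p q v k = ambient_row p' q' v' k.
Proof. by move=> -> -> /funext ->. Qed.

Let inverse_sum a x j m : dom a x ->
  \sum_p invmx (form_in a x (g x)) m p * form_comp a g j p x = (j == m)%:R.
Proof.
move=> ax; have ug : form_in a x (g x) \in unitmx.
  by rewrite form_in_unit// riemannian_unit.
have /matrixP/(_ m j) := mulVmx ug; rewrite !mxE eq_sym => <-.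
by apply: eq_bigr => p _; rewrite form_comp_sym.
Qed.

Let sum0 m a x (F : 'I_n -> R) : (forall p, F p = 0) ->
  \sum_p invmx (form_in a x (g x)) m p * F p = 0.
Proof. by move=> F0; rewrite big1// => p _; rewrite F0 mulr0. Qed.

Opaque ambient_entry.

Lemma christoffel_t_t a t x k : 0 < t -> dom a x ->
  chr a t x idx_t idx_t k = ambient_row 0 0 (fun=> 0) k.
Proof.
move=> t0 ax; rewrite chrE//; apply: row_eq => [||m].
- rewrite /ambient_first_kind !(pder_t_metric, pder_rho_metric)// !ambient_entryE; ring.
- rewrite /ambient_first_kind !(pder_t_metric, pder_rho_metric)// !ambient_entryE; ring.
- rewrite sum0 ?mulr0// => p.
  rewrite /ambient_first_kind !(pder_t_metric, pder_M_metric)// !ambient_entryE; ring.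
Qed.

Lemma christoffel_t_rho a t x k : 0 < t -> dom a x ->
  chr a t x idx_t idx_rho k = ambient_row 0 t^-1 (fun=> 0) k.
Proof.
move=> t0 ax; rewrite chrE//; apply: row_eq => [||m].
- rewrite /ambient_first_kind !(pder_t_metric, pder_rho_metric)// !ambient_entryE; ring.
- rewrite /ambient_first_kind !(pder_t_metric, pder_rho_metric)// !ambient_entryE.
  by field; rewrite gt_eqF.
- rewrite sum0 ?mulr0// => p.
  rewrite /ambient_first_kind !(pder_t_metric, pder_rho_metric, pder_M_metric)// !ambient_entryE.
  ring.
Qed.

Ltac first_kind_entries := rewrite /ambient_first_kind; congr (_ + _ - _);
  [ first [rewrite pder_t_metric// | rewrite pder_rho_metric// | rewrite pder_M_metric//]
  | first [rewrite pder_t_metric// | rewrite pder_rho_metric// | rewrite pder_M_metric//]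
  | first [rewrite pder_t_metric// | rewrite pder_rho_metric// | rewrite pder_M_metric//]];
  rewrite ambient_entryE ?scalemx_comp ?[metric_pder _ _ _ _ _]mxE.

(** The metric is homogeneous of degree 2 in [t]. With the two preceding lemmas this expresses that
    t d/dt has the identity as covariant derivative on [rho] = 0. *)
Lemma christoffel_t_M a t x j k : 0 < t -> dom a x ->
  chr a t x idx_t (idx_M j) k = ambient_row 0 0 (fun m => t^-1 * (j == m)%:R) k.
Proof.
move=> t0 ax; rewrite chrE//; apply: row_eq => [||m].
- have -> : ambient_first_kind a t x idx_t (idx_M j) idx_rho = 0 + 0 - 0 by first_kind_entries.
  ring.
- have -> : ambient_first_kind a t x idx_t (idx_M j) idx_t = 0 + 0 - 0 by first_kind_entries.
  ring.
- rewrite -(inverse_sum _ _ ax) !mulr_sumr; apply: eq_bigr => p _.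
  have -> : ambient_first_kind a t x idx_t (idx_M j) (idx_M p) = 2 * t * form_comp a g j p x + 0 - 0.
    by first_kind_entries.
  by field; rewrite gt_eqF.
Qed.

Lemma christoffel_M_t a t x j k : 0 < t -> dom a x ->
  chr a t x (idx_M j) idx_t k = ambient_row 0 0 (fun m => t^-1 * (j == m)%:R) k.
Proof.
move=> t0 ax; rewrite chrE//; apply: row_eq => [||m].
- have -> : ambient_first_kind a t x (idx_M j) idx_t idx_rho = 0 + 0 - 0 by first_kind_entries.
  ring.
- have -> : ambient_first_kind a t x (idx_M j) idx_t idx_t = 0 + 0 - 0 by first_kind_entries.
  ring.
- rewrite -(inverse_sum _ _ ax) !mulr_sumr; apply: eq_bigr => p _.
  have -> : ambient_first_kind a t x (idx_M j) idx_t (idx_M p) = 0 + 2 * t * form_comp a g j p x - 0.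
    by first_kind_entries.
  by field; rewrite gt_eqF.
Qed.

(** Half of the derivative of [alpha] at 0, in components, with no dependence on [t]: the source of
    the Weingarten endomorphism. *)
Lemma christoffel_M_rho a t x j k : 0 < t -> dom a x ->
  chr a t x (idx_M j) idx_rho k = ambient_row 0 0
    (fun m => 2^-1 * \sum_p invmx (form_in a x (g x)) m p * form_comp a alpha_form j p x)
    k.
Proof.
move=> t0 ax; rewrite chrE//; apply: row_eq => [||m].
- have -> : ambient_first_kind a t x (idx_M j) idx_rho idx_rho = 0 + 0 - 0 by first_kind_entries.
  ring.
- have -> : ambient_first_kind a t x (idx_M j) idx_rho idx_t = 0 + 0 - 0 by first_kind_entries.
  ring.
- rewrite !mulr_sumr; apply: eq_bigr => p _.
  have -> : ambient_first_kind a t x (idx_M j) idx_rho (idx_M p) =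
    0 + t ^+ 2 * form_comp a alpha_form j p x - 0 by first_kind_entries.
  by field; rewrite gt_eqF.
Qed.

(** The slices of constant [t] in [rho] = 0 carry the Levi-Civita connection of [g]; their second
    fundamental form is -(t/2) B along d/dt and -g along d/drho. *)
Lemma christoffel_M_M a t x i j k : 0 < t -> dom a x ->
  chr a t x (idx_M i) (idx_M j) k = ambient_row (- (2^-1 * (t * form_comp a alpha_form i j x)))
    (- form_comp a g i j x) (fun m => christoffel g a i j m x) k.
Proof.
move=> t0 ax; rewrite chrE//; apply: row_eq => [||m].
- have -> : ambient_first_kind a t x (idx_M i) (idx_M j) idx_rho =
    0 + 0 - t ^+ 2 * form_comp a alpha_form i j x by first_kind_entries.
  by field; rewrite gt_eqF.
- have -> : ambient_first_kind a t x (idx_M i) (idx_M j) idx_t =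
    0 + 0 - 2 * t * form_comp a g i j x by first_kind_entries.
  by field; rewrite gt_eqF.
- rewrite /christoffel; congr (_ * _); rewrite mulr_sumr; apply: eq_bigr => p _.
  have -> : ambient_first_kind a t x (idx_M i) (idx_M j) (idx_M p) =
      t ^+ 2 * pder a i (form_comp a g j p) x + t ^+ 2 * pder a j (form_comp a g i p) x
      - t ^+ 2 * pder a p (form_comp a g i j) x by first_kind_entries.
  rewrite -![pder a _ (fun y => form_in a y (g y) _ _) x]/(pder a _ (form_comp a g _ _) x).
  by field; rewrite gt_eqF.
Qed.

End AmbientMetric.

(** * The ambient curvature *)

Opaque ambient_row.

Lemma is_pder_fext (R : realType) n (M : chartedSpace R n) (a : chart M) i (f h : M -> R) x d :
  f =1 h -> is_pder a i h x d -> is_pder a i f x d.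
Proof. by move=> /funext ->. Qed.

Section AmbientCurvature.
Context {R : realType} {n : nat} {M : chartedSpace R n}.
Hypothesis hM : smooth_manifold M.
Variable delta : {posnum R}.
Implicit Types (a b : chart M) (x : M) (t rho : R).
Local Notation amb := (@ambient R n M delta).
Local Notation pt := (@ambient_point R n M delta).
Local Notation ach := (@ambient_chart R n M delta).
Variables (g : M -> 'M[R]_n) (alpha : R -> M -> 'M[R]_n).
Local Notation G := (@ambient_metric R n M delta g alpha).
Hypotheses (hg : riemannian g) (alpha0 : forall x, alpha 0 x = 1%:M).
Hypothesis smooth_alpha : tensor11_family alpha.
Local Notation beta a := (form_comp a (alpha_form g alpha)).
Hypothesis beta_smooth : forall a i j, smooth_inside a (dom a) (beta a i j).
Hypothesis beta_sym : forall a i j x, beta a i j x = beta a j i x.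
Local Notation row := (@ambient_row R n).
Local Notation chr a := (christoffel G (ach a)).

Let zero_lt_delta : `|0 : R| < delta%:num.
Proof. by rewrite normr0. Qed.

Let tt_ := christoffel_t_t hM delta hg alpha0 smooth_alpha.
Let tr_ := christoffel_t_rho hM delta hg alpha0 smooth_alpha.
Let tM_ := christoffel_t_M hM delta hg alpha0 smooth_alpha.
Let Mt_ := christoffel_M_t hM delta hg alpha0 smooth_alpha.
Let Mr_ := christoffel_M_rho hM delta hg alpha0 smooth_alpha.
Let MM_ := christoffel_M_M hM delta hg alpha0 smooth_alpha.

Lemma pder_t_christoffel_M_M a t x j k l : 0 < t -> dom a x ->
  pder (ach a) idx_t (chr a (idx_M j) (idx_M k) l) (pt t 0 x) =
  row (- (2^-1 * beta a j k x)) 0 (fun=> 0) l.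
Proof.
move=> t0 ax; apply: (pder_t_near hM t0 zero_lt_delta ax (fun s s0 => MM_ j k l s0 ax)).
move: l; apply: forall_ambient => [||m]; rewrite ambient_rowE.
- apply: is_derive_fext (is_derive_scale (- (2^-1 * beta a j k x)) t) => s.
  by rewrite ambient_rowE; ring.
- by apply: is_derive_fext (is_derive_cst _ _ _) => s; rewrite ambient_rowE.
- by apply: is_derive_fext (is_derive_cst _ _ _) => s; rewrite ambient_rowE.
Qed.

Lemma pder_t_christoffel_M_t a t x j l : 0 < t -> dom a x ->
  pder (ach a) idx_t (chr a (idx_M j) idx_t l) (pt t 0 x) =
  row 0 0 (fun m => - t ^- 2 * (j == m)%:R) l.
Proof.
move=> t0 ax; apply: (pder_t_near hM t0 zero_lt_delta ax (fun s s0 => Mt_ j l s0 ax)).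
move: l; apply: forall_ambient => [||m]; rewrite ambient_rowE.
- by apply: is_derive_fext (is_derive_cst _ _ _) => s; rewrite ambient_rowE.
- by apply: is_derive_fext (is_derive_cst _ _ _) => s; rewrite ambient_rowE.
- have dV : is_derive t 1 (fun s : R => s^-1) (- t ^- 2).
    have tn0 : t != 0 by rewrite gt_eqF.
    have dI := @derivableV _ _ (id : R -> R) t 1 tn0 (@derivable_id _ _ t 1).
    have DI := @deriveV _ _ (id : R -> R) t 1 tn0 (@derivable_id _ _ t 1).
    split; first exact: dI.
    by apply: (etrans DI); rewrite derive_id [_ *: _]mulr1.
  have := is_deriveZ ((j == m)%:R : R) dV.
  by rewrite [_ *: _]mulrC; apply: is_derive_fext => s; rewrite ambient_rowE mulrC.
Qed.

Lemma pder_M_christoffel_M_M a t x i j k l : 0 < t -> dom a x ->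
  pder (ach a) (idx_M i) (chr a (idx_M j) (idx_M k) l) (pt t 0 x) =
  row (- (2^-1 * (t * pder a i (beta a j k) x))) (- pder a i (form_comp a g j k) x)
    (fun m => pder a i (christoffel g a j k m) x) l.
Proof.
move=> t0 ax; rewrite (pder_M_near hM i t0 zero_lt_delta ax (fun y ay => MM_ j k l t0 ay)).
have sda := subdomain_dom hM a; have [sg _ _] := hg.
apply: is_pderE; move: l; apply: forall_ambient => [||m]; rewrite ambient_rowE.
- have db : is_pder a i (beta a j k) x (pder a i (beta a j k) x).
    exact: smooth_inside_is_pder.
  apply: (is_pder_fext (fun y => (ambient_rowE _ _ _).1.1)).
  apply: is_pder_eq; first exact (is_pderN (is_pderM hM ax (is_pder_cst a i 2^-1 x)
    (is_pderM hM ax (is_pder_cst a i t x) db))).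
  by rewrite !mul0r !add0r.
- have dg : is_pder a i (form_comp a g j k) x (pder a i (form_comp a g j k) x).
    by apply: smooth_inside_is_pder ax; exact: sg.
  apply: (is_pder_fext (fun y => (ambient_rowE _ _ _).1.2)).
  exact (is_pderN dg).
- have dG : is_pder a i (christoffel g a j k m) x (pder a i (christoffel g a j k m) x).
    by apply: smooth_inside_is_pder ax; exact: christoffel_smooth.
  by apply: (is_pder_fext (fun y => (ambient_rowE _ _ _).2 m)).
Qed.

Lemma pder_M_christoffel_M_t a t x i j l : 0 < t -> dom a x ->
  pder (ach a) (idx_M i) (chr a (idx_M j) idx_t l) (pt t 0 x) = 0.
Proof.
move=> t0 ax; rewrite (pder_M_near hM i t0 zero_lt_delta ax (fun y ay => Mt_ j l t0 ay)).
exact: is_pderE (is_pder_cst _ _ _ _).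
Qed.

Lemma pder_M_christoffel_t_M a t x i j l : 0 < t -> dom a x ->
  pder (ach a) (idx_M i) (chr a idx_t (idx_M j) l) (pt t 0 x) = 0.
Proof.
move=> t0 ax; rewrite (pder_M_near hM i t0 zero_lt_delta ax (fun y ay => tM_ j l t0 ay)).
exact: is_pderE (is_pder_cst _ _ _ _).
Qed.

Lemma pder_M_christoffel_t_t a t x i l : 0 < t -> dom a x ->
  pder (ach a) (idx_M i) (chr a idx_t idx_t l) (pt t 0 x) = 0.
Proof.
move=> t0 ax; rewrite (pder_M_near hM i t0 zero_lt_delta ax (fun y ay => tt_ l t0 ay)).
exact: is_pderE (is_pder_cst _ _ _ _).
Qed.

Lemma curvature_comp_contract a t x i j k l d1 d2 (r1 r2 : 'I_(1 + 1 + n) -> R) :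
  pder (ach a) i (chr a j k l) (pt t 0 x) = d1 ->
  pder (ach a) j (chr a i k l) (pt t 0 x) = d2 ->
  (forall q, chr a j k q (pt t 0 x) = r1 q) ->
  (forall q, chr a i k q (pt t 0 x) = r2 q) ->
  curvature_comp G (ach a) i j k l (pt t 0 x) = d1 - d2
   + (r1 idx_t * chr a i idx_t l (pt t 0 x) + r1 idx_rho * chr a i idx_rho l (pt t 0 x)
      + \sum_q r1 (idx_M q) * chr a i (idx_M q) l (pt t 0 x)
    - (r2 idx_t * chr a j idx_t l (pt t 0 x) + r2 idx_rho * chr a j idx_rho l (pt t 0 x)
      + \sum_q r2 (idx_M q) * chr a j (idx_M q) l (pt t 0 x))).
Proof.
move=> <- <- H1 H2; rewrite /curvature_comp; congr (_ + _).
rewrite sumrB; congr (_ - _); rewrite sum_ambient; rewrite ?H1 ?H2;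
  by congr (_ + _); apply: eq_bigr => q _; rewrite ?H1 ?H2.
Qed.

Let sum_delta (c : R) j (F : 'I_n -> R) : \sum_q (c * (j == q)%:R) * F q = c * F j.
Proof.
rewrite (bigD1 j)//= eqxx mulr1 big1 ?addr0// => q qj.
by rewrite eq_sym (negbTE qj) mulr0 mul0r.
Qed.

Let sum_deltar (c : R) m (F : 'I_n -> R) : \sum_q F q * (c * (q == m)%:R) = c * F m.
Proof.
rewrite (bigD1 m)//= eqxx mulr1 mulrC big1 ?addr0// => q qj.
by rewrite (negbTE qj) !mulr0.
Qed.

(* [t d/dt] has covariant derivative the identity, so that the curvature
   vanishes in its direction; the next three lemmas are what is needed of it. *)
Lemma curvature_t_M_t a t x j l : 0 < t -> dom a x ->
  curvature_comp G (ach a) idx_t (idx_M j) idx_t l (pt t 0 x) = 0.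
Proof.
move=> t0 ax.
rewrite (curvature_comp_contract (pder_t_christoffel_M_t j l t0 ax)
  (pder_M_christoffel_t_t j l t0 ax) (fun q => Mt_ j q t0 ax) (fun q => tt_ q t0 ax)).
rewrite !ambient_rowE !mul0r !add0r subr0.
under eq_bigr => q _ do rewrite ambient_rowE tM_//.
under [X in _ - X]eq_bigr => q _ do rewrite ambient_rowE mul0r.
rewrite big1_eq subr0 sum_delta; move: l; apply: forall_ambient => [||m]; rewrite !ambient_rowE.
- by rewrite mulr0 addr0.
- by rewrite mulr0 addr0.
- by field; rewrite gt_eqF.
Qed.

Lemma curvature_M_M_t a t x i j l : 0 < t -> dom a x ->
  curvature_comp G (ach a) (idx_M i) (idx_M j) idx_t l (pt t 0 x) = 0.
Proof.
move=> t0 ax.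
rewrite (curvature_comp_contract (pder_M_christoffel_M_t i j l t0 ax)
  (pder_M_christoffel_M_t j i l t0 ax) (fun q => Mt_ j q t0 ax) (fun q => Mt_ i q t0 ax)).
rewrite subr0 !ambient_rowE !mul0r !add0r.
under eq_bigr => q _ do rewrite ambient_rowE.
under [X in _ - X]eq_bigr => q _ do rewrite ambient_rowE.
rewrite !sum_delta !MM_//; apply/eqP; rewrite subr_eq0; apply/eqP; congr (_ * _).
move: l; apply: forall_ambient => [||m]; rewrite !ambient_rowE.
- by rewrite beta_sym.
- by rewrite (form_comp_sym hg).
- exact: christoffel_sym.
Qed.

Lemma curvature_t_M_M a t x j k l : 0 < t -> dom a x ->
  curvature_comp G (ach a) idx_t (idx_M j) (idx_M k) l (pt t 0 x) = 0.
Proof.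
move=> t0 ax.
rewrite (curvature_comp_contract (pder_t_christoffel_M_M j k l t0 ax)
  (pder_M_christoffel_t_M j k l t0 ax) (fun q => MM_ j k q t0 ax) (fun q => tM_ k q t0 ax)).
rewrite subr0 !ambient_rowE !mul0r !add0r tt_// tr_//.
under eq_bigr => q _ do rewrite ambient_rowE tM_//.
under [X in _ - X]eq_bigr => q _ do rewrite ambient_rowE.
rewrite sum_delta MM_//; move: l; apply: forall_ambient => [||m]; rewrite !ambient_rowE.
- under eq_bigr => q _ do rewrite ambient_rowE mulr0.
  by rewrite big1_eq; field; rewrite gt_eqF.
- under eq_bigr => q _ do rewrite ambient_rowE mulr0.
  by rewrite big1_eq; ring.
- under eq_bigr => q _ do rewrite ambient_rowE.
  by rewrite sum_deltar; ring.
Qed.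

(* Half of the derivative of [alpha] at 0, i.e. the shape operator of [Psi 0]. *)
Definition shape_comp a j m x : R :=
  2^-1 * \sum_p invmx (form_in a x (g x)) m p * beta a j p x.

(** The d/dt part is the Codazzi expression of B, a Cotton tensor up to a factor; the d/drho part is
    that of [g] and vanishes; the part along M is Gauss's equation, with one null direction
    contributing B / 2 and the other the shape operator. *)
Lemma curvature_M_M_M a t x i j k l : 0 < t -> dom a x ->
  curvature_comp G (ach a) (idx_M i) (idx_M j) (idx_M k) l (pt t 0 x) =
  row (- (2^-1 * t * cotton_comp g (alpha_form g alpha) a i j k x)) 0
   (fun m => curvature_comp g a i j k m x
     - (2^-1 * beta a j k x * (i == m)%:R + form_comp a g j k x * shape_comp a i m x)
     + (2^-1 * beta a i k x * (j == m)%:R + form_comp a g i k x * shape_comp a j m x)) l.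
Proof.
move=> t0 ax.
rewrite (curvature_comp_contract (pder_M_christoffel_M_M i j k l t0 ax)
  (pder_M_christoffel_M_M j i k l t0 ax) (fun q => MM_ j k q t0 ax) (fun q => MM_ i k q t0 ax)).
rewrite !ambient_rowE !Mt_// !Mr_//.
under eq_bigr => q _ do rewrite ambient_rowE MM_//.
under [X in _ - (_ + X)]eq_bigr => q _ do rewrite ambient_rowE MM_//.
move: l; apply: forall_ambient => [||m]; rewrite !ambient_rowE.
- under eq_bigr => q _ do rewrite ambient_rowE.
  under [X in _ - (_ + X)]eq_bigr => q _ do rewrite ambient_rowE.
  have E i' j' : \sum_q christoffel g a j' k q x * - (2^-1 * (t * beta a i' q x)) =
      - (2^-1 * t * \sum_q christoffel g a j' k q x * beta a i' q x).
    by rewrite mulr_sumr -sumrN; apply: eq_bigr => q _; ring.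
  by rewrite !E /cotton_comp; ring.
- under eq_bigr => q _ do rewrite ambient_rowE.
  under [X in _ - (_ + X)]eq_bigr => q _ do rewrite ambient_rowE.
  have E i' j' : \sum_q christoffel g a j' k q x * - form_comp a g i' q x =
      - \sum_q christoffel g a j' k q x * form_comp a g q i' x.
    by rewrite -sumrN; apply: eq_bigr => q _; rewrite (form_comp_sym hg) mulrN.
  (* The d/drho part vanishes because [g] is parallel and its Christoffel symbols are symmetric. *)
  rewrite !E (metric_compatible hM hg i j k ax) (metric_compatible hM hg j i k ax).
  have S q : christoffel g a j i q x = christoffel g a i j q x by exact: christoffel_sym.
  under [\sum_k christoffel g a j i k x * _]eq_bigr => q _ do rewrite S.
  ring.
- under eq_bigr => q _ do rewrite ambient_rowE.
  under [X in _ - (_ + X)]eq_bigr => q _ do rewrite ambient_rowE.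
  have alg (d1 d2 s1 s2 b1 b2 g1 g2 S1 S2 e1 e2 : R) :
      d1 - d2 + (- (2^-1 * (t * b1)) * (t^-1 * e1) + - g1 * S1 + s1
                 - (- (2^-1 * (t * b2)) * (t^-1 * e2) + - g2 * S2 + s2))
      = d1 - d2 + (s1 - s2) - (2^-1 * b1 * e1 + g1 * S1) + (2^-1 * b2 * e2 + g2 * S2).
    by field; rewrite gt_eqF.
  by rewrite /curvature_comp sumrB; exact: alg.
Qed.

End AmbientCurvature.

(** * The immersions *)
Transparent ambient_block.

Section Immersion.
Context {R : realType} {n : nat} {M : chartedSpace R n}.
Hypothesis hM : smooth_manifold M.
Variable delta : {posnum R}.
Implicit Types (a b : chart M) (x : M) (t rho : R) (u : M -> R).
Local Notation amb := (@ambient R n M delta).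
Local Notation pt := (@ambient_point R n M delta).
Local Notation ach := (@ambient_chart R n M delta).

Let zero_lt_delta : `|0 : R| < delta%:num.
Proof. by rewrite normr0. Qed.

Lemma tangent_Psi u x k : smooth_fun u ->
  (tangent_map (Psi delta u) x k idx_t = expR (u x) * pder (chart_at x) k u x)
  * (tangent_map (Psi delta u) x k idx_rho = 0)
  * (forall l, tangent_map (Psi delta u) x k (idx_M l) = (k == l)%:R).
Proof.
move=> su; have ax := manifold_cover hM x; set a := chart_at x in ax *.
have E j y : chart_map (ach a) (Psi delta u y) 0 j =
    row_mx (row_mx (expR (u y))%:M 0%:M) (chart_map a y) 0 j.
  by rewrite Psi_point chart_map_point// expR_gt0.
have TE j : tangent_map (Psi delta u) x k j =
    pder a k (fun y => row_mx (row_mx (expR (u y))%:M 0%:M) (chart_map a y) 0 j) x.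
  by rewrite mxE; congr pder; apply/funext => y; rewrite -E.
do !split; rewrite ?TE.
- apply: is_pderE; apply: (is_pder_fext (h := fun y => expR (u y))) => [y|].
    by rewrite row_t mxE mulr1n.
  apply: is_pder_expR => //; apply: smooth_inside_is_pder ax; exact: su.
- apply: is_pderE; apply: (is_pder_fext (h := fun y => 0)) => [y|].
    by rewrite row_rho mxE mul0rn.
  exact: is_pder_cst.
- move=> l; rewrite TE.
  have <- : trans a a x k l = (k == l)%:R by rewrite trans_id// mxE.
  by rewrite mxE; congr pder; apply/funext => y; rewrite row_M.
Qed.

Lemma mul_tangent_Psi u x (v : 'rV[R]_n) : smooth_fun u ->
  ((v *m tangent_map (Psi delta u) x) 0 idx_rho = 0)
  * (forall l, (v *m tangent_map (Psi delta u) x) 0 (idx_M l) = v 0 l).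
Proof.
move=> su; split=> [|l]; rewrite mxE.
  by rewrite big1// => k _; rewrite (tangent_Psi _ _ su) mulr0.
rewrite (bigD1 l)//= (tangent_Psi _ _ su) eqxx mulr1 big1 ?addr0// => k kl.
by rewrite (tangent_Psi _ _ su) (negbTE kl) mulr0.
Qed.

Variables (g : M -> 'M[R]_n) (alpha : R -> M -> 'M[R]_n).
Local Notation G := (@ambient_metric R n M delta g alpha).
Hypotheses (hg : riemannian g) (alpha0 : forall x, alpha 0 x = 1%:M).
Hypothesis smooth_alpha : tensor11_family alpha.
Local Notation beta a := (form_comp a (alpha_form g alpha)).

Let chart_at_point t rho x : chart_at (pt t rho x) = ach (chart_at x).
Proof. by []. Qed.

Section Curvature.
Hypothesis beta_smooth : forall a i j, smooth_inside a (dom a) (beta a i j).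
Hypothesis beta_sym : forall a i j x, beta a i j x = beta a j i x.

(** The [rho] components vanish by hypothesis, and a d/dt in any of the three arguments gives zero
    curvature; only the components along M are left. *)
Lemma riemann_ambient t x (v w z : 'rV[R]_(1 + 1 + n)) l : 0 < t ->
  v 0 idx_rho = 0 -> w 0 idx_rho = 0 -> z 0 idx_rho = 0 ->
  riemann G (pt t 0 x) v w z 0 l = \sum_i \sum_j \sum_k
    v 0 (idx_M i) * w 0 (idx_M j) * z 0 (idx_M k) *
    curvature_comp G (ach (chart_at x)) (idx_M i) (idx_M j) (idx_M k) l (pt t 0 x).
Proof.
move=> t0 v0 w0 z0; have ax := manifold_cover hM x.
rewrite riemannE chart_at_point; set a := chart_at x in ax *.
have Z i k' : curvature_comp G (ach a) i i k' l (pt t 0 x) = 0.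
  have /eqP := curvature_comp_anti G (ach a) i i k' l (pt t 0 x).
  by rewrite -addr_eq0 -mulr2n mulrn_eq0 => /eqP.
have C1 j := curvature_t_M_t hM delta hg alpha0 smooth_alpha j l t0 ax.
have C2 j k := curvature_t_M_M hM delta hg alpha0 smooth_alpha j k l t0 ax.
have C3 i j := curvature_M_M_t hM delta hg alpha0 smooth_alpha beta_sym i j l t0 ax.
pose F i j k := v 0 i * w 0 j * z 0 k * curvature_comp G (ach a) i j k l (pt t 0 x).
have Fti j k : F idx_t j k = 0.
  rewrite /F; move: j; apply: forall_ambient => [||j].
  - by rewrite Z mulr0.
  - by rewrite w0 mulr0 !mul0r.
  - move: k; apply: forall_ambient => [||k]; last by rewrite C2 mulr0.
      by rewrite C1 mulr0.
    by rewrite z0 mulr0 mul0r.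
have FMt i k : F (idx_M i) idx_t k = 0.
  rewrite /F curvature_comp_anti; move: k; apply: forall_ambient => [||k].
  - by rewrite C1 oppr0 mulr0.
  - by rewrite z0 mulr0 mul0r.
  - by rewrite C2 oppr0 mulr0.
rewrite -[LHS]/(\sum_i \sum_j \sum_k F i j k) sum_ambient.
rewrite big1 => [|j _]; last by rewrite big1// => k _; exact: Fti.
rewrite [X in _ + X + _]big1 => [|j _]; last first.
  by rewrite big1// => k _; rewrite /F v0 !mul0r.
rewrite !add0r; apply: eq_bigr => i _; rewrite sum_ambient.
rewrite big1 => [|k _]; last exact: FMt.
rewrite [X in _ + X + _]big1 => [|k _]; last by rewrite /F w0 mulr0 !mul0r.
rewrite !add0r; apply: eq_bigr => j _; rewrite sum_ambient.
by rewrite {1}/F C3 mulr0 {1}/F z0 mulr0 mul0r !add0r.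
Qed.

End Curvature.

Lemma eta0 x : Defs.eta g (fun=> 0) x = row_mx (row_mx 0 (-1)%:M) 0.
Proof.
have d0 : gradient g (fun=> 0) x = 0.
  rewrite /gradient (_ : differential _ _ = 0) ?trmx0 ?mul0mx//.
  apply/colP => i; rewrite !mxE; exact: is_pderE (is_pder_cst _ _ _ _).
rewrite /Defs.eta /grad_sqnorm d0 /inner !mul0mx mxE mul0r mulr0 scaler0 mulr0 oppr0 expR0.
by rewrite scalar_mx0.
Qed.

Lemma smooth_fun0 : smooth_fun (fun=> 0 : R) (M := M).
Proof. by move=> a; exact: (@smooth_inside_cst R n M a (dom a) 0). Qed.

(** [Psi] of the zero function is the slice [t] = 1, [rho] = 0 with normal -d/drho. This field has
    constant components, so its covariant derivative is read off [christoffel_M_rho], and its sign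
    cancels the one in the Weingarten convention. *)
Lemma mobius_of0 x : mobius_of delta g alpha (fun=> 0) x = 2^-1 *: alpha_form g alpha x.
Proof.
have ax := manifold_cover hM x; set a := chart_at x in ax.
have PsiE y : Psi delta (fun=> 0) y = pt 1 0 y by rewrite Psi_point expR0.
have T1 : tangent_map (Psi delta (fun=> 0)) x = row_mx 0 1%:M.
  apply/matrixP => k l; move: l; apply: forall_ambient => [||l].
  - rewrite (tangent_Psi _ _ smooth_fun0) (is_pderE (is_pder_cst _ _ _ _)) mulr0.
    by rewrite row_mxEl mxE.
  - by rewrite (tangent_Psi _ _ smooth_fun0) row_mxEl mxE.
  - by rewrite (tangent_Psi _ _ smooth_fun0) row_mxEr mxE.
have Tt k : tangent_map (Psi delta (fun=> 0)) x k idx_t = 0.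
  by rewrite (tangent_Psi _ _ smooth_fun0) (is_pderE (is_pder_cst _ _ _ _)) mulr0.
pose e : 'rV[R]_(1 + 1 + n) := row_mx (row_mx 0 (-1)%:M) 0.
have vecE y : vec_in (ach a) (pt 1 0 y) e = e.
  rewrite /vec_in chart_at_point trans_ambient//; last exact: manifold_cover.
  by rewrite mul_row_block !mulmx0 mulmx1 mul0mx addr0 addr0.
have covE' i : cov_along G (Psi delta (fun=> 0)) (Defs.eta g (fun=> 0)) x (delta_mx 0 i) =
    row_mx 0 (\row_m - shape_comp g alpha a i m x).
  apply/rowP => k; rewrite mxE PsiE chart_at_point -/a.
  rewrite big1 ?add0r => [|j _]; last first.
    rewrite (_ : pder _ _ _ _ = 0) ?mulr0//.
    apply: is_pderE; apply: (is_pder_fext (h := fun=> e 0 k)); last exact: is_pder_cst.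
    by move=> y; rewrite PsiE eta0 -/e vecE.
  have vT p : ((delta_mx 0 i : 'rV[R]_n) *m tangent_map (Psi delta (fun=> 0)) x) 0 p =
      tangent_map (Psi delta (fun=> 0)) x i p by rewrite -rowE mxE.
  have F p : \sum_q christoffel G (ach a) p q k (pt 1 0 x)
      * ((delta_mx 0 i : 'rV[R]_n) *m tangent_map (Psi delta (fun=> 0)) x) 0 p
      * Defs.eta g (fun=> 0) x 0 q =
      - (christoffel G (ach a) p idx_rho k (pt 1 0 x)
         * tangent_map (Psi delta (fun=> 0)) x i p).
    rewrite vT eta0 sum_ambient row_t row_rho !mxE mulr0 add0r.
    rewrite big1 => [|q _]; last by rewrite row_M mxE mulr0.
    by rewrite addr0 mulr1n mulrN1.
  under eq_bigr => p _ do rewrite F.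
  rewrite sum_ambient Tt (tangent_Psi _ _ smooth_fun0) !mulr0 oppr0 !add0r.
  rewrite (bigD1 i)//= [X in _ + X]big1 => [|j ji]; last first.
    by rewrite (tangent_Psi _ _ smooth_fun0) eq_sym (negbTE ji) mulr0 oppr0.
  rewrite (tangent_Psi _ _ smooth_fun0) eqxx mulr1 addr0.
  rewrite (christoffel_M_rho hM delta hg alpha0 smooth_alpha)//.
  move: k {F}; apply: forall_ambient => [||m]; rewrite ambient_rowE.
  - by rewrite oppr0 row_mxEl mxE.
  - by rewrite oppr0 row_mxEl mxE.
  - by rewrite row_M mxE.
(* The induced metric is [g] itself, so projecting a vector already tangent to M returns its
   components. *)
have tanE (s : 'rV[R]_n) : tangential G (Psi delta (fun=> 0)) x (row_mx 0 s) = s.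
  rewrite /tangential T1 PsiE ambient_metric_point// alpha0 mul1mx expr1n scale1r.
  rewrite /ambient_block tr_row_mx !mul_row_block !mul0mx !mulmx0 !add0r !mul_row_col.
  rewrite !trmx0 !mulmx0 !add0r trmx1 !mulmx1 mul1mx.
  by rewrite mulmxK// riemannian_unit.
apply/matrixP => i k; rewrite /mobius_of mxE scalemx_comp.
have -> : rescale (fun=> 0) g x = g x by rewrite /rescale mulr0 expR0 scale1r.
have W m : weingarten G (Psi delta (fun=> 0)) (Defs.eta g (fun=> 0)) x i m = shape_comp g alpha a i m x.
  by rewrite mxE covE' tanE !mxE opprK.
under eq_bigr => m _ do rewrite W.
have ug := riemannian_unit x hg.
rewrite /shape_comp form_in_at//.
have -> : alpha_form g alpha x i k = \sum_p alpha_form g alpha x i p * (invmx (g x) *m g x) p k.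
  rewrite mulVmx// (bigD1 k)//= [1%:M _ _]mxE eqxx mulr1 big1 ?addr0// => p pk.
  by rewrite [1%:M _ _]mxE (negbTE pk) mulr0.
rewrite mulr_sumr.
under [RHS]eq_bigr => p _ do rewrite [(invmx _ *m _) _ _]mxE mulr_sumr mulr_sumr.
rewrite exchange_big/=; apply: eq_bigr => m _.
rewrite mulr_sumr mulr_suml; apply: eq_bigr => p _.
rewrite /form_comp form_in_at//.
have -> : invmx (g x) m p = invmx (g x) p m.
  by have [_ gT _] := hg; rewrite -[in LHS](gT x) -trmx_inv mxE.
by rewrite !mulrA; congr (_ * _); rewrite -mulrA mulrC [_ * 2^-1]mulrC mulrA mulrAC.
Qed.

End Immersion.

Opaque ambient_block.

(** * From the ambient curvature to flatness *)

Section Main.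
Context {R : realType} {M : chartedSpace R 2}.
Hypothesis hM : smooth_manifold M.
Variables (c : set (M -> 'M[R]_2)) (g : M -> 'M[R]_2) (alpha : R -> M -> 'M[R]_2).
Variables (delta : {posnum R}) (D : (M -> 'M[R]_2) -> (M -> 'M[R]_2)).
Hypotheses (hg : riemannian g) (cg : c g) (alpha0 : forall x, alpha 0 x = 1%:M).
Hypothesis smooth_alpha : tensor11_family alpha.
Hypothesis hD : mobius_structure c D.
Hypothesis hDalpha : D g = (fun x => 2^-1 *: alpha_form g alpha x).
Local Notation beta a := (form_comp a (alpha_form g alpha)).

Let two0 : 2 != 0 :> R.
Proof. by rewrite pnatr_eq0. Qed.

Lemma alpha_form_comp a i j x : beta a i j x = 2 * form_comp a (D g) i j x.
Proof. by rewrite /form_comp hDalpha form_inZ scalemx_comp mulrA mulfV// mul1r. Qed.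

(** Being twice [D g], the lowered derivative of [alpha] inherits smoothness from the Moebius
    structure, as it does symmetry in the next lemma. *)
Lemma alpha_form_smooth a i j : smooth_inside a (dom a) (beta a i j).
Proof.
have sda := subdomain_dom hM a.
apply: (smooth_insideP hM sda (f := fun x => 2 * form_comp a (D g) i j x)).
  by move=> x _; rewrite alpha_form_comp.
apply: smooth_insideM => //; first exact: smooth_inside_cst.
exact: (mobius_tensor hD cg).
Qed.

Lemma alpha_form_sym a i j x : beta a i j x = beta a j i x.
Proof.
rewrite !alpha_form_comp; congr (_ * _).
rewrite /form_comp -[in LHS](trmxK (form_in a x (D g x))) mxE form_in_tr.
by rewrite (mobius_sym hD cg).
Qed.

Lemma cotton_comp_alpha_form a i j k x : dom a x ->
  cotton_comp g (alpha_form g alpha) a i j k x = 2 * cotton_comp g (D g) a i j k x.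
Proof.
move=> ax; have sda := subdomain_dom hM a.
have dE i' j' k' : pder a i' (beta a j' k') x = 2 * pder a i' (form_comp a (D g) j' k') x.
  have dD : is_pder a i' (form_comp a (D g) j' k') x (pder a i' (form_comp a (D g) j' k') x).
    by apply: smooth_inside_is_pder ax; exact: (mobius_tensor hD cg).
  apply: is_pderE; apply: (is_pder_fext (fun y => alpha_form_comp a j' k' y)).
  apply: is_pder_eq; first exact (is_pderM hM ax (is_pder_cst a i' 2 x) dD).
  by rewrite mul0r add0r.
rewrite /cotton_comp !dE.
under eq_bigr => l _ do rewrite alpha_form_comp mulrCA.
under [X in _ + X]eq_bigr => l _ do rewrite alpha_form_comp mulrCA.
by rewrite -!mulr_sumr; ring.
Qed.

(** The factor 1/2 of the shape operator cancels the 2 in B = 2 D(g), so the shape operator is the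
    endomorphism of the Cotton-York tensor. *)
Lemma shape_compE x i m :
  shape_comp g alpha (chart_at x) i m x = sharp g (D g) x i m.
Proof.
have [_ gT _] := hg.
rewrite /shape_comp mulr_sumr mxE; apply: eq_bigr => p _.
rewrite alpha_form_comp /form_comp !form_in_at//.
have -> : invmx (g x) m p = invmx (g x) p m.
  by rewrite -[in LHS](gT x) -trmx_inv mxE.
by rewrite mulrCA mulKf// mulrC.
Qed.

(* In dimension 2 the curvature of [g] is determined by [scal g], twice the trace
   of [D g], which makes it cancel against the second fundamental form. *)
Lemma tangential_curvature x i j k m :
  curvature_comp g (chart_at x) i j k m x
   - (2^-1 * beta (chart_at x) j k x * (i == m)%:R
      + form_comp (chart_at x) g j k x * shape_comp g alpha (chart_at x) i m x)
   + (2^-1 * beta (chart_at x) i k x * (j == m)%:R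
      + form_comp (chart_at x) g i k x * shape_comp g alpha (chart_at x) j m x) = 0.
Proof.
rewrite !shape_compE !alpha_form_comp !mulrA !mulVf// !mul1r /form_comp !form_in_at//.
pose E := sharp g (D g) x.
have DE i' j' : D g x i' j' = E i' 0 * g x 0 j' + E i' 1 * g x 1 j'.
  have {1}-> : D g x = E *m g x by rewrite /E /sharp mulmxKV// (riemannian_unit x hg).
  by rewrite mxE sum_ord2.
(* The cancellation is the 2 x 2 identity tr(E) (v ∧ w) = Ev ∧ w + v ∧ Ew, where (v ∧ w) z = g(w,z)
   v - g(v,z) w. *)
have K : scal g x / 2 = E 0 0 + E 1 1.
  by rewrite -(mobius_trace hD cg) /trace_form /mxtrace sum_ord2.
have curv01 := scal_curvature hM hg x; rewrite K in curv01.
rewrite -/E !DE.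
have Z p : curvature_comp g (chart_at x) p p k m x = 0.
  have /eqP := curvature_comp_anti g (chart_at x) p p k m x.
  by rewrite -addr_eq0 -mulr2n mulrn_eq0 => /eqP.
move: i j; apply: forall_ord2; apply: forall_ord2.
- by rewrite Z sub0r addNr.
- rewrite curv01; move: m {Z}; apply: forall_ord2 => /=; ring.
- rewrite curvature_comp_anti curv01; move: m {Z}; apply: forall_ord2 => /=; ring.
- by rewrite Z sub0r addNr.
Qed.

Lemma riemann_Psi u U V W x : smooth_fun u -> vector_field U -> vector_field V ->
  let T := tangent_map (Psi delta u) x in
  riemann (ambient_metric g alpha) (Psi delta u x) (U x *m T) (V x *m T) (W x *m T) =
  row_mx (row_mx (- expR (u x) * cotton_york D g U V W x)%:M 0) 0.
Proof.
move=> su sU sV T; have ax := manifold_cover hM x.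
have TE v := mul_tangent_Psi hM delta x v su.
apply/rowP => l; rewrite Psi_point riemann_ambient ?expR_gt0 ?TE//; last exact: alpha_form_sym.
have C i j k := curvature_M_M_M hM delta hg alpha0 smooth_alpha alpha_form_smooth
  i j k l (expR_gt0 (u x)) ax.
(* The coefficient -t/2 with [t] = e^u meets the factor 2 between the Cotton tensors of B and of
   D(g). *)
transitivity (\sum_i \sum_j \sum_k U x 0 i * V x 0 j * W x 0 k *
  ambient_row (- expR (u x) * cotton_comp g (D g) (chart_at x) i j k x) 0 (fun=> 0) l).
  apply: eq_bigr => i _; apply: eq_bigr => j _; apply: eq_bigr => k _.
  rewrite !TE C; congr (_ * _); move: l {C}; apply: forall_ambient => [||m]; rewrite !ambient_rowE.
  - rewrite cotton_comp_alpha_form//.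
    by field.
  - by [].
  - exact: tangential_curvature.
rewrite (cotton_yorkE hM hg)//; last exact: (mobius_tensor hD cg).
move: l {C}; apply: forall_ambient => [||m].
- rewrite row_t mxE mulr1n mulr_sumr; apply: eq_bigr => i _.
  rewrite mulr_sumr; apply: eq_bigr => j _; rewrite mulr_sumr; apply: eq_bigr => k _.
  by rewrite ambient_rowE mulrCA.
- rewrite row_rho mxE; rewrite big1// => i _; rewrite big1// => j _; rewrite big1// => k _.
  by rewrite ambient_rowE mulr0.
- rewrite row_M mxE; rewrite big1// => i _; rewrite big1// => j _; rewrite big1// => k _.
  by rewrite ambient_rowE mulr0.
Qed.

End Main.

Theorem proposition5p3 (R : realType) (M : chartedSpace R 2)
  (hM : smooth_manifold M)
  (c : set (M -> 'M[R]_2)) (hc : conformal_structure c)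
  (g : M -> 'M[R]_2) (hg : c g)
  (alpha : R -> M -> 'M[R]_2) (halpha : admissible c alpha)
  (delta : {posnum R}) (hdelta : nonsingular_upto alpha delta%:num)
  (htrace : forall x, \tr (alpha_dot alpha 0 x) = scal g x)
  (D : (M -> 'M[R]_2) -> (M -> 'M[R]_2)) (hD : mobius_structure c D)
  (hDalpha : forall u : M -> R, smooth_fun u ->
     D (rescale u g) = mobius_of delta g alpha u) :
  mobius_flat c D <->
  forall u : M -> R, smooth_fun u ->
  forall U V W : M -> 'rV[R]_2,
    vector_field U -> vector_field V -> vector_field W ->
    exists2 Z : M -> 'rV[R]_2, vector_field Z &
      forall x,
        let T := tangent_map (Psi delta u) x in
        riemann (ambient_metric g alpha) (Psi delta u x)
          (U x *m T) (V x *m T) (W x *m T) = Z x *m T.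
Proof.
have [smooth_alpha _ alpha0 _] := halpha.
have [g0 rg0 cE] := hc.
have [u0 su0 gE] : exists2 u, smooth_fun u & g = rescale u g0 by move: hg; rewrite cE.
have rg : riemannian g by rewrite gE; exact: riemannian_rescale.
have smooth0 := @smooth_fun0 R 2 M.
have rescale0 : rescale (fun=> 0) g = g.
  by apply/funext => x; rewrite /rescale mulr0 expR0 scale1r.
have DgE : D g = (fun x => 2^-1 *: alpha_form g alpha x).
  rewrite -[in LHS]rescale0 hDalpha//; apply/funext => x.
  exact: mobius_of0.
have key u U V W x := @riemann_Psi R M hM c g alpha delta D rg hg alpha0 smooth_alpha
  hD DgE u U V W x.
split.
(* With the Cotton-York tensor zero the curvature vanishes outright, so the zero field is the
   witness. *)
- move=> flat u su U V W sU sV sW; exists (fun=> 0).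
    move=> a j; rewrite /smooth_in.
    apply: (smooth_insideP hM (subdomain_dom hM a) _ (smooth_inside_cst a (dom a) 0)).
    by move=> x _; rewrite /vec_in mul0mx mxE.
  by move=> x /=; rewrite key// (flat _ hg)// mulr0 mul0mx scalar_mx0 !row_mx0.
- move=> tangent h ch U V W sU sV sW x.
  have [u su hE] : exists2 u, smooth_fun u & h = rescale u g.
    have [v sv ->] : exists2 v, smooth_fun v & h = rescale v g0 by move: ch; rewrite cE.
    (* [h] and [g] are both given as rescalings of [g0], by [v] and [u0]; their ratio is the
       rescaling by the difference. *)
    exists (fun y => v y - u0 y).
      by move=> a; apply: (smooth_insideB hM (subdomain_dom hM a) (sv a) (su0 a)).
    apply/funext => y; rewrite gE /rescale scalerA -expRD; congr (expR _ *: _); ring.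
  rewrite hE in ch *.
  rewrite (cotton_york_rescale hM rg su hD hg)//.
  (* Tangency for the zero function is enough, conformal invariance having reduced [h] to [g]. *)
  have [Z _ /(_ x)/=] := tangent _ smooth0 U V W sU sV sW.
  rewrite key// => ZE.
  (* The tangent map is the identity on components along M, where the curvature has none; hence [Z]
     vanishes, and with it the d/dt part, which is minus the Cotton-York tensor. *)
  have Z0 : Z x = 0.
    apply/rowP => k; have /rowP/(_ (idx_M k)) := ZE.
    by rewrite row_M (mul_tangent_Psi hM delta x _ smooth0) => <-; rewrite mxE.
  move: ZE; rewrite Z0 mul0mx => /rowP/(_ idx_t).
  by rewrite row_t !mxE expR0 mulr1n mulN1r => /eqP; rewrite oppr_eq0 => /eqP.
Qed.
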